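(* Let $a>0$ and $h\in\mathbb{R}$, $h\neq 0$, be constants. Let $f_{m}\in L^{2}(\mathbb{R})$, $m\in\mathbb{N}$, be such that $f_{m}\to f$ in $L^{2}(\mathbb{R})$ as $m\to\infty$. Consider the equations $$-\frac{d^{2}u_{m}(x)}{dx^{2}}-a\,u_{m}(x-h)=f_{m}(x),\qquad x\in\mathbb{R},\quad m\in\mathbb{N}, \qquad ( *_m)$$ and the limiting equation $$-\frac{d^{2}u(x)}{dx^{2}}-a\,u(x-h)=f(x),\qquad x\in\mathbb{R}. \qquad ( * )$$ a) If $h\neq \frac{2\pi n}{\sqrt{a}}$ for all $n\in\mathbb{Z}$, then each equation $( *_m)$ has a unique solution $u_{m}\in H^{2}(\mathbb{R})$ and the limiting equation $( * )$ has a unique solution $u\in H^{2}(\mathbb{R})$. b) If $h=\frac{2\pi n}{\sqrt{a}}$ for some $n\in\mathbb{Z}$, $n\neq 0$, assume in addition that $xf_{m}(x)\in L^{1}(\mathbb{R})$ for all $m\in\mathbb{N}$, that $xf_{m}(x)\to xf(x)$ in $L^{1}(\mathbb{R})$ as $m\to\infty$, and that the orthogonality relations $$\left(f_{m}(x),\frac{e^{\pm i\sqrt{a}x}}{\sqrt{2\pi}}\right)_{L^{2}(\mathbb{R})}=0$$ (both signs) are valid for all $m\in\mathbb{N}$. Then each equation $( *_m)$ has a unique solution $u_{m}\in H^{2}(\mathbb{R})$ and the limiting equation $( * )$ has a unique solution $u\in H^{2}(\mathbb{R})$. In both cases a) and b), $u_{m}\to u$ in $H^{2}(\mathbb{R})$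 as $m\to\infty$.
   Context: $H^{2}(\mathbb{R})$ is the Sobolev space with norm $\|u\|_{H^{2}(\mathbb{R})}^{2}=\|u\|_{L^{2}(\mathbb{R})}^{2}+\|u''\|_{L^{2}(\mathbb{R})}^{2}$; equations are understood as equalities in $L^{2}(\mathbb{R})$ (almost everywhere). The notation $(f_{1},f_{2})_{L^{2}(\mathbb{R})}:=\int_{\mathbb{R}}f_{1}(x)\overline{f_{2}(x)}\,dx$ is used also when $f_{1}\in L^{1}(\mathbb{R})$ and $f_{2}$ is bounded but not square integrable. (If $g\in L^2(\mathbb{R})$ and $xg\in L^1(\mathbb{R})$, then $g\in L^1(\mathbb{R})$.) *)

(* Defs.v *)
From HB Require Import structures.
From mathcomp Require Import all_boot all_order all_algebra.
From mathcomp Require Import all_classical all_reals all_analysis.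
From mathcomp Require Export complex.

Set Implicit Arguments.
Unset Strict Implicit.
Unset Printing Implicit Defensive.

Import Order.TTheory GRing.Theory Num.Theory.
Import numFieldNormedType.Exports.

Local Open Scope classical_set_scope.
Local Open Scope complex_scope.
Local Open Scope ring_scope.

(* Functions on the line are complex valued.  The Lebesgue measure of the
   library lives on the Borel sets, so measurable means Borel measurable; the
   elements of L^p and H^2 are represented by such functions, and equality in
   these spaces is equality almost everywhere. *)

Section Lp.
Context {R : realType}.
Implicit Types (p : R) (f g : R -> R[i]).

Local Notation mu := (@lebesgue_measure R).

Definition cmeasurable f : Prop :=
  measurable_fun [set: R] (fun x => complex.Re (f x)) /\
  measurable_fun [set: R] (fun x => complex.Im (f x)).

Definition Lpnorm p f : \bar R :=
  Lnorm mu p%:E (fun x => (ComplexField.Normc.normc (f x))%:E).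

Definition Lp p f : Prop := cmeasurable f /\ (Lpnorm p f < +oo)%E.

Definition cvg_Lp p (f_ : nat -> R -> R[i]) f : Prop :=
  Lp p f /\ (fun m => Lpnorm p (f_ m \- f)) @ \oo --> 0%E.

Definition cintegral f : R[i] :=
  Rintegral mu [set: R] (fun x => complex.Re (f x)) +i*
  Rintegral mu [set: R] (fun x => complex.Im (f x)).

Definition inner f g : R[i] := cintegral (fun x => f x * (g x)^*).

Definition expi (t : R) : R[i] := cos t +i* sin t.

End Lp.

Section Sobolev.
Context {R : realType}.
Implicit Types (phi : R -> R) (u v f : R -> R[i]).

Local Notation mu := (@lebesgue_measure R).

Definition test_function phi : Prop :=
  (forall (k : nat) (x : R), derivable (derive1n k phi) x 1) /\
  compact (closure [set x | phi x != 0]).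

(* Real test functions suffice: the identity is linear in phi. *)
Definition weak_derivative (k : nat) u v : Prop :=
  forall phi, test_function phi ->
    cintegral (fun x => u x * (derive1n k phi x)%:C) =
    (-1) ^+ k * cintegral (fun x => v x * (phi x)%:C).

Definition H2 u : Prop :=
  [/\ Lp 2 u,
      exists v, Lp 2 v /\ weak_derivative 1 u v &
      exists v, Lp 2 v /\ weak_derivative 2 u v].

(* The second weak derivative of u; it is determined only up to a null set, and
   it is the zero function by default when u has none in L^2. *)
Definition wderiv2 u : R -> R[i] :=
  xget (fun=> 0) [set v | Lp 2 v /\ weak_derivative 2 u v].

Definition H2norm u : \bar R :=
  (((Lpnorm 2 u) `^ 2 + (Lpnorm 2 (wderiv2 u)) `^ 2) `^ (2^-1))%E.

Definition cvg_H2 (u_ : nat -> R -> R[i]) u : Prop :=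
  (fun m => H2norm (u_ m \- u)) @ \oo --> 0%E.

(* u is an H^2 solution of  - u''(x) - a u(x - h) = f(x). *)
Definition solution (a h : R) f u : Prop :=
  H2 u /\
  {ae mu, forall x, - wderiv2 u x - a%:C * u (x - h) = f x}.

Definition uniquely_solvable (a h : R) f : Prop :=
  exists u, solution a h f u /\
    forall v, solution a h f v -> {ae mu, forall x, v x = u x}.

(* The solutions are unique up to a null set and H2norm is blind to null sets,
   so the last clause does not depend on the representatives of u_m and u. *)
Definition solvable_in_sequences (a h : R) (f_ : nat -> R -> R[i]) f : Prop :=
  [/\ forall m, uniquely_solvable a h (f_ m),
      uniquely_solvable a h f &
      forall (u_ : nat -> R -> R[i]) u,
        (forall m, solution a h (f_ m) (u_ m)) -> solution a h f u ->
        cvg_H2 u_ u].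

End Sobolev.

(* Main.v *)
(* The operator L u = - u'' - a u(. - h) is real, so real and imaginary parts
   are treated separately.  Put k = sqrt a and w = u'' + a u.  Integration by
   parts gives |L u|^2 = |w|^2 + a |u'(. - h) - u'|^2 in L^2.

   If cos (k h) <> 1, variation of constants over one delay expresses
   (cos (k h) - 1) u' - k sin (k h) u through u'(. - h) - u' and w, hence bounds
   it by L u.  As (u', u) = 0, this bounds u', and then a |u|^2 = |u'|^2 + (w, u)
   bounds u.  For existence write u = G v with G the inverse of 1 - d^2/dx^2:
   the bounded operator v |-> L (G v) and its adjoint (the same operator with
   delay - h) are bounded below, and a Neumann series inverts it.

   If k h is a nonzero multiple of 2 pi, the orthogonality relations make
   g'' + a g = - f solvable in L^2, with |g| controlled by the weighted L^1 norm
   of f, and L u = f becomes u + S u = g for the window operator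
   S u (x) = - k \int_(x - h)^x sin (k (x - y)) u(y) dy.  With the companion
   C u (x) = \int_(x - h)^x cos (k (x - y)) u(y) dy, one has
   |u + S u|^2 = |u|^2 + a |C u|^2, so the Neumann series applies again.

   The weak formulation is linked to absolutely continuous representatives by
   the du Bois-Reymond lemma. *)

Require Import Defs.
From HB Require Import structures.
From mathcomp Require Import all_boot all_order all_algebra.
From mathcomp Require Import all_classical all_reals all_analysis.
From mathcomp Require Import measurable_realfun.
From mathcomp Require Import complex.
From mathcomp Require Import ring lra.

Set Implicit Arguments.
Unset Strict Implicit.
Unset Printing Implicit Defensive.

Import Order.TTheory GRing.Theory Num.Theory.
Import numFieldNormedType.Exports.

Local Open Scope classical_set_scope.
Local Open Scope complex_scope.
Local Open Scope ring_scope.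

(** On the Fourier side L multiplies by p^2 - a e^(-i h p), and |p^2 - a e^(-i h p)|^2 = (p^2 - a)^2
    + 2 a p^2 (1 - cos (h p)). For real p this vanishes only if p^2 = a and cos (k h) = 1, whence
    the two cases. The energy identity is this formula read through Plancherel. At resonance 1 + S
    is the quotient of p^2 - a e^(-i h p) by p^2 - a, an entire function of modulus at least 1 on
    the line; the division by p^2 - a is left to the auxiliary equation for g. The proof itself
    stays on the physical side: multiplier bounds become integrations by parts and kernel estimates.
    A lower bound on an operator gives injectivity only; surjectivity needs it for the adjoint, and
    it is available because replacing h by - h preserves both cases. Both cases end in one estimate
    of |u|^2 + |u''|^2 by the data. By linearity it is applied to differences and yields uniqueness
    and convergence alike. In case b) it covers f_m - f only because f inherits the orthogonality
    relations, which are assumed for the f_m alone. *)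

#[local] Instance ae_lebesgue_filter (R : realType) :
    Filter (nbhs (almost_everywhere (@lebesgue_measure R))) :=
  ae_filter_ringOfSetsType (@lebesgue_measure R).

(** * Square integrable functions *)

Section L2theory.
Context {R : realType}.
Implicit Types (f g u v : R -> R) (x y c : R).

Local Notation mu := (@lebesgue_measure R).
Local Notation meas f := (measurable_fun [set: R] f).
Local Notation int f := (Rintegral mu [set: R] f).

Definition integ f := mu.-integrable [set: R] (EFin \o f).

Lemma integ_meas f : integ f -> meas f.
Proof. by move=> /integrableP[/measurable_EFinP]. Qed.

Lemma le_integ f g : meas f -> (forall x, `|f x| <= g x) -> integ g -> integ f.
Proof.
move=> mf fg; apply: le_integrable => //; first exact/measurable_EFinP.
by move=> x _ /=; rewrite lee_fin (le_trans (fg x))// ler_norm.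
Qed.

Lemma integD f g : integ f -> integ g -> integ (fun x => f x + g x).
Proof. by move=> hf hg; apply: eq_integrable (integrableD _ hf hg) => //. Qed.

Lemma integZ c f : integ f -> integ (fun x => c * f x).
Proof. by move=> hf; apply: eq_integrable (integrableZl _ c hf) => //. Qed.

Lemma integB f g : integ f -> integ g -> integ (fun x => f x - g x).
Proof. by move=> hf hg; apply: eq_integrable (integrableB _ hf hg) => //. Qed.

Lemma integ_norm f : integ f -> integ (fun x => `|f x|).
Proof. by move/integrable_norm. Qed.

Lemma integ0 : integ (fun _ => 0).
Proof. exact: integrable0. Qed.

Lemma intD f g : integ f -> integ g ->
  int (fun x => f x + g x) = int f + int g.
Proof. exact: RintegralD. Qed.

Lemma intB f g : integ f -> integ g ->
  int (fun x => f x - g x) = int f - int g.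
Proof. exact: RintegralB. Qed.

Lemma intZ c f : integ f -> int (fun x => c * f x) = c * int f.
Proof. by move=> hf; rewrite RintegralZl. Qed.

Lemma int_ge0 f : (forall x, 0 <= f x) -> 0 <= int f.
Proof. by move=> h; apply: Rintegral_ge0. Qed.

Lemma le_int f g : integ f -> integ g -> (forall x, f x <= g x) ->
  int f <= int g.
Proof. by move=> hf hg h; apply: le_Rintegral. Qed.

Lemma integ_ae f g : integ f -> meas g -> {ae mu, forall x, g x = f x} ->
  integ g.
Proof.
move=> /integrableP[mf fi] mg gf; apply/integrableP; split.
  exact/measurable_EFinP.
rewrite (_ : integral _ _ _ = \int[mu]_x `|(f x)%:E|)%E//.
apply: ae_eq_integral => //.
- by apply: measurableT_comp => //; exact/measurable_EFinP.
- by apply: measurableT_comp.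
- by move: gf; apply: filterS => x gfx _ /=; rewrite gfx.
Qed.

(** Measurability suffices: the extended integrals already agree, whether finite or not. *)
Lemma int_ae f g : meas f -> meas g -> {ae mu, forall x, f x = g x} ->
  int f = int g.
Proof.
move=> mf mg fg; congr fine; apply: ae_eq_integral => //;
  try exact/measurable_EFinP.
by move: fg; apply: filterS => x fgx _ /=; rewrite fgx.
Qed.

Lemma int_eq0 f : integ f -> (forall x, 0 <= f x) -> int f = 0 ->
  {ae mu, forall x, f x = 0}.
Proof.
move=> fi f0 /eqP.
rewrite fine_eq0; last exact: integrable_fin_num.
move=> /eqP if0.
have mf : measurable_fun [set: R] (EFin \o f) by apply: measurable_int fi.
have : ae_eq mu [set: R] (EFin \o f) (cst 0%E).
  apply/(ae_eq_integral_abs mu measurableT mf).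
  rewrite -if0; apply: eq_integral => x _ /=; by rewrite ger0_norm.
by apply: filterS => x /(_ Logic.I) /= [].
Qed.

Definition L2 f := meas f /\ integ (fun x => f x ^+ 2).

Lemma L2_meas f : L2 f -> meas f. Proof. by case. Qed.

Lemma L2_mul f g : L2 f -> L2 g -> integ (fun x => f x * g x).
Proof.
move=> [mf f2] [mg g2]; apply: le_integ (integD f2 g2).
  exact: measurable_funM.
move=> x; have := sqr_ge0 (f x + g x); have := sqr_ge0 (f x - g x).
by rewrite ler_norml => ? ?; apply/andP; split; nra.
Qed.

Lemma le_L2 f g : meas f -> (forall x, `|f x| <= `|g x|) -> L2 g -> L2 f.
Proof.
move=> mf fg [_ g2]; split=> //; apply: le_integ g2.
  by apply: measurable_funX.
by move=> x; rewrite ger0_norm ?sqr_ge0// -[leLHS]real_normK ?num_real//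
  -[leRHS]real_normK ?num_real// ler_pXn2r ?nnegrE.
Qed.

Lemma L2D f g : L2 f -> L2 g -> L2 (fun x => f x + g x).
Proof.
move=> hf hg; split; first exact: measurable_funD hf.1 hg.1.
apply: le_integ (integD (integZ 2 hf.2) (integZ 2 hg.2)).
  by apply: measurable_funX; apply: measurable_funD hf.1 hg.1.
move=> x; rewrite ger0_norm ?sqr_ge0//.
by have := sqr_ge0 (f x - g x); nra.
Qed.

Lemma L2Z c f : L2 f -> L2 (fun x => c * f x).
Proof.
move=> [mf f2]; split; first exact: measurable_funM.
under eq_fun do rewrite exprMn; exact: integZ.
Qed.

Lemma L2_eq f g : L2 f -> (forall x, f x = g x) -> L2 g.
Proof. by move=> + /funext <-. Qed.

Lemma L2N f : L2 f -> L2 (fun x => - f x).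
Proof. by move=> /(L2Z (-1)) /L2_eq; apply => x; rewrite mulN1r. Qed.

Lemma L2B f g : L2 f -> L2 g -> L2 (fun x => f x - g x).
Proof. by move=> hf /L2N hg; apply: L2D. Qed.

Lemma L2_ae f g : L2 f -> meas g -> {ae mu, forall x, g x = f x} -> L2 g.
Proof.
move=> [mf f2] mg gf; split=> //; apply: integ_ae f2 _ _.
  exact: measurable_funX.
by move: gf; apply: filterS => x ->.
Qed.

Lemma L2_0 : L2 (fun=> 0).
Proof. by split=> //; under eq_fun do rewrite expr0n /=; exact: integ0. Qed.

Definition ip f g := int (fun x => f x * g x).

Lemma ipC f g : ip f g = ip g f.
Proof. by apply: eq_Rintegral => x _; rewrite mulrC. Qed.

Lemma ipDl f g v : L2 f -> L2 g -> L2 v ->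
  ip (fun x => f x + g x) v = ip f v + ip g v.
Proof.
move=> hf hg hv; rewrite -intD; [|exact: L2_mul..].
by apply: eq_Rintegral => x _; rewrite mulrDl.
Qed.

Lemma ipZl c f v : L2 f -> L2 v -> ip (fun x => c * f x) v = c * ip f v.
Proof.
move=> hf hv; rewrite -intZ; last exact: L2_mul.
by apply: eq_Rintegral => x _; rewrite mulrA.
Qed.

Lemma ipNl f v : L2 f -> L2 v -> ip (fun x => - f x) v = - ip f v.
Proof.
move=> hf hv; rewrite -mulN1r -ipZl//.
by apply: eq_Rintegral => x _; rewrite mulN1r.
Qed.

Lemma ipBl f g v : L2 f -> L2 g -> L2 v ->
  ip (fun x => f x - g x) v = ip f v - ip g v.
Proof. by move=> hf hg hv; rewrite ipDl ?ipNl//; exact: L2N. Qed.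

Lemma ipDr f g v : L2 f -> L2 g -> L2 v ->
  ip v (fun x => f x + g x) = ip v f + ip v g.
Proof. by move=> *; rewrite ipC ipDl// !(ipC v). Qed.

Lemma ipZr c f v : L2 f -> L2 v -> ip v (fun x => c * f x) = c * ip v f.
Proof. by move=> *; rewrite ipC ipZl// (ipC v). Qed.

Lemma ipBr f g v : L2 f -> L2 g -> L2 v ->
  ip v (fun x => f x - g x) = ip v f - ip v g.
Proof. by move=> *; rewrite ipC ipBl// !(ipC v). Qed.

Lemma ip_ae f f' g g' : L2 f -> L2 f' -> L2 g -> L2 g' ->
  {ae mu, forall x, f x = f' x} -> {ae mu, forall x, g x = g' x} ->
  ip f g = ip f' g'.
Proof.
move=> hf hf' hg hg' ff gg; apply: int_ae.
- exact: measurable_funM hf.1 hg.1.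
- exact: measurable_funM hf'.1 hg'.1.
- by move: ff gg; apply: filterS2 => x -> ->.
Qed.

Definition nsq f := ip f f.

Lemma nsq_ge0 f : 0 <= nsq f.
Proof. by apply: int_ge0 => x; rewrite -expr2 sqr_ge0. Qed.

Lemma nsqE f : nsq f = int (fun x => f x ^+ 2).
Proof. by apply: eq_Rintegral => x _; rewrite expr2. Qed.

Lemma nsq_eq0 f : L2 f -> nsq f <= 0 -> {ae mu, forall x, f x = 0}.
Proof.
move=> [mf f2] n0; have : int (fun x => f x ^+ 2) = 0.
  by rewrite -nsqE; apply/eqP; rewrite eq_le n0 nsq_ge0.
move=> /(int_eq0 f2) h; have /h : forall x, 0 <= f x ^+ 2.
  by move=> x; exact: sqr_ge0.
by apply: filterS => x /eqP; rewrite sqrf_eq0 => /eqP.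
Qed.

Lemma nsq_ae f g : L2 f -> L2 g -> {ae mu, forall x, f x = g x} ->
  nsq f = nsq g.
Proof. by move=> hf hg fg; exact: ip_ae. Qed.

Lemma nsqZ c f : L2 f -> nsq (fun x => c * f x) = c ^+ 2 * nsq f.
Proof. by move=> hf; rewrite /nsq ipZl ?ipZr ?mulrA//; exact: L2Z. Qed.

Lemma nsqN f : nsq (fun x => - f x) = nsq f.
Proof. by apply: eq_Rintegral => x _; rewrite mulrNN. Qed.

Lemma nsqD f g : L2 f -> L2 g ->
  nsq (fun x => f x + g x) = nsq f + 2 * ip f g + nsq g.
Proof.
move=> hf hg; rewrite /nsq ipDl ?ipDr//; last exact: L2D.
by rewrite (ipC g f); ring.
Qed.

Lemma nsqB f g : L2 f -> L2 g ->
  nsq (fun x => f x - g x) = nsq f - 2 * ip f g + nsq g.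
Proof.
move=> hf hg; rewrite /nsq ipBl ?ipBr//; last exact: L2B.
by rewrite (ipC g f); ring.
Qed.

Lemma cauchy_schwarz f g : L2 f -> L2 g -> ip f g ^+ 2 <= nsq f * nsq g.
Proof.
move=> hf hg.
have H t : 0 <= nsq f + 2 * t * ip f g + t ^+ 2 * nsq g.
  have := nsq_ge0 (fun x => f x + t * g x).
  rewrite nsqD//; last exact: L2Z.
  by rewrite ipZr// nsqZ// mulrA.
have := nsq_ge0 g; have := nsq_ge0 f.
have [g0|g0] := eqVneq (nsq g) 0.
  move=> f0 _; rewrite g0 mulr0; move: H; rewrite g0.
  have [->|i0] := eqVneq (ip f g) 0; first by rewrite expr0n.
  (* With [nsq g = 0] the quadratic is affine in t; at this t it equals - [nsq f] - 2 < 0. *)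
  move=> /(_ (- (nsq f + 1) / ip f g)).
  by rewrite mulr0 addr0 -mulrA divfK//; lra.
move=> f0 gge; have {gge}ggt : 0 < nsq g by rewrite lt0r g0.
(* The minimiser of the quadratic in t. *)
have := H (- ip f g / nsq g).
rewrite (_ : nsq f + _ + _ = (nsq f * nsq g - ip f g ^+ 2) / nsq g); last first.
  by field.
by rewrite pmulr_lge0 ?invr_gt0// subr_ge0.
Qed.

Lemma nsqD_le f g : L2 f -> L2 g ->
  nsq (fun x => f x + g x) <= 2 * nsq f + 2 * nsq g.
Proof.
by move=> hf hg; have := nsq_ge0 (fun x => f x - g x); rewrite nsqB// nsqD//; lra.
Qed.

End L2theory.

(** * Absolutely continuous functions *)

Section AC.
Context {R : realType}.
Implicit Types (f g u v p q : R -> R) (x y c : R).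

Local Notation mu := (@lebesgue_measure R).
Local Notation meas f := (measurable_fun [set: R] f).
Local Notation int f := (Rintegral mu [set: R] f).

Definition J x y f := Rintegral mu `[x, y] f.

Definition locint f := meas f /\ forall x y, mu.-integrable `[x, y] (EFin \o f).

Lemma integ_locint f : integ f -> locint f.
Proof.
by move=> hf; split; [exact: integ_meas|move=> x y; exact: integrableS hf].
Qed.

Lemma cont_meas f : continuous f -> meas f.
Proof. exact: continuous_measurable_fun. Qed.

Lemma cont_locint f : continuous f -> locint f.
Proof.
move=> cf; split; first exact: cont_meas.
move=> x y; apply: continuous_compact_integrable; first exact: segment_compact.
exact: continuous_subspaceT.
Qed.

Lemma locint_mul_cont f g : locint f -> continuous g ->
  locint (fun x => f x * g x).
Proof.
move=> [mf hf] cg; split.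
  by apply: measurable_funM => //; exact: cont_meas.
move=> x y.
have := @integrableMl _ _ _ mu `[x, y] (measurable_itv _) (EFin \o f) g (hf x y).
have mg : measurable_fun `[x, y] g.
  by apply: measurable_funS (cont_meas cg).
have bg : [bounded g z | z in `[x, y]].
  have /compact_bounded[M [Mr hM]] := continuous_compact
    (continuous_subspaceT cg) (@segment_compact R x y).
  by exists M; split=> // r Mr' z zI; apply: hM => //; exists z.
by move=> /(_ mg bg); apply: eq_integrable.
Qed.

Lemma locintD f g : locint f -> locint g -> locint (fun x => f x + g x).
Proof.
move=> [mf hf] [mg hg]; split; first exact: measurable_funD.
by move=> x y; apply: eq_integrable (integrableD _ (hf x y) (hg x y)).
Qed.

Lemma locintZ c f : locint f -> locint (fun x => c * f x).
Proof.
move=> [mf hf]; split; first exact: measurable_funM.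
by move=> x y; apply: eq_integrable (integrableZl _ c (hf x y)).
Qed.

(** |f| <= f^2 + 1, and constants are integrable on segments. *)
Lemma L2_locint f : L2 f -> locint f.
Proof.
move=> [mf f2]; split=> // x y.
apply: (@le_integrable _ _ _ mu _ _ _ (EFin \o (fun t => f t ^+ 2 + 1))).
- exact: measurable_itv.
- by apply/measurable_EFinP; exact: measurable_funS mf.
- move=> t _ /=; rewrite lee_fin [leRHS]ger0_norm; last first.
    by rewrite addr_ge0// sqr_ge0.
  by have := sqr_ge0 (f t - 1); have := sqr_ge0 (f t + 1);
    rewrite ler_norml => ? ?; apply/andP; split; nra.
- have := (locintD (integ_locint f2) (cont_locint (@cst_continuous _ _ (1:R)))).2.
  exact.
Qed.

Lemma JD x y f g : locint f -> locint g ->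
  J x y (fun t => f t + g t) = J x y f + J x y g.
Proof. by move=> [_ hf] [_ hg]; rewrite /J RintegralD. Qed.

Lemma JZ x y c f : locint f -> J x y (fun t => c * f t) = c * J x y f.
Proof. by move=> [_ hf]; rewrite /J RintegralZl. Qed.

Lemma J_ae x y f g : meas f -> meas g -> {ae mu, forall t, f t = g t} ->
  J x y f = J x y g.
Proof.
move=> mf mg fg; congr fine; apply: ae_eq_integral => //.
- by apply/measurable_EFinP; exact: measurable_funS mf.
- by apply/measurable_EFinP; exact: measurable_funS mg.
- by move: fg; apply: filterS => t fgx _ /=; rewrite fgx.
Qed.

(* p is locally absolutely continuous with density p1 *)
Definition AC p p1 := locint p1 /\ forall x y, x <= y -> p y - p x = J x y p1.

Lemma AC_D p p1 q q1 : AC p p1 -> AC q q1 ->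
  AC (fun x => p x + q x) (fun x => p1 x + q1 x).
Proof.
move=> [lp hp] [lq hq]; split; first exact: locintD.
by move=> x y xy; rewrite JD// -hp// -hq//; ring.
Qed.

Lemma AC_Z c p p1 : AC p p1 -> AC (fun x => c * p x) (fun x => c * p1 x).
Proof.
move=> [lp hp]; split; first exact: locintZ.
by move=> x y xy; rewrite JZ// -hp//; ring.
Qed.

Lemma AC_eq p p1 q q1 : AC p p1 -> (forall x, p x = q x) ->
  (forall x, p1 x = q1 x) -> AC q q1.
Proof. by move=> + /funext <- /funext <-. Qed.

Lemma AC_N p p1 : AC p p1 -> AC (fun x => - p x) (fun x => - p1 x).
Proof. by move=> /(AC_Z (-1)) /AC_eq; apply => x; rewrite mulN1r. Qed.

Lemma AC_B p p1 q q1 : AC p p1 -> AC q q1 ->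
  AC (fun x => p x - q x) (fun x => p1 x - q1 x).
Proof. by move=> hp /AC_N; exact: AC_D. Qed.

Lemma AC_cont p p1 : AC p p1 -> continuous p.
Proof.
move=> [[mp lp] hp] x.
have xx : x - 1 <= x + 1 by lra.
have := parameterized_integral_continuous xx (lp _ _).
have x11 : (x - 1 < x + 1) by lra.
move=> /(continuous_within_itvP _ x11)[/(_ x) H _ _].
have {}H : {for x, continuous (fun y => parameterized_integral mu (x - 1) y p1)}.
  by apply: H; rewrite in_itv/=; apply/andP; split; lra.
have : {for x, continuous (fun y => p (x - 1) +
   parameterized_integral mu (x - 1) y p1)}.
  by apply: continuousD => //; exact: cst_continuous.
have E : \forall y \near x, p (x - 1) +
   parameterized_integral mu (x - 1) y p1 = p y.
  near=> y; have : x - 1 <= y.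
    by apply: ltW; near: y; apply: lt_nbhsr; lra.
  by move=> /hp; rewrite /parameterized_integral -/(J _ _ _) => <-; ring.
move=> C; rewrite /continuous_at.
rewrite (_ : p x = p (x - 1) + parameterized_integral mu (x - 1) x p1); last first.
  by rewrite /parameterized_integral -/(J _ _ _) -hp; [ring|lra].
apply: cvg_trans C; apply: near_eq_cvg.
by move: E; apply: filterS.
Unshelve. all: by end_near. Qed.

Lemma AC_meas p p1 : AC p p1 -> meas p.
Proof. by move=> /AC_cont; exact: cont_meas. Qed.

Lemma AC_C1 p p1 : (forall x, is_derive x (1:R) p (p1 x)) -> continuous p1 ->
  AC p p1.
Proof.
move=> dp cp1; split; first exact: cont_locint.
have cp : continuous p.
  by move=> x; apply/differentiable_continuous/derivable1_diffP; exact: ex_derive.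
move=> x y; rewrite le_eqVlt => /predU1P[->|xy].
  by rewrite subrr /J set_itv1 Rintegral_set1.
rewrite /J /Rintegral (@continuous_FTC2 _ p1 p _ _ xy (continuous_subspaceT cp1)) //=.
- split; first by move=> z _; exact: ex_derive.
  + by apply: cvg_at_right_filter; exact: cp.
  + by apply: cvg_at_left_filter; exact: cp.
- by move=> z _; rewrite derive1E; exact: derive_val.
Qed.


Lemma integ_prod f g : integ f -> integ g ->
  ((mu \x mu)%E).-integrable [set: R * R] (fun z => (f z.1 * g z.2)%:E).
Proof.
move=> hf hg.
have mfg : measurable_fun [set: R * R] (fun z => f z.1 * g z.2).
  apply: measurable_funM.
  - by apply: measurableT_comp; [exact: integ_meas|exact: measurable_fst].
  - by apply: measurableT_comp; [exact: integ_meas|exact: measurable_snd].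
apply/integrable12ltyP; first exact/measurable_EFinP.
rewrite (_ : (fun x => _) = (fun x => `|f x|%:E * (\int[mu]_y `|(g y)%:E|))%E); last first.
  apply/funext => x; rewrite -ge0_integralZl//.
  - by apply: eq_integral => y _ /=; rewrite normrM EFinM.
  - by apply: measurableT_comp => //; apply/measurable_EFinP; exact: integ_meas.
have /integrableP[_ gi] := hg; have /integrableP[_ fi] := hf.
rewrite ge0_integralZr//.
- apply: lte_mul_pinfty => //; [exact: integral_ge0|].
  by rewrite ge0_fin_numE//; exact: integral_ge0.
- by apply/measurable_EFinP; apply: measurableT_comp => //; exact: integ_meas.
- exact: integral_ge0.
Qed.

(** Integrability on the plane controls almost every slice only; asking it of every slice makes the
    inner real integrals agree with the extended ones at every point. *)
Lemma Rfubini (F : R * R -> R) :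
  ((mu \x mu)%E).-integrable [set: R * R] (EFin \o F) ->
  (forall x, integ (fun y => F (x, y))) ->
  (forall y, integ (fun x => F (x, y))) ->
  int (fun x => int (fun y => F (x, y))) = int (fun y => int (fun x => F (x, y))).
Proof.
move=> hF h1 h2; rewrite /Rintegral; congr fine.
transitivity (\int[mu]_x \int[mu]_y (EFin \o F) (x, y))%E.
  by apply: eq_integral => x _; rewrite fineK//; apply: integrable_fin_num (h1 x).
rewrite (Fubini hF); apply: eq_integral => y _.
by rewrite fineK//; apply: integrable_fin_num (h2 y).
Qed.

End AC.

(** * Integration by parts on segments and on the line *)

Section IBP.
Context {R : realType}.
Implicit Types (f g u v p q : R -> R) (x y c : R).

Local Notation mu := (@lebesgue_measure R).
Local Notation meas f := (measurable_fun [set: R] f).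
Local Notation int f := (Rintegral mu [set: R] f).

(** Restriction by values rather than by domain: integrals over segments become integrals over the
    line, to which Fubini and translation invariance apply. *)
Definition cut x y f := fun t => if x <= t <= y then f t else 0.

Lemma cutE x y f : cut x y f = f \_ `[x, y].
Proof.
by apply/funext => t; rewrite patchE /cut mem_setE in_itv.
Qed.

Lemma J_cut x y f : J x y f = int (cut x y f).
Proof. by rewrite cutE /J [LHS]Rintegral_mkcond. Qed.

Lemma integ_cut x y f : locint f -> integ (cut x y f).
Proof.
move=> [_ /(_ x y)]; rewrite cutE /integ => hf.
rewrite -restrict_EFin.
exact/(@integrable_mkcond _ _ _ mu `[x, y]).
Qed.

(** Both closed segments contain y, so the cuts add up only off this one point. *)
Lemma J_split x y z f : locint f -> x <= y -> y <= z ->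
  J x z f = J x y f + J y z f.
Proof.
move=> lf xy yz; rewrite !J_cut -intD; [|exact: integ_cut..].
apply: int_ae.
- by apply: integ_meas; exact: integ_cut.
- by apply: integ_meas; apply: integD; exact: integ_cut.
exists [set y]; split; [exact: measurable_set1|exact: lebesgue_measure_set1|].
have E (t : R) : t != y -> cut x z f t = cut x y f t + cut y z f t.
  move=> ty; rewrite /cut; have [ty'|ty'] := ltP t y.
    by rewrite (le_trans (ltW ty') yz) (ltW ty') !andbT/= addr0.
  have {}ty : y < t by rewrite lt_neqAle eq_sym ty.
  by rewrite (lt_geF ty) (le_trans xy (ltW ty)) andbF/= add0r.
by move=> t /=; apply: contra_notP => /eqP /E.
Qed.

Lemma locint_AC f c : locint f ->
  AC (fun x => if c <= x then J c x f else - J x c f) f.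
Proof.
move=> lf; split=> // x y xy.
have [cx|cx] := leP c x.
  by rewrite (le_trans cx xy) (J_split lf cx xy); ring.
have [cy|cy] := leP c y.
  by rewrite (J_split lf (ltW cx) cy); ring.
by rewrite (J_split lf xy (ltW cy)); ring.
Qed.

(** Fubini for p1 s * q1 t on the triangle s <= t of the square [A, B]^2: integrating in t first
    gives p1 s * (q B - q s), integrating in s first gives q1 t * (p t - p A). *)
Lemma J_ibp p p1 q q1 A B : AC p p1 -> AC q q1 -> A <= B ->
  J A B (fun x => p1 x * q x + p x * q1 x) = p B * q B - p A * q A.
Proof.
move=> hp hq AB.
pose P := cut A B p1; pose Q := cut A B q1.
have iP : integ P by apply: integ_cut; case: hp.
have iQ : integ Q by apply: integ_cut; case: hq.
pose F (z : R * R) := if z.1 <= z.2 then P z.1 * Q z.2 else 0.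
have mF : measurable_fun [set: R * R] F.
  apply: measurable_fun_ifT => //.
    by apply: measurable_fun_ler; [exact: measurable_fst|exact: measurable_snd].
  apply: measurable_funM.
  - by apply: measurableT_comp; [exact: integ_meas|exact: measurable_fst].
  - by apply: measurableT_comp; [exact: integ_meas|exact: measurable_snd].
have iF : ((mu \x mu)%E).-integrable [set: R * R] (EFin \o F).
  apply: le_integrable (integ_prod iP iQ) => //; first exact/measurable_EFinP.
  by move=> z _ /=; rewrite lee_fin /F; case: ifP => // _; rewrite normr0.
have E1 s : (fun t => F (s, t)) = (fun t => P s * cut s B q1 t).
  apply/funext => t; rewrite /F/= /P /Q /cut.
  have [/andP[As sB]|nAsB] := boolP (A <= s <= B); last by rewrite !mul0r if_same.
  have [st|st] := leP s t; last by rewrite mulr0.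
  by rewrite (le_trans As st).
have E2 t : (fun s => F (s, t)) = (fun s => Q t * cut A t p1 s).
  apply/funext => s; rewrite /F/= /P /Q /cut.
  have [/andP[At tB]|nAtB] := boolP (A <= t <= B); last by rewrite !(mulr0, mul0r) if_same.
  have [st|st] := leP s t; last by rewrite andbF mulr0.
  by rewrite (le_trans st tB) !andbT mulrC.
have := Rfubini iF.
have h1 x : integ (fun y => F (x, y)).
  by rewrite E1; apply: integZ; apply: integ_cut; case: hq.
have h2 y : integ (fun x => F (x, y)).
  by rewrite E2; apply: integZ; apply: integ_cut; case: hp.
move=> /(_ h1 h2).
have lpq : locint (fun x => p1 x * q x).
  by apply: locint_mul_cont hp.1 (AC_cont hq).
have lqp : locint (fun x => q1 x * p x).
  by apply: locint_mul_cont hq.1 (AC_cont hp).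
have -> : int (fun x => int (fun y => F (x, y))) =
    q B * J A B p1 - J A B (fun x => p1 x * q x).
  have -> : (fun x => int (fun y => F (x, y))) =
     (cut A B (fun x => q B * p1 x + (-1) * (p1 x * q x))).
    apply/funext => s; rewrite E1 intZ; last by apply: integ_cut; case: hq.
    rewrite -J_cut /P /cut; case: ifPn; last by rewrite mul0r.
    by move=> /andP[As sB]; rewrite -hq.2//; ring.
  rewrite -J_cut JD ?JZ ?mulN1r//; [exact: hp.1|apply: locintZ; exact: hp.1|exact: locintZ].
have -> : int (fun y => int (fun x => F (x, y))) =
    J A B (fun x => q1 x * p x) - p A * J A B q1.
  have -> : (fun y => int (fun x => F (x, y))) =
     (cut A B (fun x => q1 x * p x + (- p A) * (q1 x))).
    apply/funext => t; rewrite E2 intZ; last by apply: integ_cut; case: hp.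
    rewrite -J_cut /Q /cut; case: ifPn; last by rewrite mul0r.
    by move=> /andP[At tB]; rewrite -hp.2//; ring.
  rewrite -J_cut JD ?JZ ?mulNr//; [exact: hq.1|apply: locintZ; exact: hq.1].
rewrite JD//; last by under eq_fun do rewrite mulrC.
rewrite [J A B (fun x => p x * _)](_ : _ = J A B (fun x => q1 x * p x)); last first.
  by apply: eq_Rintegral => x _; rewrite mulrC.
by rewrite -hp.2// -hq.2// => E; lra.
Qed.

Lemma AC_M p p1 q q1 : AC p p1 -> AC q q1 ->
  AC (fun x => p x * q x) (fun x => p1 x * q x + p x * q1 x).
Proof.
move=> hp hq; split.
  apply: locintD; first exact: locint_mul_cont hp.1 (AC_cont hq).
  by under eq_fun do rewrite mulrC; exact: locint_mul_cont hq.1 (AC_cont hp).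
by move=> x y xy; rewrite (J_ibp hp hq).
Qed.

Lemma AC_const p p1 : AC p p1 -> {ae mu, forall x, p1 x = 0} ->
  forall x y, p x = p y.
Proof.
move=> hp p0.
suff H x y : x <= y -> p x = p y.
  by move=> x y; have [/H//|/ltW/H->] := leP x y.
move=> xy; apply/esym/eqP; rewrite -subr_eq0 hp.2//.
have -> : J x y p1 = J x y (fun=> 0).
  by apply: J_ae => //; case: hp => -[].
by rewrite J_cut /cut; under eq_Rintegral do rewrite if_same;
  rewrite /Rintegral integral0.
Qed.

Lemma Rdct (f_ : nat -> R -> R) f g : (forall n, meas (f_ n)) -> meas f ->
  {ae mu, forall x, f_ ^~ x @ \oo --> f x} -> integ g ->
  (forall n x, `|f_ n x| <= g x) -> (fun n => int (f_ n)) @ \oo --> int f.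
Proof.
move=> mf_ mf ff ig fg.
have mE n : measurable_fun [set: R] (EFin \o f_ n).
  apply/measurable_EFinP. exact: mf_.
have mE' : measurable_fun [set: R] (EFin \o f) by exact/measurable_EFinP.
have [] := @dominated_convergence _ _ R mu [set: R] measurableT
  (fun n => EFin \o f_ n) (EFin \o f) (EFin \o g).
- exact: mE.
- exact: mE'.
- move: ff; apply: filterS => x h _ /=.
  by apply: cvg_EFin; first exact: nearW.
- exact: ig.
- by apply: aeW => x n _ /=; rewrite lee_fin; exact: fg.
move=> hf _ H; apply: fine_cvg.
by rewrite fineK//; exact: integrable_fin_num hf.
Qed.

(** The parabola 1 - x^2 / (n + 1)^2 vanishes at the ends of [- (n + 1), n + 1], so integrating the
    derivative of p times it leaves no boundary term, and no decay of p at infinity has to be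
    proved. Its slope is at most 2 there, which gives the majorant |p1| + 2 |p|. *)
Lemma int_deriv0 p p1 : AC p p1 -> integ p -> integ p1 -> int p1 = 0.
Proof.
move=> hp ip ip1.
pose chi n x := 1 - n.+1%:R^-2 * x ^+ 2 : R.
pose chi1 n x := - n.+1%:R^-2 * (2 * x) : R.
have hchi n : AC (chi n) (chi1 n).
  apply: AC_C1.
    move=> x; rewrite /chi /chi1.
    by apply: is_derive_eq; rewrite /GRing.scale/=; ring.
  by move=> x; apply: cvgM; [exact: cvg_cst|apply: cvgM; [exact: cvg_cst|exact: cvg_id]].
pose f_ n := cut (- n.+1%:R) n.+1%:R (fun x => p1 x * chi n x + p x * chi1 n x).
have mn : (fun n => int (f_ n)) @ \oo --> int p1.
  apply: (@Rdct f_ p1 (fun x => `|p1 x| + 2 * `|p x|)).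
  - by move=> n; apply: integ_meas; apply: integ_cut; exact: (AC_M hp (hchi n)).1.
  - apply: integ_meas; exact: ip1.
  - apply: aeW => x.
    have H : (fun n => p1 x * chi n x + p x * chi1 n x) @ \oo --> p1 x.
      have i2 : (fun n : nat => (n.+1%:R : R)^-2) @ \oo --> (0 : R).
        rewrite -(mulr0 (0 : R)); under eq_fun do rewrite expr2 invfM.
        by apply: cvgM; exact: cvg_harmonic.
      rewrite -[X in _ --> X]addr0; apply: cvgD.
        rewrite -[X in _ --> X]mulr1; apply: cvgM; first exact: cvg_cst.
        rewrite -[X in _ --> X]subr0; apply: cvgB; first exact: cvg_cst.
        rewrite -[X in _ --> X](mul0r (x ^+ 2)); apply: cvgM => //; exact: cvg_cst.
      rewrite -[X in _ --> X](mulr0 (p x)); apply: cvgM; first exact: cvg_cst.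
      have i3 : (fun n : nat => - (n.+1%:R : R)^-2) @ \oo --> (0 : R).
        by rewrite -oppr0; exact: cvgN.
      rewrite -[X in _ --> X](mul0r (2 * x)); apply: cvgM => //; exact: cvg_cst.
    apply: cvg_trans H; apply: near_eq_cvg; near=> n.
    rewrite /f_ /cut -ler_norml ifT//.
    have : `|x| <= n%:R by near: n; exact: nbhs_infty_ger.
    by move/le_trans; apply; rewrite ler_nat.
  - by apply: integD; [exact: integ_norm|apply: integZ; exact: integ_norm].
  - move=> n x; rewrite /f_ /cut; case: ifPn; last by rewrite normr0 addr_ge0 ?mulr_ge0.
    move=> nx; have n0 : 0 < n.+1%:R :> R by [].
    have n1 : 1 <= n.+1%:R :> R by rewrite ler1n.
    have e1 : `|chi n x| <= 1.
      have : n.+1%:R^-2 * x ^+ 2 <= 1.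
        rewrite mulrC ler_pdivrMr ?exprn_gt0// mul1r -ler_sqrt ?exprn_ge0//.
        by rewrite !sqrtr_sqr (ger0_norm (ltW n0)) ler_norml.
      have : 0 <= n.+1%:R^-2 * x ^+ 2 by rewrite mulr_ge0 ?invr_ge0 ?sqr_ge0.
      rewrite /chi; set t := _ * _ => t0 t1.
      by rewrite ler_norml; apply/andP; split; lra.
    have e2 : `|chi1 n x| <= 2.
      rewrite /chi1 normrM normrN normrM normrV ?unitfE ?expf_neq0// normrX !normr_nat.
      rewrite mulrC ler_pdivrMr ?exprn_gt0// ler_pM2l//.
      have : `|x| <= n.+1%:R by rewrite ler_norml.
      by nra.
    apply: (le_trans (ler_normD _ _)); rewrite (normrM (p1 x)) (normrM (p x)); apply: lerD.
      by rewrite ler_piMr.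
    rewrite [leLHS]mulrC; exact: (ler_wpM2r (normr_ge0 _) e2).
have z n : int (f_ n) = 0.
  rewrite -J_cut (J_ibp hp (hchi n)).
    by rewrite /chi sqrrN mulVf ?expf_neq0// subrr !mulr0 subrr.
  by rewrite (@le_trans _ _ 0)// oppr_le0.
move: mn; under eq_fun do rewrite z.
by move=> /(cvg_lim (@norm_hausdorff _ _)); rewrite lim_cst.
Unshelve. all: by end_near. Qed.

Lemma ibp_line p p1 q q1 : AC p p1 -> AC q q1 -> L2 p -> L2 p1 -> L2 q -> L2 q1 ->
  ip p1 q = - ip p q1.
Proof.
move=> hp hq lp lp1 lq lq1; apply/eqP; rewrite -addr_eq0 -intD; [|exact: L2_mul..].
by rewrite (int_deriv0 (AC_M hp hq)) ?integD//; exact: L2_mul.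
Qed.

End IBP.

(** * Translations *)

Section shift.
Context {R : realType}.
Implicit Types (f g u v p q : R -> R) (x y c h : R).

Local Notation mu := (@lebesgue_measure R).
Local Notation meas f := (measurable_fun [set: R] f).
Local Notation int f := (Rintegral mu [set: R] f).

Definition sh h f : R -> R := fun x => f (x - h).

Lemma shm h : measurable_fun [set: measurableTypeR R] (fun x : R => x - h : measurableTypeR R).
Proof.
apply: continuous_measurable_fun => x; apply: cvgB; [exact: cvg_id|exact: cvg_cst].
Qed.

(** Lebesgue measure is determined by its values on the intervals ]a, b]. *)
Lemma mu_shift h (A : set (measurableTypeR R)) : measurable A ->
  mu ((fun x : R => x - h) @^-1` A) = mu A.
Proof.
move=> mA; apply/esym.
pose nu := pushforward mu (fun x : measurableTypeR R => x - h : measurableTypeR R).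
pose mphi := isMeasurableFun.Build _ _ _ _ _ (shm h).
pose phi : {mfun measurableTypeR R >-> measurableTypeR R} :=
  HB.pack (fun x : measurableTypeR R => x - h : measurableTypeR R) mphi.
apply: (@lebesgue_measure_unique R (pushforward mu phi)) => //.
move=> _ [[a b] _ <-] /=; rewrite /pushforward /=.
rewrite (_ : _ @^-1` _ = `]a + h, b + h]%classic); last first.
  by apply/seteqP; split=> x /=; rewrite !in_itv/= ltrBrDr lerBlDr.
rewrite !lebesgue_measure_itv/= !lte_fin ltrD2r; case: ifP => // _.
by rewrite -!EFinD; congr EFin; ring.
Qed.

Lemma ge0_integral_shift h (f : R -> \bar R) : measurable_fun [set: R] f ->
  (forall x, 0 <= f x)%E ->
  (\int[mu]_x f ((x : R) - h)%R = \int[mu]_x f x)%E.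
Proof.
move=> mf f0.
have := @ge0_integral_pushforward _ _ _ _ R _ (shm h) mu [set: measurableTypeR R] f
  measurableT mf.
rewrite preimage_setT => /= /(_ _)/wrap[//|<-].
apply: eq_measure_integral; first exact: shm.
by move=> ? A mA _; exact: mu_shift.
Qed.

Lemma meas_shift h f : meas f -> meas (sh h f).
Proof. by move=> mf; apply: (measurableT_comp mf); exact: shm. Qed.

Lemma integ_shift h f : integ f -> integ (sh h f).
Proof.
move=> hf; have mf := integ_meas hf; have /integrableP[_ fi] := hf.
apply/integrableP; split.
  apply/measurable_EFinP; exact: meas_shift.
rewrite (_ : integral _ _ _ = \int[mu]_x `|(f x)%:E|)%E//.
apply: (@ge0_integral_shift h (fun x => `|(f x)%:E|%E)) => //.
by apply/measurable_EFinP; apply: measurableT_comp.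
Qed.

Lemma int_shift h f : meas f -> int (sh h f) = int f.
Proof.
move=> mf; congr fine; rewrite integralE [RHS]integralE; congr (_ - _)%E.
- transitivity (\int[mu]_x ((EFin \o f)^\+ ((x : R) - h)%R))%E.
    by apply: eq_integral => x _; rewrite !funeposE.
  have := @ge0_integral_shift h ((EFin \o f)^\+)%E; apply => //.
  by apply: measurable_funepos; exact/measurable_EFinP.
- transitivity (\int[mu]_x ((EFin \o f)^\- ((x : R) - h)%R))%E.
    by apply: eq_integral => x _; rewrite !funenegE.
  have := @ge0_integral_shift h ((EFin \o f)^\-)%E; apply => //.
  by apply: measurable_funeneg; exact/measurable_EFinP.
Qed.

Lemma L2_shift h f : L2 f -> L2 (sh h f).
Proof.
move=> [mf f2]; split; first exact: meas_shift.
exact: (integ_shift h f2).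
Qed.

Lemma ip_shift h f g : L2 f -> L2 g -> ip (sh h f) (sh h g) = ip f g.
Proof.
by move=> hf hg; exact: (int_shift h (integ_meas (L2_mul hf hg))).
Qed.

Lemma sh_sh h h' f : sh h (sh h' f) = sh (h + h') f.
Proof. by apply/funext => x; rewrite /sh; congr f; ring. Qed.

Lemma sh0 f : sh 0 f = f.
Proof. by apply/funext => x; rewrite /sh subr0. Qed.

Lemma ip_shC h f g : L2 f -> L2 g -> ip (sh h f) g = ip f (sh (- h) g).
Proof.
move=> hf hg; rewrite -(ip_shift (- h) (L2_shift h hf) hg) sh_sh addNr sh0//.
Qed.

Lemma nsq_shift h f : L2 f -> nsq (sh h f) = nsq f.
Proof. by move=> hf; exact: ip_shift. Qed.

Lemma ae_shift h (P : R -> Prop) : {ae mu, forall x, P x} ->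
  {ae mu, forall x, P (x - h)}.
Proof.
move=> [N [mN N0 PN]]; exists ((fun x : R => x - h) @^-1` N); split.
- rewrite -[X in measurable X]setTI; exact: (shm h measurableT mN).
- by rewrite mu_shift.
- by move=> x /= Px; apply: PN.
Qed.

Lemma AC_shift h p p1 : AC p p1 -> AC (sh h p) (sh h p1).
Proof.
move=> [[mp lp] hp]; split; first split.
- exact: meas_shift.
- move=> x y.
  have /(integ_shift h) : integ (cut (x - h) (y - h) p1) by apply: integ_cut.
  move=> /(@integrableS _ _ _ mu _ `[x, y]) => /(_ measurableT (measurable_itv _)).
  move=> /(_ (fun _ _ => Logic.I)); apply: eq_integrable => // t.
  rewrite inE/= in_itv/= /sh /cut => /andP[xt ty].
  by rewrite !lerD2r xt ty.
- move=> x y xy; rewrite hp ?lerD2r// !J_cut -[LHS](int_shift h).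
    by congr Rintegral; apply/funext => t; rewrite /sh /cut !lerD2r.
  by apply: integ_meas; exact: integ_cut.
Qed.

End shift.

(** * Integral operators and Neumann series *)

Section schur.
Context {R : realType}.
Implicit Types (f g u v p q : R -> R) (x y c h M B : R) (K : R -> R -> R).

Local Notation mu := (@lebesgue_measure R).
Local Notation meas f := (measurable_fun [set: R] f).
Local Notation int f := (Rintegral mu [set: R] f).

Lemma int_EFin f : integ f -> (int f)%:E = (\int[mu]_x (f x)%:E)%E.
Proof. by move=> hf; rewrite fineK//; exact: integrable_fin_num hf. Qed.

(* M bounds the kernel, B its rows and columns in L^1, as in the Schur test *)
Definition skernel K M B := [/\ measurable_fun [set: R * R] (fun z => K z.1 z.2),
  forall x y, `|K x y| <= M,
  forall x, integ (K x) /\ int (fun y => `|K x y|) <= B &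
  forall y, integ (K^~ y) /\ int (fun x => `|K x y|) <= B].

Definition Kop K u : R -> R := fun x => int (fun y => K x y * u y).
Definition trK K : R -> R -> R := fun x y => K y x.

Lemma skernel_tr K M B : skernel K M B -> skernel (trK K) M B.
Proof.
move=> [mK KM K1 K2]; split=> //; last by move=> x y; exact: KM.
rewrite (_ : (fun z => _) = (fun z : R * R => K z.1 z.2) \o (fun z : R * R => (z.2, z.1)))//.
apply: measurableT_comp => //.
by apply/measurable_fun_pair; [exact: measurable_snd|exact: measurable_fst].
Qed.

Lemma skernel_ge0 K M B : skernel K M B -> 0 <= M /\ 0 <= B.
Proof.
move=> [_ KM K1 _]; split; first exact: le_trans (normr_ge0 _) (KM 0 0).
by apply: le_trans (K1 0).2; exact: int_ge0.
Qed.

(** As K^2 <= M |K|, the bound M puts the L^1 rows into L^2. Hence [Kop K u x] is a convergent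
    integral at every x, not merely at almost every x. *)
Lemma L2_row K M B x : skernel K M B -> L2 (K x).
Proof.
move=> kK; have [mK KM /(_ x)[iK _] _] := kK; split; first exact: integ_meas.
apply: le_integ (integZ M (integ_norm iK)).
  by apply: measurable_funX; exact: integ_meas.
by move=> y /=; rewrite normrX expr2 ler_wpM2r.
Qed.

Lemma L2_sqrt f : integ f -> L2 (fun x => Num.sqrt `|f x|).
Proof.
move=> hf; split.
  apply: measurableT_comp; first exact: continuous_measurable_fun (@sqrt_continuous R).
  by apply: measurableT_comp => //; exact: integ_meas.
rewrite (_ : (fun x => _) = (fun x => `|f x|)); first exact: integ_norm.
by apply/funext => x; rewrite sqr_sqrtr.
Qed.

Lemma integ2_row K M B f : skernel K M B -> integ f ->
  ((mu \x mu)%E).-integrable [set: R * R] (fun z => (K z.1 z.2 * f z.1)%:E).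
Proof.
move=> kK hf; have [mK KM K1 K2] := kK.
have mf : measurable_fun [set: R * R] (fun z => K z.1 z.2 * f z.1).
  apply: measurable_funM => //.
  by apply: measurableT_comp; [exact: integ_meas|exact: measurable_fst].
apply/integrable12ltyP; first exact/measurable_EFinP.
have H x : (\int[mu]_y `|(K x y * f x)%:E| = (int (fun y => `|K x y|) * `|f x|)%:E)%E.
  rewrite mulrC -intZ; last exact: integ_norm (K1 x).1.
  rewrite int_EFin; last by apply: integZ; exact: integ_norm (K1 x).1.
  by apply: eq_integral => y _; rewrite /= normrM mulrC.
under eq_integral do rewrite H.
have /integrableP[_] := integZ B (integ_norm hf).
apply: le_lt_trans; apply: ge0_le_integral => //.
- by move=> x _; rewrite lee_fin mulr_ge0//; exact: int_ge0.
- rewrite [X in measurable_fun _ X](_ : _ =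
    fubini_F mu (fun z => `|(K z.1 z.2 * f z.1)%:E|%E)); last first.
    by apply/funext => x; rewrite /fubini_F /= -H.
  apply: measurable_fun_fubini_tonelli_F => //.
  by apply: measurableT_comp => //; exact/measurable_EFinP.
- apply: measurableT_comp => //; apply/measurable_EFinP.
  by apply: integ_meas; exact: integZ (integ_norm hf).
- move=> x _; rewrite lee_fin; apply: le_trans (ler_norm _).
  by apply: ler_wpM2r => //; exact: (K1 x).2.
Qed.


Lemma integ2_col K M B f : skernel K M B -> integ f ->
  ((mu \x mu)%E).-integrable [set: R * R] (fun z => (K z.1 z.2 * f z.2)%:E).
Proof.
move=> kK hf; have [mK KM K1 K2] := kK.
have mf : measurable_fun [set: R * R] (fun z => K z.1 z.2 * f z.2).
  apply: measurable_funM => //.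
  by apply: measurableT_comp; [exact: integ_meas|exact: measurable_snd].
apply/integrable21ltyP; first exact/measurable_EFinP.
have H y : (\int[mu]_x `|(K x y * f y)%:E| = (int (fun x => `|K x y|) * `|f y|)%:E)%E.
  rewrite mulrC -intZ; last exact: integ_norm (K2 y).1.
  rewrite int_EFin; last by apply: integZ; exact: integ_norm (K2 y).1.
  by apply: eq_integral => x _; rewrite /= normrM mulrC.
under eq_integral do rewrite H.
have /integrableP[_] := integZ B (integ_norm hf).
apply: le_lt_trans; apply: ge0_le_integral => //.
- by move=> x _; rewrite lee_fin mulr_ge0//; exact: int_ge0.
- rewrite [X in measurable_fun _ X](_ : _ =
    fubini_G mu (fun z => `|(K z.1 z.2 * f z.2)%:E|%E)); last first.
    by apply/funext => x; rewrite /fubini_G /= -H.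
  apply: measurable_fun_fubini_tonelli_G => //.
  by apply: measurableT_comp => //; exact/measurable_EFinP.
- apply: measurableT_comp => //; apply/measurable_EFinP.
  by apply: integ_meas; exact: integZ (integ_norm hf).
- move=> x _; rewrite lee_fin; apply: le_trans (ler_norm _).
  by apply: ler_wpM2r => //; exact: (K2 x).2.
Qed.

Lemma Kop_integ K M B u x : skernel K M B -> L2 u -> integ (fun y => K x y * u y).
Proof. by move=> /(L2_row x) hK hu; exact: L2_mul. Qed.

(** Fubini with the majorant |K x y| (u(y)^2 + v(x)^2), whose two terms are integrable on the plane
    because the columns and the rows of K have L^1 norm at most B. *)
Lemma Kop_adj K M B u v : skernel K M B -> L2 u -> L2 v ->
  ip (Kop K u) v = ip u (Kop (trK K) v).
Proof.
move=> kK hu hv; have [mK KM K1 K2] := kK; have kT := skernel_tr kK.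
have := @Rfubini R (fun z => K z.1 z.2 * u z.2 * v z.1).
have e1 x : int (fun y => K x y * u y * v x) = Kop K u x * v x.
  rewrite mulrC -intZ; last exact: Kop_integ kK hu.
  by apply: eq_Rintegral => y _; rewrite mulrC.
have e2 y : int (fun x => K x y * u y * v x) = u y * Kop (trK K) v y.
  rewrite -intZ; last exact: Kop_integ kT hv.
  by apply: eq_Rintegral => x _; rewrite /trK; ring.
rewrite /= (eq_Rintegral mu (fun x _ => e1 x)) (eq_Rintegral mu (fun x _ => e2 x)).
apply.
- have mu2 : measurable_fun [set: R * R] (fun z => u z.2).
    by apply: measurableT_comp; [exact: hu.1|exact: measurable_snd].
  have mv1 : measurable_fun [set: R * R] (fun z => v z.1).
    by apply: measurableT_comp; [exact: hv.1|exact: measurable_fst].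
  have I := integrableD _ (integrable_abse (integ2_col kK hu.2))
    (integrable_abse (integ2_row kK hv.2)).
  have {}I : ((mu \x mu)%E).-integrable [set: R * R]
    (fun z => (`|K z.1 z.2 * u z.2 ^+ 2| + `|K z.1 z.2 * v z.1 ^+ 2|)%:E).
    by apply: eq_integrable (I measurableT).
  apply: le_integrable I => //.
    apply/measurable_EFinP; apply: measurable_funM => //.
    exact: measurable_funM.
  move=> z _ /=; rewrite lee_fin [leRHS]ger0_norm ?addr_ge0// !normrM.
  rewrite -mulrA -mulrDr; apply: ler_wpM2l => //.
  have := sqr_ge0 (`|u z.2| - `|v z.1|).
  have := normr_ge0 (u z.2); have := normr_ge0 (v z.1).
  by nra.
- move=> x; under eq_fun do rewrite mulrC; apply: integZ; exact: Kop_integ kK hu.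
- move=> y; rewrite (_ : (fun x => _) = (fun x => u y * (trK K y x * v x))).
    by apply: integZ; exact: Kop_integ kT hv.
  by apply/funext => x; rewrite /trK /=; ring.
Qed.

(** Cauchy-Schwarz for the splitting |K| = sqrt |K| * sqrt |K| gives (K u)^2 <= B * [G] pointwise,
    and exchanging the integrals of [G] costs a second B. Measurability of K u is left to the
    callers, which know K u by a formula or as an absolutely continuous function. *)
Lemma schur K M B u : skernel K M B -> L2 u -> meas (Kop K u) ->
  L2 (Kop K u) /\ nsq (Kop K u) <= B ^+ 2 * nsq u.
Proof.
move=> kK hu mKu; have [mK KM K1 K2] := kK.
have kA : skernel (fun x y => `|K x y|) M B.
  split.
  - exact: measurableT_comp.
  - by move=> x y; rewrite normr_id.
  - move=> x; split; first exact: integ_norm (K1 x).1.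
    by under eq_Rintegral do rewrite normr_id; exact: (K1 x).2.
  - move=> y; split; first exact: integ_norm (K2 y).1.
    by under eq_Rintegral do rewrite normr_id; exact: (K2 y).2.
have [M0 B0] := skernel_ge0 kK.
pose G x := int (fun y => `|K x y| * u y ^+ 2).
have iG x : integ (fun y => `|K x y| * u y ^+ 2).
  apply: le_integ (integZ M hu.2).
    apply: measurable_funM; last exact: measurable_funX hu.1.
    by apply: measurableT_comp => //; exact: integ_meas (K1 x).1.
  move=> y; rewrite normrM normr_id ger0_norm ?sqr_ge0//.
  by rewrite ler_wpM2r ?sqr_ge0.
have i2 := integ2_col kA hu.2.
have iGx : integ G.
  apply: eq_integrable (integrable_fubini_F i2) => // x _.
  by rewrite /fubini_F /= /G (int_EFin (iG x)).
have intG : int G <= B * nsq u.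
  have := Rfubini (F := fun z => `|K z.1 z.2| * u z.2 ^+ 2) i2 iG.
  rewrite /= -/G => ->; last first.
    move=> y; under eq_fun do rewrite mulrC; apply: integZ.
    exact: integ_norm (K2 y).1.
  rewrite nsqE -intZ; last exact: hu.2.
  have E y : int (fun x => `|K x y| * u y ^+ 2) = u y ^+ 2 * int (fun x => `|K x y|).
    rewrite -intZ; last exact: integ_norm (K2 y).1.
    by apply: eq_Rintegral => x _; rewrite mulrC.
  rewrite (eq_Rintegral mu (fun y _ => E y)).
  have le y : u y ^+ 2 * int (fun x => `|K x y|) <= B * u y ^+ 2.
    by rewrite mulrC ler_wpM2r ?sqr_ge0//; exact: (K2 y).2.
  apply: le_int => //; last exact: integZ hu.2.
  apply: le_integ (integZ B hu.2).
    rewrite (_ : (fun y => _) = fine \o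
      fubini_G mu (fun z => (`|K z.1 z.2| * u z.2 ^+ 2)%:E)); last first.
      by apply/funext => y; rewrite -E.
    apply: measurableT_comp; first exact: fine_measurable.
    exact: measurable_fubini_G i2.
  move=> y; rewrite ger0_norm// mulr_ge0 ?sqr_ge0//; exact: int_ge0.
have key x : Kop K u x ^+ 2 <= B * G x.
  have s1 := L2_sqrt (K1 x).1.
  have e1 : int (fun y => Num.sqrt `|K x y| ^+ 2) = int (fun y => `|K x y|).
    by apply: eq_Rintegral => y _; rewrite sqr_sqrtr.
  have s2 : L2 (fun y => Num.sqrt `|K x y| * `|u y|).
    split.
      apply: measurable_funM; first exact: s1.1.
      by apply: measurableT_comp => //; exact: hu.1.
    rewrite (_ : (fun y => _) = (fun y => `|K x y| * u y ^+ 2)) //.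
    by apply/funext => y; rewrite exprMn sqr_sqrtr// real_normK// num_real.
  have e2 : nsq (fun y => Num.sqrt `|K x y| * `|u y|) = G x.
    rewrite nsqE; apply: eq_Rintegral => y _.
    by rewrite exprMn sqr_sqrtr// real_normK// num_real.
  have := cauchy_schwarz s1 s2; rewrite e2 nsqE e1.
  have G0 : 0 <= G x by apply: int_ge0 => y; rewrite mulr_ge0 ?sqr_ge0.
  move=> h; apply: le_trans (le_trans h (ler_wpM2r G0 (K1 x).2)).
  have n1 : `|Kop K u x| <= ip (fun y => Num.sqrt `|K x y|)
        (fun y => Num.sqrt `|K x y| * `|u y|).
    apply: le_trans (le_normr_Rintegral _ _) _ => //; first exact: Kop_integ kK hu.
    by rewrite le_eqVlt; apply/orP; left; apply/eqP; apply: eq_Rintegral => y _; rewrite mulrA -expr2 sqr_sqrtr// normrM.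
  rewrite -(real_normK (num_real (Kop K u x))) ler_pXn2r// ?nnegrE//.
  exact: le_trans n1.
have hL : L2 (Kop K u).
  split=> //; apply: le_integ (integZ B iGx); first exact: measurable_funX.
  by move=> x; rewrite ger0_norm ?sqr_ge0.
split=> //; rewrite nsqE; apply: (@le_trans _ _ (int (fun x => B * G x))).
  by apply: le_int => //; [exact: hL.2|exact: integZ].
by rewrite intZ// expr2 -mulrA ler_wpM2l.
Qed.

End schur.

(** * Geometrically convergent series in L^2 *)

Section complete.
Context {R : realType}.
Implicit Types (f g u v p q : R -> R) (x y c h : R).

Local Notation mu := (@lebesgue_measure R).
Local Notation meas f := (measurable_fun [set: R] f).
Local Notation int f := (Rintegral mu [set: R] f).

(** [e n] is the sum of C s^j over j >= n, so the segments [S n - e n, S n + e n] are nested; the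
    limit is the supremum of their left ends. *)
Lemma geometric_limit (r : nat -> R) (C s : R) : 0 <= C -> 0 < s < 1 ->
  (forall j, `|r j| <= C * s ^+ j) ->
  exists l, forall n, `|l - \sum_(j < n) r j| <= C / (1 - s) * s ^+ n.
Proof.
move=> C0 /andP[s0 s1] hr; have s1' : 0 < 1 - s by rewrite subr_gt0.
pose e n := C / (1 - s) * s ^+ n; pose S n := \sum_(j < n) r j.
have e0 n : 0 <= e n by rewrite /e mulr_ge0 ?exprn_ge0 ?divr_ge0// ltW.
have eS n : e n - e n.+1 = C * s ^+ n.
  by rewrite /e exprS; field; rewrite gt_eqF.
have qS n : S n - e n <= S n.+1 - e n.+1.
  have := hr n; rewrite -eS /S big_ord_recr/= ler_norml => /andP[]; lra.
have pS n : S n.+1 + e n.+1 <= S n + e n.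
  have := hr n; rewrite -eS /S big_ord_recr/= ler_norml => /andP[]; lra.
have qm n m : (n <= m)%N -> S n - e n <= S m - e m.
  elim: m => [|m IH]; first by rewrite leqn0 => /eqP->.
  by rewrite leq_eqVlt => /predU1P[->//|/IH h]; exact: le_trans h (qS m).
have pm n m : (n <= m)%N -> S m + e m <= S n + e n.
  elim: m => [|m IH]; first by rewrite leqn0 => /eqP->.
  by rewrite leq_eqVlt => /predU1P[->//|/IH h]; exact: le_trans (pS m) h.
have qp n m : S n - e n <= S m + e m.
  apply: le_trans (qm n (maxn n m) (leq_maxl _ _)) _.
  apply: le_trans (pm m (maxn n m) (leq_maxr _ _)).
  by have := e0 (maxn n m); lra.
pose X := range (fun n => S n - e n).
have hX : has_sup X.
  split; first by exists (S 0%N - e 0%N), 0%N.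
  by exists (S 0%N + e 0%N) => _ [n _ <-].
exists (sup X) => n; rewrite ler_norml; apply/andP; split.
- have : S n - e n <= sup X by apply: sup_upper_bound => //; exists n.
  by rewrite /S /e; lra.
- have : sup X <= S n + e n.
    by apply: ge_sup => [|_ [m _ <-]]; first exact: hX.1.
  by rewrite /S /e; lra.
Qed.

Lemma L2_sum (r : nat -> R -> R) n : (forall j, L2 (r j)) ->
  L2 (fun x => \sum_(j < n) r j x).
Proof.
move=> hr; elim: n => [|n IH].
  by under eq_fun do rewrite big_ord0; exact: L2_0.
by under eq_fun do rewrite big_ord_recr/=; exact: L2D.
Qed.

(** The decay s^(3 j) is shared out. Under the weight s^(- 2 j) the squares still have integrals at
    most D s^j, so their sum W is integrable and finite almost everywhere; then |r_j| <= sqrt W *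
    s^j makes the series converge geometrically at almost every point. *)
Lemma L2_complete (r : nat -> R -> R) (D s : R) : 0 < s < 1 ->
  (forall j, L2 (r j)) -> (forall j, nsq (r j) <= D * (s ^+ 3) ^+ j) ->
  exists2 y, L2 y &
    exists E, forall n, nsq (fun x => y x - \sum_(j < n) r j x) <= E * s ^+ n.
Proof.
move=> s01 hr nr; have /andP[s0 s1] := s01; have s1' : 0 < 1 - s by rewrite subr_gt0.
have D0 : 0 <= D by have := nr 0%N; rewrite expr0 mulr1; apply: le_trans; exact: nsq_ge0.
pose t j x := (s ^+ 2) ^- j * r j x ^+ 2.
have t0 j x : 0 <= t j x by rewrite mulr_ge0 ?sqr_ge0// invr_ge0 !exprn_ge0// ltW.
have ti j : integ (t j) by apply: integZ; exact: (hr j).2.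
have mt j : measurable_fun [set: R] (EFin \o t j).
  by apply/measurable_EFinP; exact: integ_meas.
pose W x := (\sum_(j <oo) (t j x)%:E)%E.
have W0 x : (0 <= W x)%E by apply: nneseries_ge0 => *; rewrite lee_fin.
have mW : measurable_fun [set: R] W.
  have := @ge0_emeasurable_sum _ _ R [set: R] (fun j x => (t j x)%:E) predT.
  apply; first by move=> k x _ _; rewrite lee_fin.
  by move=> k _; exact: mt.
have intW : (\int[mu]_x W x < +oo)%E.
  rewrite /W integral_nneseries//; last by move=> n x _; rewrite lee_fin.
  apply: (@le_lt_trans _ _ (D / (1 - s))%:E); last exact: ltry.
  apply: lime_le.
    by apply: is_cvg_nneseries => n _ _; apply: integral_ge0 => x _; rewrite lee_fin.
  apply: nearW => n; rewrite big_mkord.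
  have E1 j : (\int[mu]_x (t j x)%:E = (int (t j))%:E)%E by rewrite int_EFin.
  under eq_bigr do rewrite E1.
  rewrite sumEFin lee_fin.
  have : \sum_(i < n) int (t i) <= D * \sum_(i < n) s ^+ i.
    rewrite mulr_sumr; apply: ler_sum => j _.
    rewrite intZ; last exact: (hr j).2.
    rewrite -nsqE mulrC ler_pdivrMr ?exprn_gt0//.
    by apply: le_trans (nr j) _; rewrite -mulrA -exprMn -exprS.
  move/le_trans; apply; rewrite ler_wpM2l// -[leRHS]mul1r ler_pdivlMr//.
  have := subrX1 s n; have : 0 <= s ^+ n by rewrite exprn_ge0// ltW.
  by lra.
have IW : mu.-integrable [set: R] W.
  apply/integrableP; split=> //.
  by rewrite (_ : (fun x => `|W x|%E) = W)//; apply/funext => x; rewrite gee0_abs.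
pose w x := fine (W x).
have w0 x : 0 <= w x by exact: fine_ge0.
have mw : meas w by apply: measurableT_comp => //; exact: fine_measurable.
have iw : integ w.
  apply: le_integrable IW => //; first exact/measurable_EFinP.
  move=> x _; rewrite gee0_abs ?lee_fin// gee0_abs// /= /w.
  by case: (W x) (W0 x) => //= *; rewrite leey.
(* The truncation makes the geometric bound true at every point, so that the pointwise sum [y]
   exists everywhere; almost everywhere it changes nothing. *)
pose rA j x := if r j x ^+ 2 <= w x * (s ^+ 2) ^+ j then r j x else 0.
have mrA j : meas (rA j).
  apply: measurable_fun_ifT => //; last exact: (hr j).1.
  apply: measurable_fun_ler; first exact: measurable_funX (hr j).1.
  exact: measurable_funM.
have aerA : {ae mu, forall x, forall j, rA j x = r j x}.
  have := integrable_ae measurableT IW; apply: filterS => x /(_ Logic.I) fx j.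
  rewrite /rA ifT// -ler_pdivrMr ?exprn_gt0 ?exprn_gt0// mulrC.
  rewrite -lee_fin /w fineK//.
  apply: le_trans (nneseries_lim_ge j.+1 _); last by move=> *; rewrite lee_fin.
  rewrite big_mkord big_ord_recr/= leeDr//.
  by apply: sume_ge0 => i _; rewrite lee_fin.
have brA j x : `|rA j x| <= Num.sqrt (w x) * s ^+ j.
  rewrite /rA; case: ifPn => [h|_]; last first.
    by rewrite normr0 mulr_ge0 ?sqrtr_ge0 ?exprn_ge0// ltW.
  rewrite -sqrtr_sqr (_ : _ * _ = Num.sqrt (w x * (s ^+ 2) ^+ j)) ?ler_wsqrtr//.
  by rewrite sqrtrM// exprAC sqrtr_sqr ger0_norm// exprn_ge0// ltW.
have /choice[y hy] x := geometric_limit (sqrtr_ge0 (w x)) s01 (brA ^~ x).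
pose K := ((1 - s)^-1) ^+ 2.
have hy2 n x : (y x - \sum_(j < n) rA j x) ^+ 2 <= K * s ^+ n * w x.
  rewrite -(real_normK (num_real (y x - _))).
  apply: le_trans (_ : (Num.sqrt (w x) / (1 - s) * s ^+ n) ^+ 2 <= _).
    by rewrite ler_pXn2r ?nnegrE ?(le_trans (normr_ge0 _) (hy x n)).
  rewrite !exprMn sqr_sqrtr// /K exprVn -exprVn.
  (* The decay s^(2 n) is available here; s^n is enough for the statement. *)
  have sn : (s ^+ n) ^+ 2 <= s ^+ n.
    rewrite expr2 ler_piMr ?exprn_ge0 ?exprn_ile1 ?ltW//.
  rewrite (_ : _ * _ * s ^+ n * w x = w x * (1 - s)^-1 ^+ 2 * s ^+ n); last by ring.
  by rewrite ler_wpM2l// mulr_ge0// sqr_ge0.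
have my : meas y.
  apply: (@measurable_fun_cvg _ _ _ _ (fun n x => \sum_(j < n) rA j x)) => //.
    by move=> n; apply: measurable_sum => j; exact: mrA.
  move=> x _; apply/cvgrPdist_le => /= e e0.
  have G := @cvg_geometric R (Num.sqrt (w x) / (1 - s)) s.
  have {G} : geometric (Num.sqrt (w x) / (1 - s)) s @ \oo --> (0 : R).
    by apply: G; rewrite ger0_norm// ltW.
  move=> /cvgrPdist_le /(_ e e0) /=; apply: filterS => n.
  rewrite sub0r normrN => h; apply: le_trans (hy x n) (le_trans (ler_norm _) h).
have LA n : L2 (fun x => y x - \sum_(j < n) rA j x).
  split; first by apply: measurable_funB => //; apply: measurable_sum => j; exact: mrA.
  apply: le_integ (integZ (K * s ^+ n) iw).
    apply: measurable_funX; apply: measurable_funB => //.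
    by apply: measurable_sum => j; exact: mrA.
  by move=> x; rewrite ger0_norm ?sqr_ge0.
exists y.
  by apply: L2_eq (LA 0%N) _ => x; rewrite big_ord0 subr0.
have Ly : L2 y by apply: L2_eq (LA 0%N) _ => x; rewrite big_ord0 subr0.
exists (K * int w) => n.
rewrite (@nsq_ae _ _ (fun x => y x - \sum_(j < n) rA j x)); last 3 first.
- by apply: L2B => //; exact: L2_sum.
- exact: LA.
- move: aerA; apply: filterS => x h; congr (_ - _).
  by apply: eq_bigr => j _; rewrite h.
rewrite nsqE mulrAC -intZ//; apply: le_int => //; [exact: (LA n).2|exact: integZ].
Qed.

End complete.

(** * Surjectivity from a lower bound on the adjoint *)

Section neumann.
Context {R : realType}.
Implicit Types (f g u v p q : R -> R) (x y b c h : R).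

Local Notation mu := (@lebesgue_measure R).
Local Notation meas f := (measurable_fun [set: R] f).

Definition L2op (A : (R -> R) -> R -> R) b :=
  [/\ forall u, L2 u -> L2 (A u) /\ nsq (A u) <= b * nsq u,
      forall u v, L2 u -> L2 v -> A (fun x => u x + v x) = (fun x => A u x + A v x) &
      forall c u, L2 u -> A (fun x => c * u x) = (fun x => c * A u x)].

Lemma L2opB A b u v : L2op A b -> L2 u -> L2 v ->
  A (fun x => u x - v x) = (fun x => A u x - A v x).
Proof.
move=> [_ AD AZ] hu hv.
rewrite (_ : (fun x => u x - v x) = (fun x => u x + (-1) * v x)); last first.
  by apply/funext => x; rewrite mulN1r.
by rewrite AD ?AZ//; [apply/funext => x; rewrite mulN1r|exact: L2Z].
Qed.

(** For B = A A' one has |v - B v / b|^2 <= |v|^2 - |A' v|^2 / b, and the lower bound on A' turns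
    this into a strict contraction. The solution is A' y, where B y = g. *)
Lemma neumann A A' b c : 0 < b -> 0 < c -> L2op A b -> L2op A' b ->
  (forall u v, L2 u -> L2 v -> ip (A u) v = ip u (A' v)) ->
  (forall u, L2 u -> nsq u <= c * nsq (A' u)) ->
  forall g, L2 g -> exists2 u, L2 u & {ae mu, forall x, A u x = g x}.
Proof.
move=> b0 c0 hA hA' adj coer g hg.
have [LA AD AZ] := hA; have [LA' AD' AZ'] := hA'.
pose B v := A (A' v).
have LB v : L2 v -> L2 (B v) by move=> hv; exact: (LA _ (LA' _ hv).1).1.
have nB v : L2 v -> nsq (B v) <= b * nsq (A' v).
  by move=> hv; exact: (LA _ (LA' _ hv).1).2.
have BD u v : L2 u -> L2 v -> B (fun x => u x + v x) = (fun x => B u x + B v x).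
  by move=> hu hv; rewrite /B AD'// AD//; [exact: (LA' _ hu).1|exact: (LA' _ hv).1].
have BZ k u : L2 u -> B (fun x => k * u x) = (fun x => k * B u x).
  by move=> hu; rewrite /B AZ'// AZ//; exact: (LA' _ hu).1.
pose t := b^-1; have t0 : 0 < t by rewrite invr_gt0.
pose H v x := v x - t * B v x.
have LH v : L2 v -> L2 (H v).
  by move=> hv; apply: L2B => //; apply: L2Z; exact: LB.
(* The argument gives the factor 1 - 1 / (b c); the added 1 ensures 0 < th without comparing b c
   with 1. *)
pose th := 1 - (b * c + 1)^-1.
have bc0 : 0 < b * c by rewrite mulr_gt0.
have nH v : L2 v -> nsq (H v) <= th * nsq v.
  move=> hv; rewrite nsqB//; last by apply: L2Z; exact: LB.
  rewrite ipZr ?nsqZ//; [|exact: LB..].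
  rewrite (ipC v) /B adj// -?/(B v); last exact: (LA' _ hv).1.
  rewrite -/(nsq (A' v)).
  have h1 : t ^+ 2 * nsq (B v) <= t * nsq (A' v).
    rewrite expr2 -mulrA ler_pM2l// /t mulrC ler_pdivrMr// mulrC; exact: nB.
  have h2 : (b * c + 1)^-1 * nsq v <= t * nsq (A' v).
    rewrite mulrC ler_pdivrMr ?ltr_wpDl ?(ltW bc0)// /t.
    have -> : b^-1 * nsq (A' v) * (b * c + 1) = c * nsq (A' v) + b^-1 * nsq (A' v).
      by field; rewrite gt_eqF.
    apply: le_trans (coer _ hv) _; rewrite lerDl mulr_ge0 ?nsq_ge0//.
    by rewrite invr_ge0 ltW.
  by rewrite /th mulrBl mul1r; lra.
(* [L2_complete] wants a ratio of the form s^3. As s is the arithmetic mean of 1, 1 and th, s^3 >=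
   th, and no cube root is extracted. *)
pose s := (2 + th) / 3.
have th01 : 0 < th < 1.
  have bc1 : 0 < b * c + 1 by lra.
  have : 0 < (b * c + 1)^-1 by rewrite invr_gt0.
  have : (b * c + 1)^-1 < 1 by rewrite invf_lt1//; lra.
  by rewrite /th => ? ?; apply/andP; split; lra.
have /andP[th0 th1] := th01.
have s01 : 0 < s < 1 by rewrite /s; apply/andP; split; lra.
have ths : th <= s ^+ 3.
  rewrite -subr_ge0 (_ : _ - th = (1 - th) ^+ 2 * (8 + th) / 27); last by rewrite /s; field.
  by apply: divr_ge0 => //; rewrite mulr_ge0 ?sqr_ge0//; lra.
(* The terms of the Neumann series for the inverse of B = (1 - H) / t, applied to g. *)
pose r j := iter j H (fun x => t * g x).
have Lr j : L2 (r j) by elim: j => [|j IH]; [exact: L2Z|exact: LH].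
have nr j : nsq (r j) <= nsq (r 0%N) * (s ^+ 3) ^+ j.
  elim: j => [|j IH]; first by rewrite mulr1.
  rewrite -[nsq (r j.+1)]/(nsq (H (r j))).
  apply: (le_trans (nH _ (Lr j))).
  rewrite exprS mulrCA; apply: ler_pM => //; [exact: ltW|exact: nsq_ge0].
have [y Ly [E hE]] := L2_complete s01 Lr nr.
(* Telescoping: t B r_j = r_j - r_(j+1). *)
have Bs n : B (fun x => \sum_(j < n) r j x) = (fun x => b * (r 0%N x - r n x)).
  elim: n => [|n IH].
    under eq_fun do rewrite big_ord0.
    rewrite (_ : (fun=> 0) = (fun x : R => 0 * (r 0%N x))); last first.
      by apply/funext => x; rewrite mul0r.
    by rewrite BZ//; apply/funext => x; rewrite subrr mul0r mulr0.
  under eq_fun do rewrite big_ord_recr/=.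
  rewrite BD//; last exact: L2_sum.
  rewrite IH; apply/funext => x; rewrite /r iterS -/(r n) {3}/H /t.
  by field; rewrite gt_eqF.
have key n : nsq (fun x => B y x - g x) <= (2 * b ^+ 2 * E + 2 * b ^+ 2 * nsq (r 0%N)) * s ^+ n.
  have -> : (fun x => B y x - g x) =
    (fun x => B (fun x => y x - \sum_(j < n) r j x) x + (- b) * r n x).
    rewrite /B (L2opB hA')//; last exact: L2_sum.
    rewrite (L2opB hA); [|exact: (LA' _ Ly).1|exact: (LA' _ (L2_sum n Lr)).1].
    rewrite -/(B y) -/(B _) Bs; apply/funext => x; rewrite /= /t.
    by field; rewrite gt_eqF.
  have Ld : L2 (fun x => y x - \sum_(j < n) r j x) by apply: L2B => //; exact: L2_sum.
  apply: le_trans (nsqD_le (LB _ Ld) (L2Z _ (Lr n))) _.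
  rewrite nsqZ// sqrrN [leRHS]mulrDl; apply: lerD.
    rewrite -!mulrA ler_pM2l//.
    apply: le_trans (nB _ Ld) _; rewrite ler_pM2l//.
    by apply: le_trans (LA' _ Ld).2 _; rewrite ler_pM2l.
  rewrite -!mulrA !ler_pM2l//.
  apply: le_trans (nr n) _; rewrite ler_wpM2l ?nsq_ge0// exprAC.
  have /andP[s0 s1] := s01.
  have z0 : 0 <= s ^+ n by rewrite exprn_ge0// ltW.
  have z1 : s ^+ n <= 1 by rewrite exprn_ile1// ltW.
  set z := s ^+ n in z0 z1 *; rewrite -subr_ge0.
  rewrite (_ : z - z ^+ 3 = z * (1 - z) * (1 + z)); last by ring.
  by rewrite !mulr_ge0//; lra.
exists (A' y); first exact: (LA' _ Ly).1.
rewrite -/(B y).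
have Lz : L2 (fun x => B y x - g x) by apply: L2B => //; exact: LB.
have : nsq (fun x => B y x - g x) <= 0.
  set C := 2 * b ^+ 2 * E + _ in key.
  have /andP[s0 s1] := s01.
  have : geometric C s @ \oo --> (0 : R) by apply: cvg_geometric; rewrite gtr0_norm.
  move=> /(@cvg_lim _ _ _ _ _ _) <- //.
  apply: limr_ge; first by apply/cvg_ex; exists 0; apply: cvg_geometric; rewrite gtr0_norm.
  by apply: nearW => n; exact: key.
move=> /(nsq_eq0 Lz) H0.
have aeF : Filter (nbhs (almost_everywhere mu)) := ae_filter_ringOfSetsType mu.
by move: H0; apply: filterS => x /eqP; rewrite subr_eq0 => /eqP.
Qed.

End neumann.

(** * The equation away from resonance *)

Ltac l2 := repeat first [assumption | apply: L2N | apply: L2D | apply: L2_shift | apply: L2Z].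

Section delay_equation.
Context {R : realType}.
Implicit Types (f g u v p q : R -> R) (x y b c h a k : R).

Local Notation mu := (@lebesgue_measure R).
Local Notation meas f := (measurable_fun [set: R] f).
Local Notation int f := (Rintegral mu [set: R] f).

Lemma AC_cos k c : AC (fun y : R => cos (k * (c - y))) (fun y => k * sin (k * (c - y))).
Proof.
apply: AC_C1.
  move=> x; have D : is_derive x (1:R) (fun y : R => k * (c - y)) (- k).
    by apply: is_derive_eq; rewrite /GRing.scale/=; ring.
  have := @is_derive1_comp _ cos (fun y : R => k * (c - y)) x _ _ (is_derive_cos _) D.
  by rewrite /comp => H; apply: is_derive_eq H _; rewrite /GRing.scale/=; ring.
move=> x; apply: cvgM; first exact: cvg_cst.
apply: continuous_comp; last exact: continuous_sin.
by apply: cvgM; [exact: cvg_cst|apply: cvgB; [exact: cvg_cst|exact: cvg_id]].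
Qed.

Lemma AC_sin k c : AC (fun y : R => sin (k * (c - y))) (fun y => - k * cos (k * (c - y))).
Proof.
apply: AC_C1.
  move=> x; have D : is_derive x (1:R) (fun y : R => k * (c - y)) (- k).
    by apply: is_derive_eq; rewrite /GRing.scale/=; ring.
  have := @is_derive1_comp _ sin (fun y : R => k * (c - y)) x _ _ (is_derive_sin _) D.
  by rewrite /comp => H; apply: is_derive_eq H _; rewrite /GRing.scale/=; ring.
move=> x; apply: cvgM; first exact: cvg_cst.
apply: continuous_comp; last exact: continuous_cos.
by apply: cvgM; [exact: cvg_cst|apply: cvgB; [exact: cvg_cst|exact: cvg_id]].
Qed.

Lemma J_cst x y c : x <= y -> J x y (fun=> c) = c * (y - x).
Proof.
move=> xy; rewrite /J Rintegral_cst; last exact: measurable_itv.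
congr (_ * _); have := lebesgue_measure_itv `[x, y] => /= ->; rewrite lte_fin.
move: xy; rewrite le_eqVlt => /predU1P[->|xy]; first by rewrite ltxx subrr.
by rewrite xy.
Qed.

Definition window l1 l2 g : R -> R -> R :=
  fun x y => if x + l1 <= y <= x + l2 then g (x - y) else 0.

Lemma Kop_window l1 l2 g u x :
  Kop (window l1 l2 g) u x = J (x + l1) (x + l2) (fun y => g (x - y) * u y).
Proof.
rewrite J_cut; apply: eq_Rintegral => y _.
by rewrite /window /cut; case: ifP; rewrite ?mul0r.
Qed.

Lemma window_tr l1 l2 g : trK (window l1 l2 g) = window (- l2) (- l1) (fun t => g (- t)).
Proof.
apply/funext => x; apply/funext => y; rewrite /trK /window opprB.
by rewrite (_ : (y + l1 <= x <= y + l2) = (x - l2 <= y <= x - l1))//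
  lerBlDr lerBrDr andbC.
Qed.

Lemma skernel_window l1 l2 g M : continuous g -> (forall t, `|g t| <= M) -> l1 <= l2 ->
  skernel (window l1 l2 g) M (M * (l2 - l1)).
Proof.
move=> cg gM l12; have M0 : 0 <= M by exact: le_trans (gM 0).
have bound x y f : x <= y -> y - x = l2 - l1 -> locint f ->
    (forall t, `|f t| <= M) ->
    integ (cut x y f) /\ int (fun t => `|cut x y f t|) <= M * (l2 - l1).
  move=> xy yx lf fM; have icf : integ (cut x y f) by exact: integ_cut.
  split=> //; rewrite -yx -J_cst// J_cut; apply: le_int.
  - exact: integ_norm.
  - by apply: integ_cut; apply: cont_locint => ?; exact: cvg_cst.
  - by move=> t; rewrite /cut; case: ifP => // _; rewrite normr0.
split.
- apply: measurable_fun_ifT => //.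
    apply: measurable_and; apply: measurable_fun_ler.
    + by apply: measurable_funD => //; exact: measurable_fst.
    + exact: measurable_snd.
    + exact: measurable_snd.
    + by apply: measurable_funD => //; exact: measurable_fst.
  apply: measurableT_comp; first exact: cont_meas.
  by apply: measurable_funB; [exact: measurable_fst|exact: measurable_snd].
- by move=> x y; rewrite /window; case: ifP => // _; rewrite normr0.
- move=> x; rewrite (_ : window l1 l2 g x = cut (x + l1) (x + l2) (fun y => g (x - y)))//.
  apply: bound => //; [lra|lra|].
  apply: cont_locint => y; apply: continuous_comp; last exact: cg.
  by apply: cvgB; [exact: cvg_cst|exact: cvg_id].
- move=> y; have E x : window l1 l2 g x y = cut (y - l2) (y - l1) (fun x => g (x - y)) x.
    rewrite /window /cut.
    by rewrite (_ : (x + l1 <= y <= x + l2) = (y - l2 <= x <= y - l1))//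
      lerBlDr lerBrDr andbC.
  rewrite (funext E); under eq_Rintegral do rewrite E.
  apply: bound => //; [lra|lra|].
  apply: cont_locint => x; apply: continuous_comp; last exact: cg.
  by apply: cvgB; [exact: cvg_id|exact: cvg_cst].
Qed.

(** An H^2 function given by its continuous representative together with its derivatives, so that
    integral identities for u and u1 hold at every point. *)
Definition nice u u1 u2 := [/\ AC u u1, AC u1 u2, L2 u, L2 u1 & L2 u2].

Lemma nice_ip2 u u1 u2 v v1 v2 : nice u u1 u2 -> nice v v1 v2 -> ip u2 v = - ip u1 v1.
Proof. by move=> [Au Au1 Lu Lu1 Lu2] [Av Av1 Lv Lv1 Lv2]; exact: ibp_line. Qed.

Lemma nice_shift h u u1 u2 : nice u u1 u2 -> nice (sh h u) (sh h u1) (sh h u2).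
Proof.
by move=> [Au Au1 Lu Lu1 Lu2]; split; try exact: AC_shift; exact: L2_shift.
Qed.

(** By parts, the cross terms (u2, u(. - h)) and (u2, u) become - (u1, u1(. - h)) and - |u1|^2. They
    differ by half the squared norm of u1(. - h) - u1. *)
Lemma energy_identity a h u u1 u2 : nice u u1 u2 ->
  nsq (fun x => - u2 x - a * sh h u x) =
  nsq (fun x => u2 x + a * u x) + a * nsq (fun x => sh h u1 x - u1 x).
Proof.
move=> Nu; have Nh := nice_shift h Nu; have [Au Au1 Lu Lu1 Lu2] := Nu.
have [_ _ Lh Lh1 _] := Nh.
rewrite -[LHS]nsqN.
rewrite (_ : (fun x => - _) = (fun x => u2 x + a * sh h u x)); last first.
  by apply/funext => x; ring.
rewrite nsqB// (nsqD Lu2 (L2Z a Lh)) (nsqD Lu2 (L2Z a Lu)) !nsqZ// !ipZr//.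
rewrite (nice_ip2 Nu Nh) (nice_ip2 Nu Nu) !nsq_shift// (ipC u1 (sh h u1)).
by rewrite -/(nsq u1); ring.
Qed.

Lemma nsq_incr_sym h u : L2 u ->
  nsq (fun x => sh h u x - u x) = nsq (fun x => sh (- h) u x - u x).
Proof.
move=> Lu; rewrite -(nsq_shift (- h)); last by apply: L2B => //; exact: L2_shift.
rewrite -[RHS]nsqN; congr nsq; apply/funext => x.
rewrite -[X in X = _]/(sh (- h) (sh h u) x - sh (- h) u x).
by rewrite sh_sh addNr sh0 opprB.
Qed.

(** The integrand is the derivative in y of cos (k (x + h - y)) u1(y) - k sin (k (x + h - y)) u(y),
    and the left side is the increment of this function from x to x + h. *)
Lemma variation_of_constants k h u u1 u2 x : 0 <= h -> AC u u1 -> AC u1 u2 ->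
  sh (- h) u1 x - cos (k * h) * u1 x + k * sin (k * h) * u x =
  Kop (window 0 h (fun t => cos (k * (t + h)))) (fun y => u2 y + k ^+ 2 * u y) x.
Proof.
move=> h0 Au Au1; rewrite Kop_window addr0.
have A := AC_B (AC_M (AC_cos k (x + h)) Au1) (AC_Z k (AC_M (AC_sin k (x + h)) Au)).
rewrite (_ : J _ _ _ = J x (x + h) (fun y => k * sin (k * (x + h - y)) * u1 y +
    cos (k * (x + h - y)) * u2 y - k * (- k * cos (k * (x + h - y)) * u y +
    sin (k * (x + h - y)) * u1 y))); last first.
  apply: eq_Rintegral => y _; rewrite (_ : x - y + h = x + h - y); last by ring.
  by ring.
rewrite -A.2 ?lerDl// subrr mulr0 cos0 sin0 /sh opprK.
by rewrite (_ : x + h - x = h); [ring|ring].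
Qed.

Lemma coercive_delay a h u u1 u2 : 0 < a -> cos (Num.sqrt a * h) != 1 -> nice u u1 u2 ->
  nsq u <= 2 * (4 * (a^-1 + h ^+ 2) / (cos (Num.sqrt a * h) - 1) ^+ 2 + a^-1) / a
    * nsq (fun x => - u2 x - a * sh h u x).
Proof.
move=> a0 ch Nu; set k := Num.sqrt a; set F := nsq (fun x => - u2 x - _).
have [Au Au1 Lu Lu1 Lu2] := Nu.
have ka : k ^+ 2 = a by rewrite sqr_sqrtr// ltW.
pose w x := u2 x + k ^+ 2 * u x.
have Lw : L2 w by apply: L2D => //; exact: L2Z.
have F0 : 0 <= F by exact: nsq_ge0.
have EF : F = nsq w + a * nsq (fun x => sh h u1 x - u1 x).
  by rewrite /F (energy_identity a h Nu)// /w ka.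
(* [variation_of_constants] wants a nonnegative delay. Neither cos (k h) nor the norm of the
   increment of u1 sees the sign of h. *)
pose H := `|h|; have H0 : 0 <= H by exact: normr_ge0.
have cH : cos (k * h) = cos (k * H).
  by rewrite /H; case: (ger0P h) => // _; rewrite mulrN cosN.
have EF2 : F = nsq w + a * nsq (fun x => sh (- H) u1 x - u1 x).
  rewrite EF /H; case: (ger0P h) => _; first by rewrite nsq_incr_sym.
  by rewrite opprK.
pose al := cos (k * h) - 1; pose be := sin (k * H).
have al0 : 0 < al ^+ 2 by rewrite exprn_even_gt0//= subr_eq0.
pose E := Kop (window 0 H (fun t => cos (k * (t + H)))) w.
have EE : E = fun x => sh (- H) u1 x - cos (k * H) * u1 x + k * sin (k * H) * u x.
  by apply/funext => x; rewrite (variation_of_constants k x H0 Au Au1).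
have kK : skernel (window 0 H (fun t => cos (k * (t + H)))) 1 (1 * (H - 0)).
  apply: skernel_window => //.
  - move=> t; apply: continuous_comp; last exact: continuous_cos.
    by apply: cvgM; [exact: cvg_cst|apply: cvgD; [exact: cvg_id|exact: cvg_cst]].
  - by move=> t; rewrite ler_norml cos_geN1 cos_le1.
have [LE nE] : L2 E /\ nsq E <= H ^+ 2 * nsq w.
  have := schur kK Lw; rewrite mul1r subr0; apply; rewrite -/E EE.
  apply: measurable_funD; first apply: measurable_funB.
  - by apply: meas_shift; exact: Lu1.1.
  - by apply: measurable_funM => //; exact: Lu1.1.
  - by apply: measurable_funM => //; exact: Lu.1.
have ip0 : ip u1 u = 0.
  by have := ibp_line Au Au Lu Lu1 Lu Lu1; rewrite (ipC u u1); lra.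
(* The square has no cross term, so the right side of [n2] bounds its u1 part alone, whatever the
   sign and size of [be]. *)
have n1 : nsq (fun x => al * u1 x - (k * be) * u x) =
    al ^+ 2 * nsq u1 + (k * be) ^+ 2 * nsq u.
  rewrite nsqB ?nsqZ//; [|exact: L2Z..].
  by rewrite ipZl ?ipZr ?ip0//; [ring|exact: L2Z].
have n2 : nsq (fun x => al * u1 x - (k * be) * u x) <=
    2 * nsq (fun x => sh (- H) u1 x - u1 x) + 2 * nsq E.
  rewrite -(nsqN E) (_ : (fun x => al * u1 x - _) =
    (fun x => (sh (- H) u1 x - u1 x) + (- E x))); last first.
    by apply/funext => x; rewrite EE /al /be cH; ring.
  apply: nsqD_le; last exact: L2N.
  by apply: L2B => //; exact: L2_shift.
have ip2 : ip w u = - nsq u1 + a * nsq u.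
  rewrite /w ipDl ?ipZl// ?ka ?(nice_ip2 Nu Nu)//; exact: L2Z.
have cs := nsq_ge0 (fun x => w x - a * u x).
rewrite nsqB ?nsqZ ?ipZr// in cs; last exact: L2Z.
have nw0 := nsq_ge0 w; have nd0 := nsq_ge0 (fun x => sh (- H) u1 x - u1 x).
have nu0 := nsq_ge0 u; have nu10 := nsq_ge0 u1.
have hH : H ^+ 2 = h ^+ 2 by rewrite real_normK// num_real.
have b1 : nsq u1 <= 4 * (a^-1 + h ^+ 2) / al ^+ 2 * F.
  rewrite mulrAC ler_pdivlMr// mulrC.
  have d1 : nsq (fun x => sh (- H) u1 x - u1 x) <= a^-1 * F.
    by rewrite mulrC ler_pdivlMr// EF2 mulrC; lra.
  have d2 : nsq w <= F by rewrite EF2 lerDl mulr_ge0// ltW.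
  have d3 : nsq E <= h ^+ 2 * F.
    by apply: le_trans nE _; rewrite hH ler_wpM2l ?sqr_ge0.
  have : 0 <= (k * be) ^+ 2 * nsq u by rewrite mulr_ge0 ?sqr_ge0.
  by have := nsq_ge0 E; rewrite n1 in n2; lra.
have d2 : nsq w <= F by rewrite EF2 lerDl mulr_ge0// ltW.
rewrite mulrAC ler_pdivlMr//.
(* By |w - a u|^2 >= 0, that is 2 a (w, u) <= |w|^2 + a^2 |u|^2, half of a |u|^2 is absorbed on the
   left. *)
have cs' : a * nsq u <= 2 * nsq u1 + a^-1 * nsq w.
  have : 0 <= a^-1 * (nsq w - 2 * (a * ip w u) + a ^+ 2 * nsq u).
    by rewrite mulr_ge0// invr_ge0 ltW.
  rewrite (_ : a^-1 * _ = a^-1 * nsq w - 2 * ip w u + a * nsq u); last first.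
    by field; rewrite gt_eqF.
  by rewrite ip2; lra.
have : a^-1 * nsq w <= a^-1 * F by rewrite ler_pM2l// invr_gt0.
have : 0 <= a^-1 * F by rewrite mulr_ge0// invr_ge0 ltW.
by rewrite -/al; lra.
Qed.

End delay_equation.

(** * Existence through the resolvent of the second derivative *)

Section resolvent_operator.
Context {R : realType}.
Implicit Types (f g u v p q : R -> R) (x y b c h a k : R).

Local Notation mu := (@lebesgue_measure R).
Local Notation meas f := (measurable_fun [set: R] f).
Local Notation int f := (Rintegral mu [set: R] f).

(** [A h v] is - u'' - a u(. - h) for u = G v, since u'' = G v - v. As G is self-adjoint and
    commutes with translations, the adjoint of [A h] is [A (- h)], and [coercive_delay] applies to
    it because cos is even. Only these properties of G enter, which keeps its kernel out of the
    estimates. *)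
Lemma exist_of_resolvent (Gop G1 : (R -> R) -> R -> R) b a h f :
  0 < b -> L2op Gop b ->
  (forall u v, L2 u -> L2 v -> ip (Gop u) v = ip u (Gop v)) ->
  (forall h u, L2 u -> Gop (sh h u) = sh h (Gop u)) ->
  (forall u, L2 u -> nice (Gop u) (G1 u) (fun x => Gop u x - u x)) ->
  0 < a -> cos (Num.sqrt a * h) != 1 -> L2 f ->
  exists u u1 u2, nice u u1 u2 /\ {ae mu, forall x, - u2 x - a * u (x - h) = f x}.
Proof.
move=> b0 [GL GD GZ] Gop_adj Gop_sh nice_Gop a0 ch Lf.
pose A h u x := u x - Gop u x - a * sh h (Gop u) x.
have AL h' u : L2 u -> L2 (A h' u) /\ nsq (A h' u) <= (2 + 4 * b + 4 * a ^+ 2 * b) * nsq u.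
  move=> Lu; have [LG nG] := GL _ Lu; split; first by rewrite /A; l2.
  rewrite (_ : A h' u = fun x => u x + - (Gop u x + a * sh h' (Gop u) x)); last first.
    by apply/funext => x; rewrite /A; ring.
  apply: le_trans (nsqD_le Lu _) _; first by l2.
  rewrite nsqN.
  have := nsqD_le LG (L2Z a (L2_shift h' LG)).
  rewrite nsqZ ?nsq_shift//; last by l2.
  have : a ^+ 2 * nsq (Gop u) <= a ^+ 2 * (b * nsq u).
    by rewrite ler_wpM2l ?sqr_ge0.
  by lra.
have Aop h' : L2op (A h') (2 + 4 * b + 4 * a ^+ 2 * b).
  split; first exact: AL.
  - by move=> u v Lu Lv; apply/funext => x; rewrite /A GD// /sh; ring.
  - by move=> c u Lu; apply/funext => x; rewrite /A GZ// /sh; ring.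
have B0 : 0 < 2 + 4 * b + 4 * a ^+ 2 * b.
  have := mulr_ge0 (sqr_ge0 a) (ltW b0); lra.
have adj u v : L2 u -> L2 v -> ip (A h u) v = ip u (A (- h) v).
  move=> Lu Lv; have [LGu _] := GL _ Lu; have [LGv _] := GL _ Lv.
  rewrite /A ipBl ?ipBl ?ipBr ?ipBr ?ipZl ?ipZr//; try by l2.
  by rewrite Gop_adj// ip_shC// Gop_adj ?Gop_sh//; l2.
set C := 2 * (4 * (a^-1 + h ^+ 2) / (cos (Num.sqrt a * h) - 1) ^+ 2 + a^-1) / a.
have C0 : 0 <= C.
  have i0 : 0 <= a^-1 by rewrite invr_ge0 ltW.
  apply: divr_ge0; last exact: ltW.
  apply: mulr_ge0 => //; apply: addr_ge0 => //; apply: divr_ge0; last exact: sqr_ge0.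
  by apply: mulr_ge0 => //; apply: addr_ge0 => //; exact: sqr_ge0.
(* From v = G v + (A v + a (G v)(. + h)), where A stands for [A (- h)]: |G v|^2 <= C |A v|^2, and
   [nsqD_le] is used twice. *)
pose D := 4 + (2 + 4 * a ^+ 2) * C.
have D0 : 0 < D.
  have : 0 <= (2 + 4 * a ^+ 2) * C.
    by rewrite mulr_ge0// addr_ge0// mulr_ge0 ?sqr_ge0.
  by rewrite /D; lra.
have coer v : L2 v -> nsq v <= D * nsq (A (- h) v).
  move=> Lv; have N := nice_Gop _ Lv; have [LG _] := GL _ Lv.
  have := @coercive_delay R a (- h) _ _ _ a0 _ N; rewrite mulrN cosN sqrrN -/C => /(_ ch).
  rewrite (_ : (fun x => - (Gop v x - v x) - _) = A (- h) v); last first.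
    by apply/funext => x; rewrite /A; ring.
  have [LA _] := AL (- h) _ Lv.
  move=> n1.
  have n2 : nsq v <= 2 * nsq (Gop v) + 2 * nsq (fun x => A (- h) v x + a * sh (- h) (Gop v) x).
    rewrite {1}(_ : v = fun x => Gop v x + (A (- h) v x + a * sh (- h) (Gop v) x)); last first.
      by apply/funext => x; rewrite /A; ring.
    by apply: nsqD_le => //; l2.
  have := nsqD_le LA (L2Z a (L2_shift (- h) LG)).
  rewrite nsqZ ?nsq_shift//; last by l2.
  have : a ^+ 2 * nsq (Gop v) <= a ^+ 2 * (C * nsq (A (- h) v)).
    by rewrite ler_wpM2l ?sqr_ge0.
  by rewrite /D; lra.
have [v Lv hv] := neumann B0 D0 (Aop h) (Aop (- h)) adj coer Lf.
exists (Gop v), (G1 v), (fun x => Gop v x - v x).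
split; first exact: nice_Gop _ Lv.
by move: hv; apply: filterS => x <-; rewrite /A /sh; ring.
Qed.

Lemma integ_oneDsqr : integ (fun x : R => (1 + x ^+ 2)^-1).
Proof.
have c : continuous (fun x : R => (1 + x ^+ 2)^-1) by exact: continuous_oneDsqrV.
apply/integrableP; split; first by apply/measurable_EFinP; exact: cont_meas c.
have p0 x : 0 <= (1 + x ^+ 2)^-1 by rewrite invr_ge0 addr_ge0 ?sqr_ge0.
under eq_integral do rewrite gee0_abs ?lee_fin//.
have := @ge0_symfun_integralT R (fun x => (1 + x ^+ 2)^-1) p0 c.
move=> -> //; last by move=> x; rewrite /= sqrrN.
have := @integral0y_oneDsqr R.
rewrite (_ : [set x | 0 <= x] = `[0, +oo[%classic); last first.
  by apply/seteqP; split => x /=; rewrite in_itv/= andbT.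
by rewrite /oneDsqr => ->; rewrite -EFinM ltry.
Qed.

Definition dexp x := expR (- `|x|) : R.

(** exp |x| = exp (|x| / 2)^2 >= (1 + |x| / 2)^2 >= (1 + x^2) / 4. *)
Lemma dexp_le x : dexp x <= 4 * (1 + x ^+ 2)^-1.
Proof.
rewrite /dexp expRN -[X in _ <= X]invrK lef_pV2 ?posrE ?expR_gt0//; last first.
  by rewrite invr_gt0 mulr_gt0// invr_gt0 ltr_pwDl ?sqr_ge0.
rewrite invfM invrK.
have h := expR_ge1Dx (`|x| / 2).
have -> : expR `|x| = expR (`|x| / 2) ^+ 2.
  by rewrite -expRM_natl; congr expR; field.
rewrite -(real_normK (num_real x)); have := normr_ge0 x; nra.
Qed.

Lemma dexpN x : dexp (- x) = dexp x. Proof. by rewrite /dexp normrN. Qed.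

Lemma dexp_cont : continuous dexp.
Proof.
move=> x; apply: continuous_comp; last exact: continuous_expR.
by apply: cvgN; exact: norm_continuous.
Qed.

Lemma integ_dexp : integ dexp.
Proof.
apply: le_integ (integZ 4 integ_oneDsqr); first exact: cont_meas dexp_cont.
by move=> x; rewrite ger0_norm ?expR_ge0//; exact: dexp_le.
Qed.

Lemma skernel_dexp (K : R -> R -> R) :
  measurable_fun [set: R * R] (fun z => K z.1 z.2) ->
  (forall x y, `|K x y| <= dexp (x - y)) -> skernel K 1 (int dexp).
Proof.
move=> mK Kd.
have row x : integ (K x) /\ int (fun y => `|K x y|) <= int dexp.
  have mx : meas (K x).
    rewrite (_ : K x = (fun z : R * R => K z.1 z.2) \o (fun y => (x, y)))//.
    by apply: measurableT_comp => //; exact: measurable_pair1.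
  have d y : `|K x y| <= sh x dexp y by rewrite /sh -dexpN opprB.
  have i := integ_shift x integ_dexp.
  have iK : integ (K x) by exact: le_integ i.
  split=> //; rewrite -(int_shift x (integ_meas integ_dexp)).
  by apply: le_int => //; exact: integ_norm.
have col y : integ (K ^~ y) /\ int (fun x => `|K x y|) <= int dexp.
  have mx : meas (K ^~ y).
    rewrite (_ : K ^~ y = (fun z : R * R => K z.1 z.2) \o (fun x => (x, y)))//.
    by apply: measurableT_comp => //; exact: measurable_pair2.
  have d x : `|K x y| <= sh y dexp x by rewrite /sh.
  have i := integ_shift y integ_dexp.
  have iK : integ (K ^~ y) by exact: le_integ i.
  split=> //; rewrite -(int_shift y (integ_meas integ_dexp)).
  by apply: le_int => //; exact: integ_norm.
split=> // x y; apply: le_trans (Kd x y) _.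
by rewrite /dexp -expR0 ler_expR oppr_le0.
Qed.

(** [Km] and [Kp] are the two halves of exp (- |x - y|). Each half solves a first-order equation,
    from which both derivatives of the half-sum [Gop] are read off. *)
Definition Km x y := if y <= x then expR (y - x) else 0 : R.
Definition Kp x y := if x <= y then expR (x - y) else 0 : R.

Lemma skernel_Km : skernel Km 1 (int dexp).
Proof.
apply: skernel_dexp.
  apply: measurable_fun_ifT => //.
    by apply: measurable_fun_ler; [exact: measurable_snd|exact: measurable_fst].
  apply: measurableT_comp; first exact: cont_meas (@continuous_expR R).
  by apply: measurable_funB; [exact: measurable_snd|exact: measurable_fst].
move=> x y; rewrite /Km /dexp; case: ifPn; last by rewrite normr0 expR_ge0.
by move=> yx; rewrite ger0_norm ?expR_ge0// ger0_norm ?subr_ge0// opprB.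
Qed.

Lemma trKm : trK Km = Kp. Proof. by []. Qed.

Lemma skernel_Kp : skernel Kp 1 (int dexp).
Proof. by rewrite -trKm; apply: skernel_tr; exact: skernel_Km. Qed.

Lemma AC_expR c : AC (fun x : R => expR (c * x)) (fun x => c * expR (c * x)).
Proof.
apply: AC_C1.
  move=> x; have D : is_derive x (1:R) (fun y : R => c * y) c.
    by apply: is_derive_eq; rewrite /GRing.scale/=; ring.
  have := @is_derive1_comp _ expR (fun y : R => c * y) x _ _ (is_derive_expR _) D.
  by rewrite /comp => H; apply: is_derive_eq H _; rewrite /GRing.scale/=; ring.
move=> x; apply: cvgM; first exact: cvg_cst.
apply: continuous_comp; last exact: continuous_expR.
by apply: cvgM; [exact: cvg_cst|exact: cvg_id].
Qed.

(** exp x * [Kop Km g x] is the integral of exp y * g y over y <= x; the product rule with exp (- x)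
    gives the density. *)
Lemma AC_Km g : L2 g -> AC (Kop Km g) (fun x => g x - Kop Km g x).
Proof.
move=> Lg; pose P x := expR x * Kop Km g x.
have iP x : integ (fun y => if y <= x then expR y * g y else 0).
  have := integZ (expR x) (Kop_integ x skernel_Km Lg).
  congr integ; apply/funext => y; rewrite /Km; case: ifP => _; last by rewrite mul0r mulr0.
  by rewrite mulrA -expRD; congr (expR _ * _); ring.
have PE x : P x = int (fun y => if y <= x then expR y * g y else 0).
  rewrite /P -intZ; last exact: Kop_integ skernel_Km Lg.
  apply: eq_Rintegral => y _; rewrite /Km; case: ifP => _; last by rewrite mul0r mulr0.
  by rewrite mulrA -expRD; congr (expR _ * _); ring.
have le : locint (fun y => expR y * g y).
  under eq_fun do rewrite mulrC; apply: locint_mul_cont; first exact: L2_locint.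
  exact: continuous_expR.
have AP : AC P (fun y => expR y * g y).
  split=> // x z xz; rewrite !PE -intB// J_cut; apply: int_ae.
  - exact: integ_meas (integB (iP z) (iP x)).
  - exact: integ_meas (integ_cut _ _ le).
  exists [set x]; split; [exact: measurable_set1|exact: lebesgue_measure_set1|].
  have E (y : R) : y != x -> (if y <= z then expR y * g y else 0) -
      (if y <= x then expR y * g y else 0) = cut x z (fun y => expR y * g y) y.
    move=> yx; rewrite /cut; have [xy|yx'] := ltP x y.
      by rewrite subr0 (ltW xy).
    have yx2 : y < x by rewrite lt_neqAle yx.
    by rewrite (lt_geF yx2) (le_trans yx' xz)/= subrr.
  by move=> y /=; apply: contra_notP => /eqP /E.
apply: (AC_eq (AC_M (AC_expR (-1)) AP)) => x.
  by rewrite /P mulrA -expRD mulN1r addNr expR0 mul1r.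
rewrite !mulN1r mulrA -expRD addNr expR0 mul1r /P mulNr mulrA -expRD addNr expR0.
by ring.
Qed.

Lemma AC_Kp g : L2 g -> AC (Kop Kp g) (fun x => Kop Kp g x - g x).
Proof.
move=> Lg; pose P x := expR (- x) * Kop Kp g x.
have iP x : integ (fun y => if x <= y then expR (- y) * g y else 0).
  have := integZ (expR (- x)) (Kop_integ x skernel_Kp Lg).
  congr integ; apply/funext => y; rewrite /Kp; case: ifP => _; last by rewrite mul0r mulr0.
  by rewrite mulrA -expRD; congr (expR _ * _); ring.
have PE x : P x = int (fun y => if x <= y then expR (- y) * g y else 0).
  rewrite /P -intZ; last exact: Kop_integ skernel_Kp Lg.
  apply: eq_Rintegral => y _; rewrite /Kp; case: ifP => _; last by rewrite mul0r mulr0.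
  by rewrite mulrA -expRD; congr (expR _ * _); ring.
have le : locint (fun y => - (expR (- y) * g y)).
  under eq_fun do rewrite -mulNr mulrC; apply: locint_mul_cont; first exact: L2_locint.
  move=> x; apply: cvgN; apply: continuous_comp; last exact: continuous_expR.
  by apply: cvgN; exact: cvg_id.
have AP : AC P (fun y => - (expR (- y) * g y)).
  split=> // x z xz; rewrite !PE -intB// J_cut; apply: int_ae.
  - exact: integ_meas (integB (iP z) (iP x)).
  - exact: integ_meas (integ_cut _ _ le).
  (* The cut contains its right end z, the difference of the two half-line integrands does not. *)
  exists [set z]; split; [exact: measurable_set1|exact: lebesgue_measure_set1|].
  have E (y : R) : y != z -> (if z <= y then expR (- y) * g y else 0) -
      (if x <= y then expR (- y) * g y else 0) =
      cut x z (fun y => - (expR (- y) * g y)) y.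
    move=> yz; rewrite /cut; have [zy|yz'] := leP z y.
      have zy' : z < y by rewrite lt_neqAle eq_sym yz.
      by rewrite (le_trans xz zy)/= (lt_geF zy') subrr.
    by rewrite (ltW yz') andbT; case: ifP => _; rewrite sub0r// oppr0.
  by move=> y /=; apply: contra_notP => /eqP /E.
apply: (AC_eq (AC_M (AC_expR 1) AP)) => x.
  by rewrite /P mulrA -expRD mul1r addrN expR0 mul1r.
rewrite !mul1r /P mulrN !mulrA -!expRD addrN expR0.
by ring.
Qed.

Lemma Kop_Km_sh h u x : L2 u -> Kop Km (sh h u) x = Kop Km u (x - h).
Proof.
move=> Lu; rewrite /Kop -[RHS](int_shift h); last first.
  by apply: integ_meas; exact: Kop_integ skernel_Km Lu.
apply: eq_Rintegral => y _; rewrite /sh /Km lerD2r; congr (_ * _).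
by rewrite (_ : y - h - (x - h) = y - x)//; ring.
Qed.

Lemma Kop_Kp_sh h u x : L2 u -> Kop Kp (sh h u) x = Kop Kp u (x - h).
Proof.
move=> Lu; rewrite /Kop -[RHS](int_shift h); last first.
  by apply: integ_meas; exact: Kop_integ skernel_Kp Lu.
apply: eq_Rintegral => y _; rewrite /sh /Kp lerD2r; congr (_ * _).
by rewrite (_ : x - h - (y - h) = x - y)//; ring.
Qed.

#[local] Opaque Km Kp.

(** Convolution with exp (- |x|) / 2, the Green function of 1 - d^2/dx^2 on the line. *)
Definition Gop g : R -> R := fun x => 2^-1 * (Kop Km g x + Kop Kp g x).

Lemma L2_Kop K u : (forall u, L2 u -> meas (Kop K u)) -> skernel K 1 (int dexp) ->
  L2 u -> L2 (Kop K u) /\ nsq (Kop K u) <= int dexp ^+ 2 * nsq u.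
Proof. by move=> mK kK hu; apply: schur kK hu (mK _ hu). Qed.

Lemma L2_Km u : L2 u -> L2 (Kop Km u) /\ nsq (Kop Km u) <= int dexp ^+ 2 * nsq u.
Proof. by apply: L2_Kop skernel_Km => v hv; exact: AC_meas (AC_Km hv). Qed.

Lemma L2_Kp u : L2 u -> L2 (Kop Kp u) /\ nsq (Kop Kp u) <= int dexp ^+ 2 * nsq u.
Proof. by apply: L2_Kop skernel_Kp => v hv; exact: AC_meas (AC_Kp hv). Qed.

Lemma nice_Gop g : L2 g ->
  nice (Gop g) (fun x => 2^-1 * (Kop Kp g x - Kop Km g x)) (fun x => Gop g x - g x).
Proof.
move=> Lg; have [Lm _] := L2_Km Lg; have [Lp _] := L2_Kp Lg.
have Am := AC_Km Lg; have Ap := AC_Kp Lg.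
split.
- apply: (AC_eq (AC_Z 2^-1 (AC_D Am Ap))) => x; first by [].
  by move: (Kop Km g x) (Kop Kp g x) => ? ?; ring.
- apply: (AC_eq (AC_Z 2^-1 (AC_B Ap Am))) => x; first by [].
  by rewrite /Gop; move: (Kop Km g x) (Kop Kp g x) => ? ?; field.
- by rewrite /Gop; l2.
- by l2.
- by rewrite /Gop; l2.
Qed.

Lemma Gop_adj u v : L2 u -> L2 v -> ip (Gop u) v = ip u (Gop v).
Proof.
move=> Lu Lv; have [Lm _] := L2_Km Lu; have [Lp _] := L2_Kp Lu.
have [Lm' _] := L2_Km Lv; have [Lp' _] := L2_Kp Lv.
have E1 : ip (Gop u) v = 2^-1 * (ip (Kop Km u) v + ip (Kop Kp u) v).
  by rewrite -(ipDl Lm Lp Lv) -(ipZl 2^-1 (L2D Lm Lp) Lv).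
have E2 : ip u (Gop v) = 2^-1 * (ip u (Kop Km v) + ip u (Kop Kp v)).
  by rewrite -(ipDr Lm' Lp' Lu) -(ipZr 2^-1 (L2D Lm' Lp') Lu).
have E3 : ip (Kop Km u) v = ip u (Kop Kp v) := Kop_adj skernel_Km Lu Lv.
have E4 : ip (Kop Kp u) v = ip u (Kop Km v) := Kop_adj skernel_Kp Lu Lv.
by rewrite E1 E2 E3 E4 [X in _ * X = _]addrC.
Qed.

Lemma Kop_lin K (M B : R) : skernel K M B ->
  (forall u v, L2 u -> L2 v -> Kop K (fun x => u x + v x) = (fun x => Kop K u x + Kop K v x)) /\
  (forall c u, L2 u -> Kop K (fun x => c * u x) = (fun x => c * Kop K u x)).
Proof.
move=> kK; split=> [u v hu hv|c u hu]; apply/funext => x.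
  rewrite /Kop -intD; [|exact: Kop_integ kK hu|exact: Kop_integ kK hv].
  by apply: eq_Rintegral => y _; rewrite mulrDr.
rewrite /Kop -intZ; last exact: Kop_integ kK hu.
by apply: eq_Rintegral => y _; rewrite mulrCA.
Qed.

Lemma Gop_op : exists2 b, 0 < b & L2op Gop b.
Proof.
exists (int dexp ^+ 2 + 1); first by rewrite ltr_wpDl ?sqr_ge0.
have [Dm Zm] := Kop_lin skernel_Km; have [Dp Zp] := Kop_lin skernel_Kp.
split.
- move=> u Lu; have [Lm nm] := L2_Km Lu; have [Lp np] := L2_Kp Lu.
  split; first by rewrite /Gop; l2.
  rewrite /Gop nsqZ; last by l2.
  have := nsqD_le Lm Lp; have := nsq_ge0 u; rewrite exprVn.
  move: nm np; move: (nsq _) (nsq u) (nsq (Kop Km u)) (nsq (Kop Kp u)) => n N p q.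
  by move: (int dexp ^+ 2) => D; lra.
- move=> u v Lu Lv; apply/funext => x; rewrite /Gop Dm// Dp//.
  by move: (Kop Km u x) (Kop Kp u x) (Kop Km v x) (Kop Kp v x) => ? ? ? ?; ring.
- move=> c u Lu; apply/funext => x; rewrite /Gop Zm// Zp//.
  by move: (Kop Km u x) (Kop Kp u x) => ? ?; ring.
Qed.

Lemma Gop_sh h u : L2 u -> Gop (sh h u) = sh h (Gop u).
Proof.
by move=> Lu; apply/funext => x; rewrite /Gop Kop_Km_sh// Kop_Kp_sh.
Qed.


Lemma exist_a a h f : 0 < a -> cos (Num.sqrt a * h) != 1 -> L2 f ->
  exists u u1 u2, nice u u1 u2 /\ {ae mu, forall x, - u2 x - a * u (x - h) = f x}.
Proof.
have [b b0 hG] := Gop_op.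
exact: exist_of_resolvent b0 hG Gop_adj Gop_sh nice_Gop.
Qed.

End resolvent_operator.

(** * The equation at resonance *)

Section window_operator.
Context {R : realType}.
Implicit Types (f g u v p q : R -> R) (x y b c h a k : R).

Local Notation mu := (@lebesgue_measure R).
Local Notation meas f := (measurable_fun [set: R] f).
Local Notation int f := (Rintegral mu [set: R] f).

(* an oriented window: Kop (swin h g) u x = \int_(x - h)^x g (x - y) u(y) dy
   also when h < 0 *)
Definition swin h g : R -> R -> R :=
  if 0 <= h then window (- h) 0 g else window 0 (- h) (fun t => - g t).

Lemma Kop_swin h g u P x : AC P (fun y => g (x - y) * u y) ->
  Kop (swin h g) u x = P x - P (x - h).
Proof.
move=> AP; rewrite /swin; case: ifPn => [h0|]; last rewrite -ltNge => h0.
  by rewrite Kop_window addr0 -AP.2// gerBl.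
rewrite Kop_window addr0 -[RHS]opprB AP.2; last by rewrite lerDl oppr_ge0 ltW.
rewrite -[RHS]mulN1r -JZ; last exact: AP.1.
by apply: eq_Rintegral => y _; rewrite mulN1r mulNr.
Qed.

(** For h <> 0 the delays h and - h fall in different branches of [swin]; at h = 0 both would take
    the first, with the wrong sign on the diagonal. *)
Lemma swin_tr h g : h != 0 -> trK (swin h g) = swin (- h) (fun t => - g (- t)).
Proof.
move=> h0; rewrite /swin oppr_ge0; have [h1|h1] := leP 0 h.
  have h2 : 0 < h by rewrite lt_neqAle eq_sym h0.
  rewrite leNgt h2/= window_tr oppr0 opprK; congr window.
  by apply/funext => t; rewrite opprK.
by rewrite (ltW h1) window_tr oppr0 opprK.
Qed.

Lemma skernel_swin h g (M : R) : continuous g -> (forall t, `|g t| <= M) ->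
  skernel (swin h g) M (M * `|h|).
Proof.
move=> cg gM; rewrite /swin; have [h0|h0] := ger0P h.
  by have := @skernel_window _ (- h) 0 g M cg gM; rewrite sub0r opprK oppr_le0; apply.
have := @skernel_window _ 0 (- h) (fun t => - g t) M; rewrite subr0; apply.
- by move=> t; apply: cvgN; exact: cg.
- by move=> t; rewrite normrN.
- by rewrite oppr_ge0 ltW.
Qed.

Definition anti f : R -> R := fun x => if 0 <= x then J 0 x f else - J x 0 f.

Lemma AC_anti f : locint f -> AC (anti f) f.
Proof. by move=> lf; exact: locint_AC. Qed.

Lemma L2_cst_eq0 c : L2 (fun _ : R => c) -> c = 0.
Proof.
move=> [_ ic]; have i0 : 0 <= c ^+ 2 by exact: sqr_ge0.
have H n : 2 * n%:R * c ^+ 2 <= int (fun _ : R => c ^+ 2).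
  have := J_cst (c ^+ 2) (_ : - n%:R <= n%:R :> R); rewrite J_cut => E.
  have nn : - n%:R <= n%:R :> R by rewrite (le_trans _ (ler0n _ n))// oppr_le0.
  rewrite (_ : 2 * n%:R * c ^+ 2 = c ^+ 2 * (n%:R - - n%:R)); last by ring.
  rewrite -E//; apply: le_int => //.
    by apply: integ_cut; apply: cont_locint => ?; exact: cvg_cst.
  by move=> x; rewrite /cut; case: ifP.
apply/eqP/negP => /negP c0; have cp : 0 < c ^+ 2 by rewrite exprn_even_gt0.
set I := int _ in H.
have /(_ (I / c ^+ 2)) := @archimedean.Num.Theory.archi_boundP R.
have I00 : 0 <= I by exact: int_ge0.
have I0 : 0 <= I / c ^+ 2 by rewrite divr_ge0.
move=> /(_ I0); rewrite ltr_pdivrMr// => lt.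
have K (M : R) : I < M -> 2 * M <= I -> False by lra.
by apply: (K _ lt); rewrite mulrA; exact: H.
Qed.

(** The energy z1^2 + a z^2 has zero derivative, hence is constant; being integrable on the line, it
    is zero. *)
Lemma oscillator_eq0 a z z1 z2 : 0 < a -> nice z z1 z2 ->
  {ae mu, forall x, z2 x = - (a * z x)} -> forall x, z x = 0.
Proof.
move=> a0 [Az Az1 Lz Lz1 Lz2] hz.
have AE := AC_D (AC_M Az1 Az1) (AC_Z a (AC_M Az Az)).
have /AC_const H := AE; have {}H := H _.
have d0 : {ae mu, forall x, z2 x * z1 x + z1 x * z2 x + a * (z1 x * z x + z x * z1 x) = 0}.
  by move: hz; apply: filterS => x ->; ring.
have {}H := H d0.
have E x : z1 x * z1 x + a * (z x * z x) = z1 0 * z1 0 + a * (z 0 * z 0) by exact: H.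
set e := z1 0 * z1 0 + _ in E.
have e0 : 0 <= e.
  by rewrite /e -!expr2 addr_ge0 ?sqr_ge0// mulr_ge0 ?sqr_ge0// ltW.
have : L2 (fun _ : R => Num.sqrt e).
  split=> //; under eq_fun do rewrite sqr_sqrtr//.
  rewrite (_ : (fun _ => e) = (fun x => z1 x * z1 x + a * (z x * z x))).
    by apply: integD; [exact: L2_mul|apply: integZ; exact: L2_mul].
  by apply/funext => x; rewrite E.
move=> /L2_cst_eq0/eqP; rewrite sqrtr_eq0 => e0'.
move=> x; have := E x; have := sqr_ge0 (z1 x); have := sqr_ge0 (z x) => z0 z10 Ex.
apply/eqP; rewrite -sqrf_eq0 eq_le z0 andbT -(ler_pM2l a0) mulr0 expr2; rewrite expr2 in z10.
lra.
Qed.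

Section period.
Variables (a h : R).
Hypotheses (a0 : 0 < a) (h0 : h != 0).
Let k := Num.sqrt a.
Hypotheses (sink : sin (k * h) = 0) (cosk : cos (k * h) = 1).

Let k0 : 0 < k. Proof. by rewrite sqrtr_gt0. Qed.
Let ka : k ^+ 2 = a. Proof. by rewrite sqr_sqrtr// ltW. Qed.

(** The kernel of S; [kc] is that of its companion C. *)
Definition ks t := - k * sin (k * t).
Definition kc t := cos (k * t).

Lemma continuous_mulk : continuous (fun t : R => k * t).
Proof. by move=> t; apply: cvgM; [exact: cvg_cst|exact: cvg_id]. Qed.

Lemma continuous_sink : continuous (fun t : R => sin (k * t)).
Proof.
by move=> t; apply: continuous_comp; [exact: continuous_mulk|exact: continuous_sin].
Qed.

Lemma continuous_kc : continuous kc.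
Proof.
by move=> t; apply: continuous_comp; [exact: continuous_mulk|exact: continuous_cos].
Qed.

Lemma continuous_ks : continuous ks.
Proof. by move=> t; apply: cvgM; [exact: cvg_cst|exact: continuous_sink]. Qed.

Lemma skernel_ks h' : skernel (swin h' ks) k (k * `|h'|).
Proof.
apply: skernel_swin; first exact: continuous_ks.
move=> t; rewrite /ks normrM normrN (gtr0_norm k0) ler_piMr ?(ltW k0)//.
by rewrite ler_norml sin_geN1 sin_le1.
Qed.

Lemma skernel_kc h' : skernel (swin h' kc) 1 (1 * `|h'|).
Proof.
apply: skernel_swin; first exact: continuous_kc.
by move=> t; rewrite ler_norml cos_geN1 cos_le1.
Qed.

(** The addition formulas separate x from y in sin (k (x - y)) and cos (k (x - y)). Thus S u and C u
    are combinations of increments of the primitives [Aop] and [Bop], and the product rule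
    differentiates them. *)
Definition Aop u := anti (fun y => u y * cos (k * y)).
Definition Bop u := anti (fun y => u y * sin (k * y)).

Lemma AC_A u : L2 u -> AC (Aop u) (fun y => u y * cos (k * y)).
Proof.
by move=> Lu; apply: AC_anti; apply: locint_mul_cont; [exact: L2_locint|exact: continuous_kc].
Qed.

Lemma AC_B' u : L2 u -> AC (Bop u) (fun y => u y * sin (k * y)).
Proof.
by move=> Lu; apply: AC_anti; apply: locint_mul_cont; [exact: L2_locint|exact: continuous_sink].
Qed.

Definition sop h' u := Kop (swin h' ks) u.
Definition cop h' u := Kop (swin h' kc) u.

Lemma sopE h' u x : L2 u -> sop h' u x =
  - k * (sin (k * x) * (Aop u x - Aop u (x - h')) - cos (k * x) * (Bop u x - Bop u (x - h'))).
Proof.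
move=> Lu; have H := AC_B (AC_Z (- k * sin (k * x)) (AC_A Lu)) (AC_Z (- k * cos (k * x)) (AC_B' Lu)).
rewrite /sop (@Kop_swin h' ks u (fun y => - k * sin (k * x) * Aop u y - - k * cos (k * x) * Bop u y)).
  by ring.
by apply: (AC_eq H) => // y; rewrite /ks mulrBr sinB; ring.
Qed.

Lemma copE h' u x : L2 u -> cop h' u x =
  cos (k * x) * (Aop u x - Aop u (x - h')) + sin (k * x) * (Bop u x - Bop u (x - h')).
Proof.
move=> Lu; have H := AC_D (AC_Z (cos (k * x)) (AC_A Lu)) (AC_Z (sin (k * x)) (AC_B' Lu)).
rewrite /cop (@Kop_swin h' kc u (fun y => cos (k * x) * Aop u y + sin (k * x) * Bop u y)).
  by ring.
by apply: (AC_eq H) => // y; rewrite /kc mulrBr cosB; ring.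
Qed.

Lemma AC_cosk : AC (fun x => cos (k * x)) (fun x => - k * sin (k * x)).
Proof.
apply: (AC_eq (AC_cos (- k) 0)) => x; rewrite sub0r mulrNN//.
Qed.

Lemma AC_sink : AC (fun x => sin (k * x)) (fun x => k * cos (k * x)).
Proof.
apply: (AC_eq (AC_sin (- k) 0)) => x; rewrite sub0r mulrNN ?opprK//.
Qed.

Lemma cos_shift x : cos (k * (x - h)) = cos (k * x).
Proof. by rewrite mulrBr cosB sink cosk; ring. Qed.

Lemma sin_shift x : sin (k * (x - h)) = sin (k * x).
Proof. by rewrite mulrBr sinB sink cosk; ring. Qed.

Lemma AC_dA u : L2 u -> AC (fun x => Aop u x - Aop u (x - h))
  (fun x => (u x - u (x - h)) * cos (k * x)).
Proof.
move=> Lu; apply: (AC_eq (AC_B (AC_A Lu) (AC_shift h (AC_A Lu)))) => x //.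
by rewrite /sh cos_shift; ring.
Qed.

Lemma AC_dB u : L2 u -> AC (fun x => Bop u x - Bop u (x - h))
  (fun x => (u x - u (x - h)) * sin (k * x)).
Proof.
move=> Lu; apply: (AC_eq (AC_B (AC_B' Lu) (AC_shift h (AC_B' Lu)))) => x //.
by rewrite /sh sin_shift; ring.
Qed.

(** There is no boundary term, since sin (k t) vanishes at both ends t = 0 and t = h of the
    window. *)
Lemma AC_sop u : L2 u -> AC (sop h u) (fun x => - (a * cop h u x)).
Proof.
move=> Lu.
apply: (AC_eq (AC_Z (- k) (AC_B (AC_M AC_sink (AC_dA Lu)) (AC_M AC_cosk (AC_dB Lu))))) => x.
  by rewrite sopE.
by rewrite copE// -ka; ring.
Qed.

(** Here cos (k t) is 1 at both ends of the window, which leaves the boundary term u x - u (x -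
    h). *)
Lemma AC_cop u : L2 u -> AC (cop h u) (fun x => u x - u (x - h) + sop h u x).
Proof.
move=> Lu.
apply: (AC_eq (AC_D (AC_M AC_cosk (AC_dA Lu)) (AC_M AC_sink (AC_dB Lu)))) => x.
  by rewrite copE.
rewrite sopE//; have := cos2Dsin2 (k * x) => e.
rewrite [in RHS](_ : u x - u (x - h) = (u x - u (x - h)) * (cos (k * x) ^+ 2 + sin (k * x) ^+ 2)).
  by ring.
by rewrite e mulr1.
Qed.

(** By periodicity of the kernel, both are integrals between x and x + h of the same function, in
    opposite orientations. *)
Lemma sop_opp u x : L2 u -> sop h u (x + h) = - sop (- h) u x.
Proof.
move=> Lu; rewrite !sopE// opprK addrK (mulrDr k x h) sinD cosD sink cosk; ring.
Qed.

Lemma L2_sop h' u : (forall u, L2 u -> meas (sop h' u)) -> L2 u ->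
  L2 (sop h' u) /\ nsq (sop h' u) <= (k * `|h'|) ^+ 2 * nsq u.
Proof. by move=> mS Lu; exact: schur (skernel_ks h') Lu (mS _ Lu). Qed.

End period.

(** Integrating s' q by parts gives a |q|^2 = (s, u) - (s, u(. - h)) + |s|^2. The last two
    hypotheses make (s, u(. - h)) = - (s, u), so a |q|^2 = 2 (s, u) + |s|^2, which is exactly |u +
    s|^2 - |u|^2. *)
Lemma coercive_of_window a h u s s' q : 0 < a ->
  AC s (fun x => - (a * q x)) -> AC q (fun x => u x - u (x - h) + s x) ->
  L2 u -> L2 s -> L2 q -> L2 s' -> ip s u = ip u s' ->
  (forall x, s (x + h) = - s' x) -> nsq u <= nsq (fun x => u x + s x).
Proof.
move=> a0 As Ac Lu Ls Lc Ls' adj opp.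
have Lh := L2_shift h Lu.
have Ls1 : L2 (fun x => - (a * q x)) by l2.
have Lc1 : L2 (fun x => u x - u (x - h) + s x).
  by apply: L2D => //; apply: L2B.
have := ibp_line As Ac Ls Ls1 Lc Lc1.
rewrite ipNl ?ipZl//; last by l2.
rewrite (ipDr (L2B Lu Lh) Ls Ls) (ipBr Lu Lh Ls) => e.
have e2 : ip s (sh h u) = - ip s u.
  have := ip_shC (- h) Ls Lu; rewrite opprK => <-.
  rewrite (_ : sh (- h) s = fun x => - s' x); last first.
    by apply/funext => x; rewrite /sh opprK opp.
  by rewrite ipNl// ipC adj.
rewrite -/(sh h u) e2 in e.
have ac : 0 <= a * nsq q by rewrite mulr_ge0 ?nsq_ge0// ltW.
rewrite nsqD// (ipC u); move: e ac; rewrite -!/(nsq _); lra.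
Qed.

Section solve.
Variables (a h : R).
Hypotheses (a0 : 0 < a) (h0 : h != 0).
Let k := Num.sqrt a.
Hypotheses (sink : sin (k * h) = 0) (cosk : cos (k * h) = 1).

Let sinkN : sin (k * - h) = 0. Proof. by rewrite mulrN sinN sink oppr0. Qed.
Let coskN : cos (k * - h) = 1. Proof. by rewrite mulrN cosN. Qed.

Local Notation S := (sop a h).
Local Notation S' := (sop a (- h)).

Lemma L2_S u : L2 u -> L2 (S u) /\ nsq (S u) <= (k * `|h|) ^+ 2 * nsq u.
Proof.
by move=> Lu; apply: L2_sop => // v Lv; exact: AC_meas (AC_sop a0 sink cosk Lv).
Qed.

Lemma L2_S' u : L2 u -> L2 (S' u) /\ nsq (S' u) <= (k * `|h|) ^+ 2 * nsq u.
Proof.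
move=> Lu; rewrite -normrN; apply: L2_sop => // v Lv.
exact: AC_meas (AC_sop a0 sinkN coskN Lv).
Qed.

Lemma L2_c u : L2 u -> L2 (cop a h u).
Proof.
move=> Lu; apply: (schur (skernel_kc a h) Lu _).1.
exact: AC_meas (AC_cop sink cosk Lu).
Qed.

(** Transposing the window replaces h by - h and reflects the kernel with a sign, which leaves the
    odd function [ks] unchanged. *)
Lemma S_adj u v : L2 u -> L2 v -> ip (S u) v = ip u (S' v).
Proof.
move=> Lu Lv; rewrite /sop (Kop_adj (skernel_ks a0 h) Lu Lv) (swin_tr _ h0).
rewrite (_ : (fun t => - ks a (- t)) = ks a); first by [].
by apply/funext => t; rewrite /ks mulrN sinN; ring.
Qed.

Lemma coercive_S u : L2 u -> nsq u <= nsq (fun x => u x + S u x).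
Proof.
move=> Lu; have [LS _] := L2_S Lu; have [LS' _] := L2_S' Lu.
apply: (coercive_of_window a0 (AC_sop a0 sink cosk Lu) (AC_cop sink cosk Lu)
  Lu LS (L2_c Lu) LS' (S_adj Lu Lu)) => x.
exact: sop_opp.
Qed.

End solve.

End window_operator.

(** * Solvability and estimate at resonance *)

Section resonant_equation.
Context {R : realType}.
Implicit Types (f g u v p q : R -> R) (x y b h a k : R).

Local Notation mu := (@lebesgue_measure R).
Local Notation meas f := (measurable_fun [set: R] f).
Local Notation int f := (Rintegral mu [set: R] f).

Section solve.
Variables (a h : R).
Hypotheses (a0 : 0 < a) (h0 : h != 0).
Let k := Num.sqrt a.
Hypotheses (sink : sin (k * h) = 0) (cosk : cos (k * h) = 1).

Lemma sop_op h' : (forall u, L2 u -> meas (sop a h' u)) ->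
  L2op (fun u x => u x + sop a h' u x) (2 + 2 * (k * `|h'|) ^+ 2).
Proof.
move=> mS; have [SD SZ] := Kop_lin (skernel_ks a0 h').
split.
- move=> u Lu; have [LS nS] := L2_sop a0 mS Lu; split; first exact: L2D.
  apply: le_trans (nsqD_le Lu LS) _; move: (nsq u) (nsq (sop a h' u)) nS => U V.
  by rewrite -/k; move: ((k * `|h'|) ^+ 2) => B; lra.
- move=> u v Lu Lv; rewrite /sop (SD _ _ Lu Lv); apply/funext => x.
  by move: (Kop _ u x) (Kop _ v x) => ? ?; ring.
- move=> c u Lu; rewrite /sop (SZ _ _ Lu); apply/funext => x.
  by move: (Kop _ u x) => ?; ring.
Qed.

(** Hides the integral operators: the estimate needs only their differential relations and the
    coercivity of 1 + S. *)
Lemma window_pair u : L2 u -> exists s q : R -> R,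
  [/\ AC s (fun x => - (a * q x)), AC q (fun x => u x - u (x - h) + s x), L2 s, L2 q &
   nsq u <= nsq (fun x => u x + s x)].
Proof.
move=> Lu; exists (sop a h u), (cop a h u); split.
- exact: AC_sop.
- exact: AC_cop.
- by have [] := L2_S a0 sink cosk Lu.
- exact: L2_c.
- exact: coercive_S.
Qed.

Lemma window_solve g : L2 g -> exists u s q : R -> R,
  [/\ AC s (fun x => - (a * q x)), AC q (fun x => u x - u (x - h) + s x), L2 u /\ L2 s, L2 q &
   {ae mu, forall x, u x + s x = g x}].
Proof.
move=> Lg.
have sinkN : sin (k * - h) = 0 by rewrite mulrN sinN sink oppr0.
have coskN : cos (k * - h) = 1 by rewrite mulrN cosN.
have m1 u : L2 u -> meas (sop a h u).
  by move=> Lu; exact: AC_meas (AC_sop a0 sink cosk Lu).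
have m2 u : L2 u -> meas (sop a (- h) u).
  by move=> Lu; exact: AC_meas (AC_sop a0 sinkN coskN Lu).
have o1 := sop_op m1; have o2 := sop_op m2; rewrite normrN in o2.
have b0 : 0 < 2 + 2 * (k * `|h|) ^+ 2.
  by rewrite ltr_pwDl// mulr_ge0// sqr_ge0.
have adj u v : L2 u -> L2 v ->
    ip (fun x => u x + sop a h u x) v = ip u (fun x => v x + sop a (- h) v x).
  move=> Lu Lv; have [LS _] := L2_S a0 sink cosk Lu; have [LS' _] := L2_S' a0 sink cosk Lv.
  by rewrite (ipDl Lu LS Lv) (ipDr Lv LS' Lu) (S_adj a0 h0 Lu Lv).
have h0' : - h != 0 by rewrite oppr_eq0.
have coer u : L2 u -> nsq u <= 1 * nsq (fun x => u x + sop a (- h) u x).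
  by move=> Lu; rewrite mul1r; exact: coercive_S.
have [u Lu hu] := neumann b0 ltr01 o1 o2 adj coer Lg.
exists u, (sop a h u), (cop a h u); split=> //.
- exact: AC_sop.
- exact: AC_cop.
- by split=> //; have [] := L2_S a0 sink cosk Lu.
- exact: L2_c.
Qed.

Lemma exist_b f g g1 g2 : nice g g1 g2 -> {ae mu, forall x, g2 x = - f x - a * g x} ->
  exists u u1 u2, nice u u1 u2 /\ {ae mu, forall x, - u2 x - a * u (x - h) = f x}.
Proof.
move=> [Ag Ag1 Lg Lg1 Lg2] hg.
have [u [s [q [As Aq [Lu Ls] Lq hu]]]] := window_solve Lg.
(* u itself is only an L^2 function; g - s agrees with it almost everywhere and is absolutely
   continuous, and s' = - a q gives the derivatives. *)
exists (fun x => g x - s x), (fun x => g1 x + a * q x),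
  (fun x => g2 x + a * (u x - u (x - h) + s x)).
have Lh := L2_shift h Lu.
split; first split.
- by apply: (AC_eq (AC_B Ag As)) => x //; ring.
- exact: AC_D Ag1 (AC_Z a Aq).
- exact: L2B.
- by l2.
- by apply: L2D => //; apply: L2Z; apply: L2D => //; exact: L2B.
have hu' := ae_shift h hu.
have hgu : {ae mu, forall x, g2 x = - f x - a * (u x + s x)}.
  by move: hg hu; apply: filterS2 => x -> ->.
move: hgu hu'; apply: filterS2 => x -> ux.
by rewrite (_ : g (x - h) - s (x - h) = u (x - h)); [ring|rewrite -ux; ring].
Qed.

(** d + s - g is an H^2 solution of z'' + a z = 0, hence zero. So every solution satisfies d + S d =
    g, and the coercivity of 1 + S applies to it. *)
Lemma estimate_b f g g1 g2 d d1 d2 : nice g g1 g2 ->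
  {ae mu, forall x, g2 x = - f x - a * g x} ->
  nice d d1 d2 -> {ae mu, forall x, - d2 x - a * d (x - h) = f x} ->
  nsq d <= nsq g.
Proof.
move=> [Ag Ag1 Lg Lg1 Lg2] hg [Ad Ad1 Ld Ld1 Ld2] hd.
have [s [q [As Aq Ls Lq n]]] := window_pair Ld.
have Lh := L2_shift h Ld.
have N : nice (fun x => d x + s x - g x) (fun x => d1 x - a * q x - g1 x)
    (fun x => d2 x - a * (d x - d (x - h) + s x) - g2 x).
  split.
  - by apply: (AC_eq (AC_B (AC_D Ad As) Ag)).
  - exact: (AC_B (AC_B Ad1 (AC_Z a Aq)) Ag1).
  - by l2.
  - by l2.
  - by apply: L2B => //; apply: L2B => //; apply: L2Z; apply: L2D => //; exact: L2B.
have z0 x : d x + s x - g x = 0.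
  move: x; apply: (oscillator_eq0 a0 N).
  by move: hg hd; apply: filterS2 => x gx fx; rewrite gx -fx; ring.
rewrite (_ : g = fun x => d x + s x)//.
by apply/funext => x; have := z0 x; lra.
Qed.

End solve.

(** Variation of constants from - oo: g x is - 1/k times the integral of sin (k (x - y)) f(y) over y
    <= x. Both primitives it contains are at most N / (1 + |x|), which is square integrable. *)
Lemma orth_source a f : 0 < a -> L2 f -> integ (fun x => (1 + `|x|) * f x) ->
  int (fun x => f x * cos (Num.sqrt a * x)) = 0 ->
  int (fun x => f x * sin (Num.sqrt a * x)) = 0 ->
  exists g g1, nice g g1 (fun x => - f x - a * g x) /\
    nsq g <= 4 / a * int (fun x => (1 + x ^+ 2)^-1) * int (fun x => (1 + `|x|) * `|f x|) ^+ 2.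
Proof.
move=> a0 Lf If; set k := Num.sqrt a => Oc Os.
have k0 : 0 < k by rewrite sqrtr_gt0.
have ka : k ^+ 2 = a by rewrite sqr_sqrtr// ltW.
set N := int (fun x => (1 + `|x|) * `|f x|).
have IN : integ (fun x => (1 + `|x|) * `|f x|).
  have := integ_norm If; congr integ; apply/funext => x.
  by rewrite normrM ger0_norm// addr_ge0.
(* the primitive vanishes at both ends, so it is bounded by the tail of f *)
have prim (t : R -> R) : continuous t -> (forall x, `|t x| <= 1) ->
    int (fun x => f x * t x) = 0 ->
    exists P, AC P (fun x => f x * t x) /\ forall x, (1 + `|x|) * `|P x| <= N.
  move=> ct t1 t0.
  have mft : meas (fun x => f x * t x).
    by apply: measurable_funM; [exact: Lf.1|exact: cont_meas].
  have ft x : `|f x * t x| <= (1 + `|x|) * `|f x|.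
    rewrite normrM mulrC ler_pM// (le_trans (t1 x))// lerDl//.
  have ift : integ (fun x => f x * t x) by exact: le_integ mft ft IN.
  have icut (b : R -> bool) : measurable_fun [set: R] b ->
      integ (fun y => if b y then f y * t y else 0).
    move=> mb; apply: le_integ IN; first exact: measurable_fun_ifT.
    move=> y; case: ifP => // _; rewrite normr0 mulr_ge0// addr_ge0//.
  have ml x : measurable_fun [set: R] (fun y => y <= x) by exact: measurable_fun_ler.
  have mr x : measurable_fun [set: R] (fun y => x < y) by exact: measurable_fun_ltr.
  pose P x := int (fun y => if y <= x then f y * t y else 0).
  have P' x : P x = - int (fun y => if x < y then f y * t y else 0).
    apply/eqP; rewrite -addr_eq0 -intD; [|exact: icut..].
    rewrite -[X in _ == X]t0; apply/eqP; apply: eq_Rintegral => y _.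
    by rewrite ltNge; case: ifP => _; rewrite ?addr0 ?add0r.
  have bd (b : R -> bool) x : measurable_fun [set: R] b -> (forall y, b y -> `|x| <= `|y|) ->
      (1 + `|x|) * `|int (fun y => if b y then f y * t y else 0)| <= N.
    move=> mb hb; have x0 : 0 <= 1 + `|x| by rewrite addr_ge0.
    rewrite -[X in X * _](ger0_norm x0) -normrM -intZ; last exact: icut.
    apply: le_trans (le_normr_Rintegral _ _) _ => //; first by apply: integZ; exact: icut.
    apply: le_int => //; first by apply: integ_norm; apply: integZ; exact: icut.
    move=> y; case: ifP => [/hb xy|_]; last by rewrite mulr0 normr0 mulr_ge0// addr_ge0.
    rewrite normrM (ger0_norm x0); apply: ler_pM => //; first by rewrite lerD2l.
    by rewrite normrM ler_piMr.
  exists P; split.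
    split=> [|x z xz].
      by apply: locint_mul_cont ct; exact: L2_locint.
    rewrite /P -intB; [|exact: icut..]; rewrite J_cut; apply: int_ae.
    - exact: integ_meas (integB (icut _ (ml z)) (icut _ (ml x))).
    - by apply: integ_meas; apply: integ_cut; apply: locint_mul_cont ct; exact: L2_locint.
    exists [set x]; split; [exact: measurable_set1|exact: lebesgue_measure_set1|].
    have E (y : R) : y != x -> (if y <= z then f y * t y else 0) -
        (if y <= x then f y * t y else 0) = cut x z (fun y => f y * t y) y.
      move=> yx; rewrite /cut; have [xy|yx'] := ltP x y.
        by rewrite subr0 (ltW xy).
      have yx2 : y < x by rewrite lt_neqAle yx.
      by rewrite (lt_geF yx2) (le_trans yx' xz)/= subrr.
    by move=> y /=; apply: contra_notP => /eqP /E.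
  (* The tail is taken on the side of x away from 0, where |y| >= |x|, so that the weight can be
     moved under the integral. *)
  move=> x; have [x0|x0] := leP x 0.
    apply: bd => // y yx; rewrite !ler0_norm// ?lerN2//; exact: le_trans x0.
  rewrite P' normrN; apply: bd => // y yx; rewrite !gtr0_norm// ?ltW//.
  exact: lt_trans yx.
have cc : continuous (fun x : R => cos (k * x)) by exact: (@continuous_kc R a).
have cs : continuous (fun x : R => sin (k * x)) by exact: (@continuous_sink R a).
have [|A [AA bA]] := prim _ cc _ Oc.
  by move=> x; rewrite ler_norml cos_geN1 cos_le1.
have [|B [AB bB]] := prim _ cs _ Os.
  by move=> x; rewrite ler_norml sin_geN1 sin_le1.
have Ac := @AC_cosk R a; have As := @AC_sink R a; rewrite -/k in Ac As.
pose g x := - k^-1 * (sin (k * x) * A x - cos (k * x) * B x).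
pose g1 x := - (cos (k * x) * A x + sin (k * x) * B x).
have e x : cos (k * x) ^+ 2 + sin (k * x) ^+ 2 = 1 by exact: cos2Dsin2.
have AG : AC g g1.
  apply: (AC_eq (AC_Z (- k^-1) (AC_B (AC_M As AA) (AC_M Ac AB)))) => x //.
  by rewrite /g1; field; rewrite gt_eqF.
have AG1 : AC g1 (fun x => - f x - a * g x).
  apply: (AC_eq (AC_N (AC_D (AC_M Ac AA) (AC_M As AB)))) => x //.
  rewrite -[f x in RHS]mulr1 -(e x) /g -ka; field; rewrite gt_eqF//.
have N0 : 0 <= N by apply: int_ge0 => x; rewrite mulr_ge0// addr_ge0.
(* Uses 1 + x^2 <= (1 + |x|)^2 and the bound N for each of the two primitives. *)
have bnd x c1 c2 : `|c1| <= 1 -> `|c2| <= 1 ->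
    (c1 * A x + c2 * B x) ^+ 2 <= 4 * N ^+ 2 * (1 + x ^+ 2)^-1.
  move=> h1 h2; have x1 : 0 < 1 + x ^+ 2 by rewrite ltr_pwDl// sqr_ge0.
  rewrite ler_pdivlMr//.
  have n1 : (1 + `|x|) * `|c1 * A x + c2 * B x| <= 2 * N.
    apply: (@le_trans _ _ ((1 + `|x|) * (`|A x| + `|B x|))).
      rewrite ler_wpM2l ?addr_ge0//; apply: le_trans (ler_normD _ _) _.
      by rewrite !normrM lerD// ler_piMl.
    by rewrite mulrDr; have := bA x; have := bB x; lra.
  have n0 : 0 <= (1 + `|x|) * `|c1 * A x + c2 * B x| by rewrite mulr_ge0// addr_ge0.
  have : ((1 + `|x|) * `|c1 * A x + c2 * B x|) ^+ 2 <= (2 * N) ^+ 2.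
    by rewrite ler_pXn2r ?nnegrE// mulr_ge0.
  rewrite !exprMn real_normK ?num_real// => n2.
  rewrite (_ : 4 * N ^+ 2 = 2 ^+ 2 * N ^+ 2); last by ring.
  apply: le_trans n2; rewrite mulrC ler_wpM2r ?sqr_ge0//.
  rewrite -(real_normK (num_real x)); have := normr_ge0 x; nra.
have bg x : g x ^+ 2 <= 4 / a * N ^+ 2 * (1 + x ^+ 2)^-1.
  have := bnd x (sin (k * x)) (- cos (k * x)).
  rewrite normrN !ler_norml cos_geN1 cos_le1 sin_geN1 sin_le1 => /(_ isT isT) b.
  rewrite /g exprMn sqrrN exprVn ka mulNr in b *.
  rewrite (_ : 4 / a * _ * _ = a^-1 * (4 * N ^+ 2 * (1 + x ^+ 2)^-1)); last by ring.
  by rewrite ler_wpM2l// invr_ge0 ltW.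
have bg1 x : g1 x ^+ 2 <= 4 * N ^+ 2 * (1 + x ^+ 2)^-1.
  by rewrite /g1 sqrrN; apply: bnd; rewrite ler_norml ?cos_geN1 ?cos_le1 ?sin_geN1 ?sin_le1.
have LL (v : R -> R) C : meas v -> (forall x, v x ^+ 2 <= C * (1 + x ^+ 2)^-1) -> L2 v.
  move=> mv hv; split=> //; apply: le_integ (integZ C integ_oneDsqr).
    exact: measurable_funX.
  by move=> x; rewrite ger0_norm ?sqr_ge0.
have Lg : L2 g by exact: LL (AC_meas AG) bg.
have Lg1 : L2 g1 by exact: LL (AC_meas AG1) bg1.
exists g, g1; split.
  by split=> //; apply: L2B; [exact: L2N|exact: L2Z].
rewrite nsqE mulrAC -intZ; last exact: integ_oneDsqr.
by apply: le_int => //; [exact: Lg.2|apply: integZ; exact: integ_oneDsqr].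
Qed.

End resonant_equation.

(** * Weak derivatives *)

Section test_functions.
Context {R : realType}.
Implicit Types (f g u v p q phi psi : R -> R) (x y a b c : R) (n m : nat).

Lemma is_derive1P f x (df : R) : is_derive x (1 : R) f df ->
  derivable f x 1 /\ (derive1 f) x = df.
Proof. by move=> h; split; [exact: ex_derive|rewrite derive1E; exact: derive_val]. Qed.

Lemma derivable_is f x : derivable f x 1 -> is_derive x (1 : R) f ((derive1 f) x).
Proof. by move=> h; rewrite derive1E; exact: derivableP. Qed.

(** Peeling off the first derivative makes closure under sums, products and affine substitutions a
    plain induction, with no formula for [derive1n] of a product. *)
Fixpoint Ck n f : Prop :=
  if n is m.+1 then (forall x, derivable f x 1) /\ Ck m (derive1 f) else True.

Lemma CkP f : (forall n, Ck n f) <->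
  (forall k x, derivable (derive1n k f) x 1).
Proof.
split=> [h k x|].
  have: Ck k.+1 f by [].
  clear h; elim: k f => [f [h _]|k IH f [_ h]]; first exact: h.
  by rewrite /derive1n iterSr; apply: IH.
move=> h n; elim: n f h => [//|n IH f h]; split; first exact: (h 0%N).
by apply: IH => k x; have := h k.+1 x; rewrite /derive1n iterSr.
Qed.

Lemma CkS n f : Ck n.+1 f -> Ck n f.
Proof. by elim: n f => [//|n IH f [df h]]; split=> //; exact: IH. Qed.

Lemma CkD n f g : Ck n f -> Ck n g -> Ck n (fun x => f x + g x).
Proof.
elim: n f g => [//|n IH f g [df hf] [dg hg]].
have D x : is_derive x (1 : R) (fun x => f x + g x) ((derive1 f) x + (derive1 g) x).
  by apply: is_deriveD; exact: derivable_is.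
split; first by move=> x; exact: (is_derive1P (D x)).1.
rewrite (_ : derive1 _ = fun x => (derive1 f) x + (derive1 g) x); first exact: IH.
by apply/funext => x; exact: (is_derive1P (D x)).2.
Qed.

Lemma CkM n f g : Ck n f -> Ck n g -> Ck n (fun x => f x * g x).
Proof.
elim: n f g => [//|n IH f g hf hg]; have [df hf'] := hf; have [dg hg'] := hg.
have D x : is_derive x (1 : R) (fun x => f x * g x) ((derive1 f) x * g x + f x * (derive1 g) x).
  have := is_deriveM (derivable_is (df x)) (derivable_is (dg x)).
  by move=> H; apply: is_derive_eq H _; rewrite /GRing.scale/= addrC (mulrC (g x)).
split; first by move=> x; exact: (is_derive1P (D x)).1.
rewrite (_ : derive1 _ = fun x => (derive1 f) x * g x + f x * (derive1 g) x).
  by apply: CkD; apply: IH => //; exact: CkS.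
by apply/funext => x; exact: (is_derive1P (D x)).2.
Qed.

Lemma Ck_cst n c : Ck n (fun _ : R => c).
Proof.
elim: n c => [//|n IH c].
have D x : is_derive x (1 : R) (fun _ : R => c) 0 by exact: is_derive_cst.
split; first by move=> x; exact: (is_derive1P (D x)).1.
rewrite (_ : derive1 _ = fun=> 0); first exact: IH.
by apply/funext => x; exact: (is_derive1P (D x)).2.
Qed.

Lemma CkZ n c f : Ck n f -> Ck n (fun x => c * f x).
Proof. by apply: CkM; exact: Ck_cst. Qed.

Lemma Ck_affine n c b f : Ck n f -> Ck n (fun x => f (c * x + b)).
Proof.
elim: n f => [//|n IH f [df hf]].
have D x : is_derive x (1 : R) (fun x => f (c * x + b)) (c * (derive1 f) (c * x + b)).
  have E : is_derive x (1:R) (fun y : R => c * y + b) c.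
    by apply: is_derive_eq; rewrite /GRing.scale/=; ring.
  have := @is_derive1_comp _ f (fun y : R => c * y + b) x _ _ (derivable_is (df _)) E.
  by move=> H; apply: is_derive_eq H _; rewrite mulrC.
split; first by move=> x; exact: (is_derive1P (D x)).1.
rewrite (_ : derive1 _ = fun x => c * (derive1 f) (c * x + b)).
  by apply: CkZ; exact: IH.
by apply/funext => x; exact: (is_derive1P (D x)).2.
Qed.

(** The function t^n exp (- t) at t = 1/x, extended by 0. Derivatives of these functions are linear
    combinations of them, so the smoothness of [flat 0] at 0 comes from one induction over the whole
    family. *)
Definition flat n x := if 0 < x then x^-1 ^+ n * expR (- x^-1) else 0 : R.

Lemma exprn_expR_le n (t : R) : 0 <= t -> t ^+ n * expR (- t) <= n`!%:R.
Proof.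
move=> t0; rewrite expRN ler_pdivrMr ?expR_gt0//; case: n => [|n].
  by rewrite expr0 fact0 mul1r; have := expR_ge1Dx t; lra.
rewrite mulrC -ler_pdivrMr ?ltr0n ?fact_gt0//.
by apply: le_trans (expR_ge1Dxn n t0); rewrite lerDr.
Qed.

Lemma flat_bound n x : `|flat n x| <= n`!%:R.
Proof.
rewrite /flat; case: ifPn => [x0|_]; last by rewrite normr0.
have t0 : 0 <= x^-1 by rewrite invr_ge0 ltW.
by rewrite ger0_norm ?exprn_expR_le// mulr_ge0 ?expR_ge0// exprn_ge0.
Qed.

Lemma is_derive_flat n x :
  is_derive x (1 : R) (flat n) (flat n.+2 x + - n%:R * flat n.+1 x).
Proof.
have [x0|x0|->] := ltgtP x 0.
- rewrite /flat ltNge (ltW x0)/= mulr0 addr0.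
  apply: (@near_eq_is_derive _ _ _ (fun=> 0)).
  by near=> y; rewrite ltNge ltW//=; near: y; exact: lt_nbhsl.
- rewrite /flat x0.
  apply: (@near_eq_is_derive _ _ _ (fun y => y^-1 ^+ n * expR (- y^-1))).
    by near=> y; rewrite ifT//; near: y; exact: lt_nbhsr.
  have I : is_derive x (1 : R) (fun y : R => y^-1) (- (x^-1 ^+ 2)).
    have := @is_deriveV R (fun y => y) x 1 1 (lt0r_neq0 x0) (is_derive_id _ _).
    by move=> H; apply: is_derive_eq H _; rewrite /GRing.scale/= mulr1 exprVn.
  have E : is_derive x (1 : R) (fun y : R => expR (- y^-1)) (x^-1 ^+ 2 * expR (- x^-1)).
    have I2 : is_derive x (1 : R) (fun y : R => - y^-1) (x^-1 ^+ 2).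
      by apply: is_derive_eq (is_deriveN I) _; rewrite opprK.
    have H := @is_derive1_comp _ expR (fun y : R => - y^-1) x _ _ (is_derive_expR _) I2.
    by apply: is_derive_eq H _; rewrite mulrC.
  have X : is_derive x (1 : R) (fun y : R => y^-1 ^+ n) (- n%:R * x^-1 ^+ n.+1).
    rewrite (_ : (fun y => y^-1 ^+ n) = (fun y : R => y^-1) ^+ n); last first.
      by apply/funext => y; rewrite exprfctE.
    apply: is_derive_eq (is_deriveX n I) _; rewrite /GRing.scale/=.
    by case: n => [|n]/=; rewrite ?mul0r ?oppr0 ?mul0r// !exprS; ring.
  have H := is_deriveM X E; apply: is_derive_eq H _.
  by rewrite /GRing.scale/= !exprS; ring.
- have Z m : flat m 0 = 0 by rewrite /flat ltxx.
  rewrite !Z mulr0 addr0.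
  (* The difference quotient at 0 is h * [flat n.+2 h], and [flat n.+2] is bounded. *)
  have L : (fun h : R => h^-1 *: (flat n (h *: 1 + 0) - flat n 0)) @ 0^' --> (0 : R).
    apply/cvgrPdist_le => /= e e0; near=> h.
    rewrite sub0r normrN Z subr0 addr0 /GRing.scale/= mulr1.
    have h0 : h != 0 by near: h; exact: nbhs_dnbhs_neq.
    have -> : h^-1 * flat n h = h * flat n.+2 h.
      rewrite /flat; case: ifP => _; last by rewrite !mulr0.
      by rewrite mulrA !exprS !mulrA mulfV// mul1r.
    rewrite normrM.
    have hh : `|h| <= e / (n.+2)`!%:R.
      near: h; apply: dnbhs0_le; rewrite divr_gt0// ltr0n fact_gt0//.
    apply: le_trans (ler_pM _ _ hh (flat_bound n.+2 h)) _ => //.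
    by rewrite divfK// pnatr_eq0 -lt0n fact_gt0.
  by apply: DeriveDef; [apply/cvg_ex; exists 0|exact: cvg_lim L].
Unshelve. all: by end_near. Qed.

Lemma Ck_flat n m : Ck n (flat m).
Proof.
elim: n m => [//|n IH m].
split; first by move=> x; exact: (is_derive1P (is_derive_flat m x)).1.
rewrite (_ : derive1 _ = fun x => flat m.+2 x + - m%:R * flat m.+1 x).
  by apply: CkD => //; exact: CkZ.
by apply/funext => x; exact: (is_derive1P (is_derive_flat m x)).2.
Qed.

(** The factor n + 1 steepens both edges: these test functions stay in [0, 1] and tend to the
    indicator function of ]a, b[. *)
Definition bump n a b x := flat 0 (n.+1%:R * (x - a)) * flat 0 (n.+1%:R * (b - x)).

Lemma Ck_bump m n a b : Ck m (bump n a b).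
Proof.
apply: CkM.
  rewrite (_ : (fun x => _) = fun x => flat 0 (n.+1%:R * x + - n.+1%:R * a)).
    by apply: Ck_affine; exact: Ck_flat.
  by apply/funext => x; congr flat; ring.
rewrite (_ : (fun x => _) = fun x => flat 0 (- n.+1%:R * x + n.+1%:R * b)).
  by apply: Ck_affine; exact: Ck_flat.
by apply/funext => x; congr flat; ring.
Qed.

Lemma flat0_01 x : 0 <= flat 0 x <= 1.
Proof.
rewrite /flat; case: ifPn => [x0|_]; last by rewrite lexx ler01.
by rewrite expr0 mul1r expR_ge0/= -expR0 ler_expR oppr_le0 invr_ge0 ltW.
Qed.

Lemma bump_01 n a b x : 0 <= bump n a b x <= 1.
Proof.
have /andP[h1 h2] := flat0_01 (n.+1%:R * (x - a)).
have /andP[h3 h4] := flat0_01 (n.+1%:R * (b - x)).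
by rewrite mulr_ge0//= mulr_ile1.
Qed.

Lemma bump_out n a b x : ~~ (a < x < b) -> bump n a b x = 0.
Proof.
rewrite negb_and -!leNgt /bump /flat => /orP[h|h].
  by rewrite pmulr_rgt0// subr_gt0 ltNge h/= mul0r.
by rewrite [X in _ * X]ifF ?mulr0// pmulr_rgt0// subr_gt0 ltNge h.
Qed.

Lemma bump_in n a b x : a < x < b ->
  bump n a b x = expR (- (n.+1%:R^-1 * ((x - a)^-1 + (b - x)^-1))).
Proof.
move=> /andP[ax xb]; rewrite /bump /flat !pmulr_rgt0// !subr_gt0 ax xb !expr0 !mul1r.
by rewrite -expRD !invfM; congr expR; ring.
Qed.

Lemma cvg_bump a b x : (fun n => bump n a b x) @ \oo --> (if a < x < b then 1 else 0 : R).
Proof.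
case: ifPn => [h|/bump_out h]; last first.
  by under eq_fun do rewrite h; exact: cvg_cst.
under eq_fun do rewrite bump_in//.
have i2 : (fun n : nat => (n.+1%:R : R)^-1) @ \oo --> (0 : R) by exact: cvg_harmonic.
have L : (fun n : nat => - ((n.+1%:R : R)^-1 * ((x - a)^-1 + (b - x)^-1))) @ \oo --> (0 : R).
  rewrite -oppr0 -(mul0r ((x - a)^-1 + (b - x)^-1)); apply: cvgN.
  by apply: (cvgM i2); exact: cvg_cst.
have := cvg_comp _ _ L (@continuous_expR R 0).
by rewrite expR0.
Qed.

Lemma test_functionP phi : test_function phi <->
  (forall n, Ck n phi) /\ exists2 M, 0 < M & forall x, M < `|x| -> phi x = 0.
Proof.
split=> [[sm]|[/CkP sm [M M0 hM]]].
- move=> /compact_bounded[N [Nr hN]]; split; first exact/CkP.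
  exists (`|N| + 1); first by rewrite ltr_wpDl.
  move=> x Mx; apply: contrapT => /eqP p0.
  have NN : N < `|N| + 1 by rewrite (le_lt_trans (ler_norm N))// ltrDl.
  have cx : closure [set x0 | phi x0 != 0] x by apply: subset_closure.
  have := hN _ NN x cx.
  by rewrite /= leNgt Mx.
- split=> //; apply: (@subclosed_compact _ _ `[- M, M]).
  + exact: closed_closure.
  + exact: segment_compact.
  + have /closure_id -> : closed (`[- M, M] : set R) by exact: interval_closed.
    apply: closure_subset => x /= p0; rewrite in_itv/= -ler_norml leNgt.
    by apply: contra p0 => /hM ->.
Qed.

Lemma test_bump n a b : test_function (bump n a b).
Proof.
apply/test_functionP; split; first by move=> m; exact: Ck_bump.
exists (`|a| + `|b| + 1); first by rewrite ltr_wpDl// addr_ge0.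
move=> x hx; apply: bump_out; apply/negP => /andP[ax xb].
have : `|x| <= `|a| + `|b| + 1.
  have := ler_norm b; have := ler_norm (- a); rewrite normrN.
  have := normr_ge0 a; have := normr_ge0 b.
  by rewrite ler_norml => *; apply/andP; split; lra.
by rewrite leNgt hx.
Qed.

Lemma test_cont phi : test_function phi -> continuous phi.
Proof.
move=> [sm _] x; have := sm 0%N x; rewrite derive1n0 => d.
by apply/differentiable_continuous/derivable1_diffP.
Qed.

Lemma test_deriv phi : test_function phi -> test_function (derive1 phi).
Proof.
move=> /test_functionP[sm [M M0 hM]]; apply/test_functionP; split.
  by move=> n; have [] := sm n.+1.
exists M => // x Mx.
have : is_derive x (1 : R) phi 0.
  apply: (@near_eq_is_derive _ _ _ (fun=> 0)).
  near=> y; rewrite hM//; near: y.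
  have : continuous (fun y : R => `|y|) by exact: norm_continuous.
  by move=> /(_ x)/cvgr_gt; apply.
by move=> /is_derive1P[].
Unshelve. all: by end_near. Qed.

Lemma test_AC phi : test_function phi -> AC phi (derive1 phi).
Proof.
move=> t; apply: AC_C1; last exact: test_cont (test_deriv t).
by move=> x; apply: derivable_is; have := t.1 0%N x; rewrite derive1n0.
Qed.

End test_functions.

(** * Absolutely continuous representatives of weakly differentiable functions *)

Section weak_derivatives.
Context {R : realType}.
Implicit Types (f g u v p q z phi psi : R -> R) (x y a b c M : R) (n m : nat).

Local Notation mu := (@lebesgue_measure R).
Local Notation meas f := (measurable_fun [set: R] f).
Local Notation int f := (Rintegral mu [set: R] f).

Lemma cut_supp M f phi : (forall x, M < `|x| -> phi x = 0) ->
  (fun x => f x * phi x) = cut (- M) M (fun x => f x * phi x).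
Proof.
move=> h; apply/funext => x; rewrite /cut -ler_norml.
by have [//|/h->] := leP; rewrite mulr0.
Qed.

Lemma test_integ f phi : locint f -> test_function phi -> integ (fun x => f x * phi x).
Proof.
move=> lf t; have [_ [M M0 hM]] := (test_functionP phi).1 t.
by rewrite (cut_supp f hM); apply: integ_cut; exact: locint_mul_cont lf (test_cont t).
Qed.

Lemma test_ibp p p1 phi : AC p p1 -> test_function phi ->
  int (fun x => p x * derive1 phi x) = - int (fun x => p1 x * phi x).
Proof.
move=> Ap t; have [_ [M M0 hM]] := (test_functionP phi).1 t.
have [_ [M' M'0 hM']] := (test_functionP _).1 (test_deriv t).
pose N := M + M' + 1.
have h1 x : N < `|x| -> phi x = 0 by move=> hx; apply: hM; rewrite /N in hx; lra.
have h2 x : N < `|x| -> derive1 phi x = 0 by move=> hx; apply: hM'; rewrite /N in hx; lra.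
apply/eqP; rewrite -addr_eq0 addrC -intD; last 2 first.
- exact: test_integ Ap.1 t.
- by apply: test_integ (test_deriv t); apply: cont_locint; exact: AC_cont Ap.
have N0 : - (N + 1) <= N + 1 by rewrite /N; lra.
have H := J_ibp Ap (test_AC t) N0.
have hn : N < `|N + 1| by rewrite ger0_norm /N; lra.
rewrite !h1 ?normrN// !mulr0 subrr in H.
rewrite -H J_cut; apply/eqP; apply: eq_Rintegral => x _.
rewrite /cut -ler_norml; have [//|hx] := leP; rewrite h1 ?h2 ?mulr0 ?addr0//; lra.
Qed.

(** Lebesgue differentiation of the primitive, which is constant. A base point - n only reaches x >
    - n, hence the countable intersection over n. *)
Lemma J_eq0_ae f : locint f -> (forall x y, x < y -> J x y f = 0) ->
  {ae mu, forall x, f x = 0}.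
Proof.
move=> lf J0.
have LI : locally_integrable [set: R] f.
  split; [exact: lf.1|exact: openT|].
  move=> K _ cK; have [N [Nr hN]] := compact_bounded cK.
  have /integrableP[_] := lf.2 (- (`|N| + 1)) (`|N| + 1).
  apply: le_lt_trans; apply: ge0_subset_integral => //.
  - exact: compact_measurable.
  - by apply/measurable_EFinP/measurable_funTS; apply: measurableT_comp => //; exact: lf.1.
  - move=> x Kx; rewrite /= in_itv/= -ler_norml.
    by apply: hN Kx; rewrite (le_lt_trans (ler_norm N))// ltrDl.
have H n : {ae mu, forall x, - n%:R < x -> f x = 0}.
  have := @FTC1 R f (BLeft (- n%:R)) (fun y => lf.2 _ _) LI.
  apply: filterS => x hx nx.
  have [|_ <-] := hx; first by rewrite lte_fin.
  rewrite (_ : (fun x => _) = fun=> 0); first by rewrite derive1_cst.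
  apply/funext => y; have [ny|] := ltP (- n%:R) y; first exact: J0.
  rewrite le_eqVlt => /predU1P[->|yn]; first by rewrite set_itv1 Rintegral_set1.
  by rewrite set_itv_ge ?Rintegral_set0// -leNgt bnd_simp.
have := ae_foralln H; apply: filterS => x hx.
apply: (hx (archimedean.Num.Def.archi_bound `|x|)).
rewrite ltrNl; apply: le_lt_trans (ler_norm _) _; rewrite normrN.
exact: archimedean.Num.Theory.archi_boundP.
Qed.

Lemma ae_neq a : {ae mu, forall x, x != a}.
Proof.
exists [set a]; split; [exact: measurable_set1|exact: lebesgue_measure_set1|].
by move=> x /= /negP; rewrite negbK => /eqP.
Qed.

(** By dominated convergence, testing with the bumps recovers the integral of f over each
    segment. *)
Lemma weak_eq0 f : locint f ->
  (forall phi, test_function phi -> int (fun x => f x * phi x) = 0) ->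
  {ae mu, forall x, f x = 0}.
Proof.
move=> lf h; apply: J_eq0_ae => // a b ab.
have icf := integ_cut a b lf.
have H : (fun n => int (fun x => f x * bump n a b x)) @ \oo --> J a b f.
  rewrite J_cut; apply: (@Rdct _ _ _ (fun x => `|cut a b f x|)).
  - by move=> n; apply: integ_meas; apply: test_integ => //; exact: test_bump.
  - exact: integ_meas.
  - move: (ae_neq a) (ae_neq b); apply: filterS2 => x xa xb.
    have E : cut a b f x = f x * (if a < x < b then 1 else 0).
      rewrite /cut !lt_neqAle xb (eq_sym a x) xa /=.
      by case: ifP => _; rewrite ?mulr1 ?mulr0.
    rewrite E; apply: cvgM; first exact: cvg_cst.
    exact: cvg_bump.
  - exact: integ_norm.
  - move=> n x; rewrite normrM /cut; have /andP[b0 b1] := bump_01 n a b x.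
    case: ifPn => [_|ab']; first by rewrite ler_piMr// ger0_norm.
    rewrite bump_out ?normr0 ?mulr0//; apply: contra ab' => /andP[xa xb].
    by rewrite (ltW xa) (ltW xb).
have E0 n : int (fun x => f x * bump n a b x) = 0 by apply: h; exact: test_bump.
move: H; under eq_fun do rewrite E0.
by move=> /(cvg_lim (@norm_hausdorff _ _)); rewrite lim_cst.
Qed.

Lemma AC_is_derive p p1 x : AC p p1 -> continuous p1 -> is_derive x (1 : R) p (p1 x).
Proof.
move=> Ap cp1.
have x1 : x < x + 1 by rewrite ltrDl.
have xm : x - 1 < x by rewrite gtrBl.
have [dF F'] := continuous_FTC1_closed x1 (Ap.1.2 (x - 1) (x + 1)) xm (cp1 x).
have D : is_derive x (1 : R) (fun y => p (x - 1) + J (x - 1) y p1) (p1 x).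
  have := derivable_is dF; rewrite F' => H.
  by apply: (is_derive_eq (is_deriveD (is_derive_cst _ _ _) H)); rewrite add0r.
apply: near_eq_is_derive D; near=> y.
have xy : x - 1 <= y by apply: ltW; near: y; exact: lt_nbhsr.
by rewrite -(Ap.2 _ _ xy); ring.
Unshelve. all: by end_near. Qed.

Lemma test_exists_int1 : exists2 rho : R -> R, test_function rho & int rho = 1.
Proof.
have tb := test_bump 0 (0 : R) 1.
have cb : continuous (bump 0 (0:R) 1) by exact: test_cont.
have ib : integ (bump 0 (0:R) 1).
  have := test_integ (cont_locint (@cst_continuous R R (1:R))) tb.
  by congr integ; apply/funext => x; rewrite mul1r.
have b0 x : 0 <= bump 0 (0:R) 1 x by have /andP[] := bump_01 0 (0:R) 1 x.
(* With zero integral the bump would vanish almost everywhere, but it is positive on ]0, 1[, a set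
   of measure 1. *)
have I0 : int (bump 0 (0:R) 1) != 0.
  apply/negP => /eqP /(int_eq0 ib b0) [N [mN N0 hN]].
  have : (lebesgue_measure (`]0%R, 1%R[ : set R) <= lebesgue_measure N)%E.
    apply: le_measure; rewrite ?inE//.
    move=> x; rewrite /= in_itv/= => x01; apply: hN => /=.
    by rewrite bump_in// => /eqP; rewrite gt_eqF// expR_gt0.
  have -> : lebesgue_measure (`]0, 1[ : set R) = 1%:E.
    by rewrite lebesgue_measure_itv/= lte_fin ltr01 oppr0 adde0.
  by rewrite N0 lee_fin ler10.
exists (fun x => (int (bump 0 (0:R) 1))^-1 * bump 0 (0:R) 1 x).
  have [sm [M M0 hM]] := (test_functionP _).1 tb.
  apply/test_functionP; split; first by move=> n; apply: CkZ.
  by exists M => // x /hM ->; rewrite mulr0.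
by rewrite intZ// mulVf.
Qed.

(** The primitive from the left of the support is constant to its right, with value the integral of
    phi; so zero integral gives compact support. *)
Lemma test_primitive phi : test_function phi -> int phi = 0 ->
  exists2 Phi, test_function Phi & derive1 Phi = phi.
Proof.
move=> t i0; have [sm [M M0 hM]] := (test_functionP _).1 t.
have cphi := test_cont t.
have lphi := cont_locint cphi.
have Aa := AC_anti lphi.
pose c := anti phi (- M).
have D x : is_derive x (1 : R) (fun x => anti phi x - c) (phi x).
  by apply: (is_derive_eq (is_deriveB (AC_is_derive x Aa cphi) (is_derive_cst _ _ _)));
    rewrite subr0.
have dE : derive1 (fun x => anti phi x - c) = phi.
  by apply/funext => x; have [] := is_derive1P (D x).
exists (fun x => anti phi x - c) => //; apply/test_functionP; split.
  case=> [//|n]; split; first by move=> x; have [] := is_derive1P (D x).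
  by rewrite dE.
have J0 x y : x <= y -> (forall t, x < t < y -> M < `|t|) -> anti phi y - anti phi x = 0.
  move=> xy h; rewrite Aa.2// J_cut.
  rewrite (@int_ae _ _ (fun=> 0)) //; first by rewrite /Rintegral integral0.
    by apply: integ_meas; exact: integ_cut.
  move: (ae_neq x) (ae_neq y); apply: filterS2 => r tx ty.
  rewrite /cut; case: ifPn => // /andP[xt ty']; apply: hM; apply: h.
  by rewrite !lt_neqAle (eq_sym x) tx ty xt ty'.
have MM : - M <= M by lra.
have eM : anti phi M = c.
  apply/eqP; rewrite -subr_eq0 /c Aa.2// J_cut -i0; apply/eqP.
  apply: eq_Rintegral => x _; rewrite /cut -ler_norml.
  by have [//|/hM->] := leP.
exists M => // x Mx; have [xM|xM] := leP x (- M).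
  rewrite /c -opprB J0 ?oppr0// => s /andP[_ sM].
  by rewrite lter_normr ltrNr sM orbT.
have {}xM : M < x.
  by move: Mx; rewrite ltr_normr => /orP[//|]; rewrite ltrNr ltNge (ltW xM).
by rewrite -eM J0 ?(ltW xM)// => s /andP[Ms _]; rewrite ltr_normr Ms.
Qed.

(** For a test function rho of integral 1, psi - (int psi) rho has integral zero, hence is the
    derivative of a test function. Testing z with it shows that z minus the constant int (z rho) is
    orthogonal to every psi. *)
Lemma du_bois_reymond z : locint z ->
  (forall phi, test_function phi -> int (fun x => z x * derive1 phi x) = 0) ->
  exists c, {ae mu, forall x, z x = c}.
Proof.
move=> lz h; have [rho trho irho] := test_exists_int1.
pose c := int (fun x => z x * rho x); exists c.
have lc : locint (fun _ : R => c) by apply: cont_locint => ?; exact: cvg_cst.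
have lzc : locint (fun x => z x - c).
  by apply: (locintD lz); apply: cont_locint => ?; exact: cvg_cst.
have l1 : locint (fun _ : R => 1) by apply: cont_locint => ?; exact: cvg_cst.
have ti psi : test_function psi -> integ psi.
  by move=> /(test_integ l1); congr integ; apply/funext => x; rewrite mul1r.
suff : {ae mu, forall x, z x - c = 0}.
  by apply: filterS => x /eqP; rewrite subr_eq0 => /eqP.
apply: weak_eq0 => // psi tpsi; pose m := int psi.
have tpr : test_function (fun x => psi x + - m * rho x).
  have [sm [M M0 hM]] := (test_functionP _).1 tpsi.
  have [sm' [M' M'0 hM']] := (test_functionP _).1 trho.
  apply/test_functionP; split; first by move=> n; apply: CkD => //; exact: CkZ.
  by exists (M + M') => [|x hx]; [lra|rewrite hM ?hM' ?mulr0 ?addr0//; lra].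
have i0 : int (fun x => psi x + - m * rho x) = 0.
  by rewrite intD ?intZ ?irho ?mulr1 ?subrr//; [exact: ti|exact: ti|apply: integZ; exact: ti].
have [Phi tPhi dPhi] := test_primitive tpr i0.
have := h _ tPhi; rewrite dPhi => e.
have : int (fun x => z x * psi x + - m * (z x * rho x)) = 0.
  by rewrite -[RHS]e; apply: eq_Rintegral => x _; ring.
rewrite intD ?intZ; [|exact: test_integ|exact: test_integ|apply: integZ; exact: test_integ].
move=> e2.
have -> : int (fun x => (z x - c) * psi x) = int (fun x => z x * psi x + - c * psi x).
  by apply: eq_Rintegral => x _; ring.
rewrite intD ?intZ; [|exact: ti|exact: test_integ|apply: integZ; exact: ti].
rewrite -/c in e2; rewrite -/m; lra.
Qed.

(** u minus a primitive of v has weak derivative zero, hence is constant almost everywhere. *)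
Lemma weak_AC u v : locint u -> locint v ->
  (forall phi, test_function phi ->
    int (fun x => u x * derive1 phi x) = - int (fun x => v x * phi x)) ->
  exists U, AC U v /\ {ae mu, forall x, u x = U x}.
Proof.
move=> lu lv h; have Av := AC_anti lv.
have lV : locint (anti v) by apply: cont_locint; exact: AC_cont Av.
have lz : locint (fun x => u x + -1 * anti v x) by apply: locintD => //; exact: locintZ.
have [phi tphi|c hc] := du_bois_reymond lz.
  have td := test_deriv tphi.
  have -> : int (fun x => (u x + -1 * anti v x) * derive1 phi x) =
      int (fun x => u x * derive1 phi x + -1 * (anti v x * derive1 phi x)).
    by apply: eq_Rintegral => x _; ring.
  rewrite intD ?intZ; [|exact: test_integ|exact: test_integ|apply: integZ; exact: test_integ].
  by rewrite h// (test_ibp Av tphi); ring.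
exists (fun x => anti v x + c); split.
  have Ac : AC (fun _ : R => c) (fun=> 0).
    by apply: AC_C1 => x; exact: cvg_cst.
  by apply: (AC_eq (AC_D Av Ac)) => x //; rewrite addr0.
by move: hc; apply: filterS => x <-; ring.
Qed.

(** The first relation tested with phi' and compared with the second shows that v1 has weak
    derivative v2. So [weak_AC] regularises v1 first, then u. *)
Lemma weak_nice u v1 v2 : L2 u -> L2 v1 -> L2 v2 ->
  (forall phi, test_function phi ->
    int (fun x => u x * derive1 phi x) = - int (fun x => v1 x * phi x)) ->
  (forall phi, test_function phi ->
    int (fun x => u x * derive1 (derive1 phi) x) = int (fun x => v2 x * phi x)) ->
  exists U U1, nice U U1 v2 /\ {ae mu, forall x, u x = U x}.
Proof.
move=> Lu Lv1 Lv2 h1 h2.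
have [U1 [AU1 e1]] : exists U, AC U v2 /\ {ae mu, forall x, v1 x = U x}.
  apply: weak_AC; [exact: L2_locint|exact: L2_locint|move=> phi t].
  by have := h1 _ (test_deriv t); rewrite h2// => ->; rewrite opprK.
have e1' : {ae mu, forall x, U1 x = v1 x} by move: e1; apply: filterS.
have mU1 := AC_meas AU1.
have LU1 : L2 U1 by exact: L2_ae Lv1 mU1 e1'.
have [U [AU e]] : exists U, AC U U1 /\ {ae mu, forall x, u x = U x}.
  apply: weak_AC; [exact: L2_locint|exact: L2_locint|move=> phi t].
  rewrite h1//; congr (- _); apply: int_ae.
  - by apply: integ_meas; apply: test_integ => //; exact: L2_locint.
  - by apply: integ_meas; apply: test_integ => //; exact: L2_locint.
  - by move: e1; apply: filterS => x ->.
have e' : {ae mu, forall x, U x = u x} by move: e; apply: filterS.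
exists U, U1; split=> //; split=> //.
exact: L2_ae Lu (AC_meas AU) e'.
Qed.

Lemma nice_weak U U1 U2 phi : nice U U1 U2 -> test_function phi ->
  int (fun x => U x * derive1 phi x) = - int (fun x => U1 x * phi x) /\
  int (fun x => U x * derive1 (derive1 phi) x) = int (fun x => U2 x * phi x).
Proof.
move=> [AU AU1 _ _ _] t; have td := test_deriv t.
by rewrite (test_ibp AU td) (test_ibp AU t) (test_ibp AU1 t) opprK.
Qed.

End weak_derivatives.

(** * Well-posedness for real functions *)

Section real_equation.
Context {R : realType}.
Implicit Types (f g u v p q phi : R -> R) (x y t a h : R).

Local Notation mu := (@lebesgue_measure R).
Local Notation meas f := (measurable_fun [set: R] f).
Local Notation int f := (Rintegral mu [set: R] f).

Lemma sincos_periodic (n : ssrint.int) x :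
  cos (x + 2 * pi * n%:~R) = cos x /\ sin (x + 2 * pi * n%:~R) = sin x.
Proof.
have H (m : nat) y : cos (y + 2 * pi * m%:R) = cos y /\ sin (y + 2 * pi * m%:R) = sin y.
  have -> : 2 * pi * m%:R = pi *+ 2 *+ m :> R by rewrite -[RHS]mulr_natr mulr_natl.
  by split; [exact: periodicn (@cosD2pi R) m y|exact: periodicn (@sinD2pi R) m y].
case: n => n; first exact: H.
have [hc hs] := H n.+1 (x + 2 * pi * (Negz n)%:~R).
have e : x + 2 * pi * (Negz n)%:~R + 2 * pi * n.+1%:R = x by rewrite NegzE mulrNz; ring.
by rewrite e in hc hs; split.
Qed.

(** The remainder r of t modulo 2 pi satisfies 1 = cos r = 1 - 2 sin^2 (r / 2), while sin (r / 2) >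
    0 if 0 < r < 2 pi. *)
Lemma cos_eq1 t : cos t = 1 -> exists n : ssrint.int, t = 2 * pi * n%:~R.
Proof.
move=> ct; have p0 : 0 < pi :> R by exact: pi_gt0.
have p2 : 0 < 2 * pi :> R by rewrite mulr_gt0.
pose n := archimedean.Num.Def.floor (t / (2 * pi)); exists n.
pose r := t - 2 * pi * n%:~R.
have cr : cos r = 1.
  by rewrite -[RHS]ct -[in RHS](subrK (2 * pi * n%:~R) t); have [-> _] := sincos_periodic n r.
have r0 : 0 <= r.
  by rewrite subr_ge0 mulrC -ler_pdivlMr// archimedean.Num.Theory.real_floor_le ?num_real.
have r2 : r < 2 * pi.
  rewrite ltrBlDr -[X in X + _]mulr1 -mulrDr mulrC -ltr_pdivrMr//.
  by have := archimedean.Num.Theory.real_floorD1_gt (num_real (t / (2 * pi))); rewrite intrD addrC.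
apply/eqP; rewrite -subr_eq0 -/r; apply/negP => /negP rn0.
have rp : 0 < r by rewrite lt_neqAle eq_sym rn0.
have s : 0 < sin (r / 2).
  by apply: sin_gt0_pi; apply/andP; split; [lra|rewrite ltr_pdivrMr//; lra].
have : cos r = 1 - 2 * sin (r / 2) ^+ 2.
  rewrite {1}(_ : r = r / 2 + r / 2); last by field.
  by rewrite cosD; have := cos2Dsin2 (r / 2); nra.
have s2 : 0 < sin (r / 2) ^+ 2 by rewrite exprn_gt0.
by rewrite cr => e; lra.
Qed.

Lemma nice_B u u1 u2 v v1 v2 : nice u u1 u2 -> nice v v1 v2 ->
  nice (fun x => u x - v x) (fun x => u1 x - v1 x) (fun x => u2 x - v2 x).
Proof.
move=> [Au Au1 Lu Lu1 Lu2] [Av Av1 Lv Lv1 Lv2].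
by split; [exact: AC_B|exact: AC_B|exact: L2B|exact: L2B|exact: L2B].
Qed.

Definition rsol a h phi u u1 u2 := nice u u1 u2 /\
  {ae mu, forall x, - u2 x - a * u (x - h) = phi x}.

(** The common form of the two cases: [adm] singles out the admissible data and [E] measures them
    quadratically. The bound is required of every solution, not only of a constructed one. *)
Definition well_posed a h (adm : (R -> R) -> Prop) (E : (R -> R) -> R) :=
  exists K : R, forall phi, adm phi ->
    (exists u u1 u2, rsol a h phi u u1 u2) /\
    (forall u u1 u2, rsol a h phi u u1 u2 -> nsq u + nsq u2 <= K * E phi).

(** The equation itself controls u2 by phi and u, so only u remains to be estimated in either
    case. *)
Lemma rsol_bound a h phi u u1 u2 : L2 phi -> rsol a h phi u u1 u2 ->
  nsq phi = nsq (fun x => - u2 x - a * sh h u x) /\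
  nsq u2 <= 2 * nsq phi + 2 * a ^+ 2 * nsq u.
Proof.
move=> Lp [[Au Au1 Lu Lu1 Lu2] hu]; have Lh := L2_shift h Lu.
have e : nsq phi = nsq (fun x => - u2 x - a * sh h u x).
  by apply: nsq_ae => //; [l2|move: hu; apply: filterS => x <-].
split=> //; rewrite -nsqN.
rewrite (_ : (fun x => - u2 x) = fun x => (- u2 x - a * sh h u x) + a * sh h u x); last first.
  by apply/funext => x; ring.
have LL : L2 (fun x => - u2 x - a * sh h u x) by l2.
apply: le_trans (nsqD_le LL (L2Z a Lh)) _.
by rewrite -e nsqZ// nsq_shift//; lra.
Qed.

Lemma well_posed_a a h : 0 < a -> cos (Num.sqrt a * h) != 1 ->
  well_posed a h L2 nsq.
Proof.
move=> a0 ch.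
set C := 2 * (4 * (a^-1 + h ^+ 2) / (cos (Num.sqrt a * h) - 1) ^+ 2 + a^-1) / a.
exists (2 + (1 + 2 * a ^+ 2) * C) => phi Lp; split.
  exact: exist_a a0 ch Lp.
move=> u u1 u2 hu; have [e n2] := rsol_bound Lp hu.
have := coercive_delay a0 ch hu.1; rewrite -e -/C => n1.
have : (1 + 2 * a ^+ 2) * nsq u <= (1 + 2 * a ^+ 2) * (C * nsq phi).
  by rewrite ler_wpM2l// addr_ge0// mulr_ge0 ?sqr_ge0.
by lra.
Qed.

(** With weight 1 + |x| instead of |x| it also controls phi near 0, as the primitives in
    [orth_source] require. *)
Definition moment phi := int (fun x => (1 + `|x|) * `|phi x|).

Definition resonant_data a phi := [/\ L2 phi, integ (fun x => (1 + `|x|) * phi x),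
  int (fun x => phi x * cos (Num.sqrt a * x)) = 0 &
  int (fun x => phi x * sin (Num.sqrt a * x)) = 0].

Lemma well_posed_b a h : 0 < a -> h != 0 ->
  sin (Num.sqrt a * h) = 0 -> cos (Num.sqrt a * h) = 1 ->
  well_posed a h (resonant_data a) (fun phi => nsq phi + moment phi ^+ 2).
Proof.
move=> a0 h0 sk ck.
pose C := 4 / a * int (fun x : R => (1 + x ^+ 2)^-1).
have C0 : 0 <= C.
  rewrite mulr_ge0 ?divr_ge0 ?(ltW a0)//; apply: int_ge0 => x.
  by rewrite invr_ge0 addr_ge0// sqr_ge0.
exists (2 + (1 + 2 * a ^+ 2) * C) => phi [Lp Ip Oc Os].
have [g [g1 [Ng ng]]] := orth_source a0 Lp Ip Oc Os.
rewrite -/(moment phi) -/C in ng.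
have gE : {ae mu, forall x, - phi x - a * g x = - phi x - a * g x} by exact: aeW.
split; first by have := exist_b a0 h0 sk ck Ng gE.
move=> u u1 u2 hu; have [_ n2] := rsol_bound Lp hu.
have n1 := estimate_b a0 h0 sk ck Ng gE hu.1 hu.2.
have : (1 + 2 * a ^+ 2) * nsq u <= (1 + 2 * a ^+ 2) * (C * moment phi ^+ 2).
  by rewrite ler_wpM2l ?(le_trans n1)// addr_ge0// mulr_ge0 ?sqr_ge0.
have : 0 <= (1 + 2 * a ^+ 2) * C * nsq phi.
  by rewrite mulr_ge0 ?nsq_ge0// mulr_ge0// addr_ge0// mulr_ge0 ?sqr_ge0.
have : 0 <= moment phi ^+ 2 by exact: sqr_ge0.
by lra.
Qed.

End real_equation.

(** * Complex functions *)

Section complex_functions.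
Context {R : realType}.
Implicit Types (f g u v : R -> R[i]) (phi : R -> R) (x y t a h : R).

Local Notation mu := (@lebesgue_measure R).
Local Notation meas f := (measurable_fun [set: R] f).
Local Notation int f := (Rintegral mu [set: R] f).

Definition rePart f : R -> R := fun x => complex.Re (f x).
Definition imPart f : R -> R := fun x => complex.Im (f x).
Local Notation normc := ComplexField.Normc.normc.

Lemma normc_sq (z : R[i]) : normc z ^+ 2 = complex.Re z ^+ 2 + complex.Im z ^+ 2.
Proof. by case: z => a b /=; rewrite sqr_sqrtr// addr_ge0 ?sqr_ge0. Qed.

Lemma normc_re (z : R[i]) : `|complex.Re z| <= normc z.
Proof.
case: z => a b /=; rewrite -sqrtr_sqr ler_wsqrtr// lerDl sqr_ge0//.
Qed.

Lemma normc_im (z : R[i]) : `|complex.Im z| <= normc z.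
Proof.
case: z => a b /=; rewrite -sqrtr_sqr ler_wsqrtr// lerDr sqr_ge0//.
Qed.

Lemma normc_nonneg (z : R[i]) : 0 <= normc z.
Proof. by case: z => a b /=; exact: sqrtr_ge0. Qed.

Lemma cmeas_normc f : cmeasurable f -> meas (fun x => normc (f x)).
Proof.
move=> [mr mi].
rewrite (_ : (fun x => _) = Num.sqrt \o (fun x => complex.Re (f x) ^+ 2 + complex.Im (f x) ^+ 2)).
  apply: measurableT_comp; first exact: continuous_measurable_fun (@sqrt_continuous R).
  by apply: measurable_funD; exact: measurable_funX.
by apply/funext => x /=; case: (f x).
Qed.

Lemma Lpnorm2_sq f : ((Lpnorm 2 f) `^ 2 =
  \int[mu]_x (complex.Re (f x) ^+ 2 + complex.Im (f x) ^+ 2)%:E)%E.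
Proof.
rewrite /Lpnorm poweR_Lnorm ?pnatr_eq0//; apply: eq_integral => x _.
rewrite /= ger0_norm ?normc_nonneg// powR_mulrn ?normc_nonneg//.
by rewrite normc_sq.
Qed.

Lemma Lp2P f : Lp 2 f <-> L2 (rePart f) /\ L2 (imPart f).
Proof.
split=> [[[mr mi] fin]|[Lr Li]].
- have I : integ (fun x => rePart f x ^+ 2 + imPart f x ^+ 2).
    apply/integrableP; split.
      by apply/measurable_EFinP; apply: measurable_funD; exact: measurable_funX.
    have : ((Lpnorm 2 f) `^ 2 < +oo)%E by rewrite poweR_lty.
    rewrite Lpnorm2_sq; congr (_ < _)%E; apply: eq_integral => x _ /=.
    by rewrite ger0_norm// addr_ge0 ?sqr_ge0.
  split; split=> //; apply: le_integ I; try exact: measurable_funX;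
    by move=> x; rewrite ger0_norm ?sqr_ge0// ?lerDl ?lerDr sqr_ge0.
- have cm : cmeasurable f by split; [exact: Lr.1|exact: Li.1].
  split=> //; have I := integD Lr.2 Li.2.
  rewrite /Lpnorm unlock; apply: poweR_lty.
  have /integrableP[_] := I; apply: le_lt_trans.
  rewrite le_eqVlt; apply/orP; left; apply/eqP; apply: eq_integral => x _ /=.
  rewrite ger0_norm ?normc_nonneg// powR_mulrn ?normc_nonneg// normc_sq.
  by rewrite ger0_norm// addr_ge0 ?sqr_ge0.
Qed.

Lemma Lpnorm2E f : Lp 2 f ->
  ((Lpnorm 2 f) `^ 2 = (nsq (rePart f) + nsq (imPart f))%:E)%E.
Proof.
move=> /Lp2P[Lr Li]; rewrite Lpnorm2_sq !nsqE -intD; [|exact: Lr.2|exact: Li.2].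
by rewrite int_EFin//; exact: integD Lr.2 Li.2.
Qed.

Lemma Lpnorm1E f : cmeasurable f ->
  Lpnorm 1 f = (\int[mu]_x (normc (f x))%:E)%E.
Proof.
move=> cm; rewrite /Lpnorm Lnorm1; apply: eq_integral => x _ /=.
by rewrite ger0_norm// normc_nonneg.
Qed.

Lemma Lp1_integ f : Lp 1 f ->
  [/\ integ (fun x => normc (f x)), integ (rePart f) & integ (imPart f)].
Proof.
move=> [cm]; rewrite Lpnorm1E// => fin.
have I : integ (fun x => normc (f x)).
  apply/integrableP; split; first by apply/measurable_EFinP; exact: cmeas_normc.
  by under eq_integral do rewrite gee0_abs ?lee_fin ?normc_nonneg//.
split=> //.
- by apply: le_integ I => [|x]; [exact: cm.1|exact: normc_re].
- by apply: le_integ I => [|x]; [exact: cm.2|exact: normc_im].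
Qed.

Lemma complex_eqE (z w : R[i]) : z = w <->
  complex.Re z = complex.Re w /\ complex.Im z = complex.Im w.
Proof. by split=> [->//|]; case: z w => [a b] [c d] /= [-> ->]. Qed.

Lemma weak_derivativeP k u v : weak_derivative k u v <->
  forall phi, test_function phi ->
    int (fun x => rePart u x * derive1n k phi x) =
      (-1) ^+ k * int (fun x => rePart v x * phi x) /\
    int (fun x => imPart u x * derive1n k phi x) =
      (-1) ^+ k * int (fun x => imPart v x * phi x).
Proof.
have E w (r : R -> R) : cintegral (fun x => w x * (r x)%:C) =
    int (fun x => rePart w x * r x) +i* int (fun x => imPart w x * r x).
  rewrite /cintegral; congr (_ +i* _); apply: eq_Rintegral => x _;
    rewrite /rePart /imPart; case: (w x) => a b /=; by ring.
have S (p q : R) : (-1) ^+ k * (p +i* q) = ((-1) ^+ k * p) +i* ((-1) ^+ k * q) :> R[i].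
  rewrite -signr_odd -[in RHS]signr_odd; case: (odd k); rewrite ?expr1 ?expr0 ?mul1r//.
  by rewrite !mulN1r.
by split=> H phi t; have := H phi t; rewrite !E S; [case|move=> [-> ->]].
Qed.

End complex_functions.

(** * Complex solutions and their real and imaginary parts *)

Section solutions.
Context {R : realType}.
Implicit Types (f g u v : R -> R[i]) (phi : R -> R) (x y t a h : R).

Local Notation mu := (@lebesgue_measure R).
Local Notation meas f := (measurable_fun [set: R] f).
Local Notation int f := (Rintegral mu [set: R] f).

Lemma weak_eq (v w : R -> R) : L2 v -> L2 w ->
  (forall phi, test_function phi -> int (fun x => v x * phi x) = int (fun x => w x * phi x)) ->
  {ae mu, forall x, v x = w x}.
Proof.
move=> Lv Lw h.
suff : {ae mu, forall x, v x - w x = 0}.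
  by apply: filterS => x /eqP; rewrite subr_eq0 => /eqP.
apply: weak_eq0 => [|phi t]; first by apply: L2_locint; exact: L2B.
have iv := test_integ (L2_locint Lv) t; have iw := test_integ (L2_locint Lw) t.
rewrite -[RHS](subrr (int (fun x => w x * phi x))) -{1}(h _ t) -intB//.
by apply: eq_Rintegral => x _; rewrite mulrBl.
Qed.

Lemma weak_derivative2_unique u v w : Lp 2 v -> Lp 2 w ->
  weak_derivative 2 u v -> weak_derivative 2 u w -> {ae mu, forall x, v x = w x}.
Proof.
move=> /Lp2P[Lv Lv'] /Lp2P[Lw Lw'] /weak_derivativeP hv /weak_derivativeP hw.
have er : {ae mu, forall x, rePart v x = rePart w x}.
  apply: weak_eq => // phi t; have [e _] := hv _ t; have [e' _] := hw _ t.
  by move: e; rewrite e' sqrrN expr1n !mul1r.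
have ei : {ae mu, forall x, imPart v x = imPart w x}.
  apply: weak_eq => // phi t; have [_ e] := hv _ t; have [_ e'] := hw _ t.
  by move: e; rewrite e' sqrrN expr1n !mul1r.
by move: er ei; apply: filterS2 => x er ei; exact/complex_eqE.
Qed.

Lemma H2_wderiv2 u : H2 u -> Lp 2 (wderiv2 u) /\ weak_derivative 2 u (wderiv2 u).
Proof.
by move=> [_ _ h2]; apply: (@xgetPex _ (fun=> 0) [set v | Lp 2 v /\ weak_derivative 2 u v]).
Qed.

Lemma wderiv2E u v : Lp 2 v -> weak_derivative 2 u v ->
  Lp 2 (wderiv2 u) /\ {ae mu, forall x, wderiv2 u x = v x}.
Proof.
move=> Lv hv; have [Lw hw] : Lp 2 (wderiv2 u) /\ weak_derivative 2 u (wderiv2 u).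
  apply: (@xgetPex _ (fun=> 0) [set v | Lp 2 v /\ weak_derivative 2 u v]).
  by exists v.
by split=> //; exact: weak_derivative2_unique hw hv.
Qed.

(** Only u is replaced by a representative. The second derivative stays the given [wderiv2 u], the
    function that enters [H2norm]. *)
Lemma solution_real a h f u : solution a h f u ->
  (exists U U1, rsol a h (rePart f) U U1 (rePart (wderiv2 u)) /\
    {ae mu, forall x, rePart u x = U x}) /\
  (exists V V1, rsol a h (imPart f) V V1 (imPart (wderiv2 u)) /\
    {ae mu, forall x, imPart u x = V x}).
Proof.
move=> [Hu hu]; have [/Lp2P[Lw Lw'] /weak_derivativeP hw] := H2_wderiv2 Hu.
have [/Lp2P[Lu Lu'] [v [/Lp2P[Lv Lv'] /weak_derivativeP hv]] _] := Hu.
have [U [U1 [NU eU]]] : exists U U1, nice U U1 (rePart (wderiv2 u)) /\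
    {ae mu, forall x, rePart u x = U x}.
  apply: weak_nice Lu Lv Lw _ _ => phi t.
    by have [-> _] := hv _ t; rewrite expr1 mulN1r.
  by have [e _] := hw _ t; move: e; rewrite sqrrN expr1n mul1r.
have [V [V1 [NV eV]]] : exists U U1, nice U U1 (imPart (wderiv2 u)) /\
    {ae mu, forall x, imPart u x = U x}.
  apply: weak_nice Lu' Lv' Lw' _ _ => phi t.
    by have [_ ->] := hv _ t; rewrite expr1 mulN1r.
  by have [_ e] := hw _ t; move: e; rewrite sqrrN expr1n mul1r.
split.
- exists U, U1; split=> //; split=> //.
  move: hu (ae_shift h eU); apply: filterS2 => x hx <-.
  rewrite /rePart -hx; case: (wderiv2 u x) (u (x - h)) => [p q] [r s] /=; ring.
- exists V, V1; split=> //; split=> //.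
  move: hu (ae_shift h eV); apply: filterS2 => x hx <-.
  rewrite /imPart -hx; case: (wderiv2 u x) (u (x - h)) => [p q] [r s] /=; ring.
Qed.

Lemma solution_build a h f (U U1 U2 V V1 V2 : R -> R) :
  rsol a h (rePart f) U U1 U2 -> rsol a h (imPart f) V V1 V2 ->
  solution a h f (fun x => U x +i* V x).
Proof.
move=> [NU hU] [NV hV]; set u := fun x => U x +i* V x.
have [AU AU1 LU LU1 LU2] := NU; have [AV AV1 LV LV1 LV2] := NV.
have Lu : Lp 2 u by apply/Lp2P.
have L1 : Lp 2 (fun x => U1 x +i* V1 x) by apply/Lp2P.
have L2' : Lp 2 (fun x => U2 x +i* V2 x) by apply/Lp2P.
have w1 : weak_derivative 1 u (fun x => U1 x +i* V1 x).
  apply/weak_derivativeP => phi t; have [e1 _] := nice_weak NU t.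
  by have [e2 _] := nice_weak NV t; rewrite expr1 !mulN1r.
have w2 : weak_derivative 2 u (fun x => U2 x +i* V2 x).
  apply/weak_derivativeP => phi t; have [_ e1] := nice_weak NU t.
  by have [_ e2] := nice_weak NV t; rewrite sqrrN expr1n !mul1r.
split; first by split=> //; [exists (fun x => U1 x +i* V1 x)|exists (fun x => U2 x +i* V2 x)].
have [_ e] := wderiv2E L2' w2.
have e2 : {ae mu, forall x, - (U2 x +i* V2 x) - a%:C * u (x - h) = f x}.
  move: hU hV; apply: filterS2 => x hU hV; apply/complex_eqE; rewrite /= -/(rePart f x) -/(imPart f x).
  by rewrite -hU -hV; split; ring.
by move: e e2; apply: filterS2 => x -> .
Qed.

Lemma ReB (z w : R[i]) : complex.Re (z - w) = complex.Re z - complex.Re w.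
Proof. by case: z w => [? ?] [? ?]. Qed.

Lemma ImB (z w : R[i]) : complex.Im (z - w) = complex.Im z - complex.Im w.
Proof. by case: z w => [? ?] [? ?]. Qed.

(** The real estimate is applied to both parts of the difference, whose data are f - g. Since
    [wderiv2] is chosen, that of u - v equals the difference of those of u and v only almost
    everywhere, by uniqueness of weak derivatives. *)
Lemma H2norm_diff a h adm E K f g u v :
  (forall phi, adm phi -> forall U U1 U2 : R -> R, rsol a h phi U U1 U2 ->
    nsq U + nsq U2 <= K * E phi) ->
  adm (rePart (f \- g)) -> adm (imPart (f \- g)) ->
  solution a h f u -> solution a h g v ->
  Lp 2 (u \- v) /\ exists N, [/\ H2norm (u \- v) = (Num.sqrt N)%:E,
    nsq (rePart (u \- v)) + nsq (imPart (u \- v)) <= N, 0 <= N &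
    N <= K * (E (rePart (f \- g)) + E (imPart (f \- g)))].
Proof.
move=> bound ar ai Su Sv.
have [[U [U1 [[NU hU] eU]]] [V [V1 [[NV hV] eV]]]] := solution_real Su.
have [[X [X1 [[NX hX] eX]]] [Y [Y1 [[NY hY] eY]]]] := solution_real Sv.
have NR := nice_B NU NX; have NI := nice_B NV NY.
have RR : rsol a h (rePart (f \- g)) (fun x => U x - X x) (fun x => U1 x - X1 x)
    (fun x => rePart (wderiv2 u) x - rePart (wderiv2 v) x).
  split=> //; move: hU hX; apply: filterS2 => x hU hX.
  have -> : rePart (f \- g) x = rePart f x - rePart g x by exact: ReB.
  by rewrite -hU -hX; ring.
have RI : rsol a h (imPart (f \- g)) (fun x => V x - Y x) (fun x => V1 x - Y1 x)
    (fun x => imPart (wderiv2 u) x - imPart (wderiv2 v) x).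
  split=> //; move: hV hY; apply: filterS2 => x hV hY.
  have -> : imPart (f \- g) x = imPart f x - imPart g x by exact: ImB.
  by rewrite -hV -hY; ring.
have bR := bound _ ar _ _ _ RR; have bI := bound _ ai _ _ _ RI.
have [/Lp2P[Lu Lu'] _ _] := Su.1; have [/Lp2P[Lv Lv'] _ _] := Sv.1.
have [LLu WDu] := H2_wderiv2 Su.1; have [LLv WDv] := H2_wderiv2 Sv.1.
have reB (p q : R -> R[i]) x : rePart (p \- q) x = rePart p x - rePart q x.
  exact: ReB.
have imB (p q : R -> R[i]) x : imPart (p \- q) x = imPart p x - imPart q x.
  exact: ImB.
have LB (p q : R -> R[i]) : Lp 2 p -> Lp 2 q -> Lp 2 (p \- q).
  move=> /Lp2P[p1 p2] /Lp2P[q1 q2]; apply/Lp2P; split.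
    by apply: L2_eq (L2B p1 q1) _ => x; rewrite reB.
  by apply: L2_eq (L2B p2 q2) _ => x; rewrite imB.
have Luv : Lp 2 (u \- v) by apply: LB; [case: Su.1|case: Sv.1].
have Lw := LB _ _ LLu LLv.
have Lpu := (Lp2P _).1 LLu; have Lpv := (Lp2P _).1 LLv.
have wd : weak_derivative 2 (u \- v) (wderiv2 u \- wderiv2 v).
  apply/weak_derivativeP => phi t.
  have td := test_deriv (test_deriv t).
  have dif (p q w z : R -> R) : L2 p -> L2 q -> L2 w -> L2 z ->
      int (fun x => p x * derive1n 2 phi x) = (-1) ^+ 2 * int (fun x => w x * phi x) ->
      int (fun x => q x * derive1n 2 phi x) = (-1) ^+ 2 * int (fun x => z x * phi x) ->
      int (fun x => (p x - q x) * derive1n 2 phi x) =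
      (-1) ^+ 2 * int (fun x => (w x - z x) * phi x).
    move=> Lp Lq Lw' Lz; rewrite sqrrN expr1n !mul1r => e e'.
    have -> : int (fun x => (w x - z x) * phi x) =
        int (fun x => w x * phi x - z x * phi x).
      by apply: eq_Rintegral => x _; rewrite mulrBl.
    rewrite intB; [|exact: test_integ (L2_locint Lw') t|exact: test_integ (L2_locint Lz) t].
    rewrite -e -e' -intB; [|exact: test_integ (L2_locint Lp) td|exact: test_integ (L2_locint Lq) td].
    by apply: eq_Rintegral => x _; rewrite mulrBl.
  have [hu hu'] := (weak_derivativeP _ _ _).1 WDu _ t.
  have [hv hv'] := (weak_derivativeP _ _ _).1 WDv _ t.
  rewrite !(funext (reB _ _)) !(funext (imB _ _)); split.
  - exact: (dif _ _ _ _ Lu Lv Lpu.1 Lpv.1 hu hv).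
  - exact: (dif _ _ _ _ Lu' Lv' Lpu.2 Lpv.2 hu' hv').
have [LW eW] := wderiv2E Lw wd.
split=> //.
have [Lr Li] := (Lp2P _).1 Luv; have [LWr LWi] := (Lp2P _).1 LW.
have [AUX _ LUX _ LWX] := NR; have [AVY _ LVY _ LWY] := NI.
have er : nsq (rePart (u \- v)) = nsq (fun x => U x - X x).
  by apply: (nsq_ae Lr LUX); move: eU eX; apply: filterS2 => x e1 e2; rewrite reB e1 e2.
have ei : nsq (imPart (u \- v)) = nsq (fun x => V x - Y x).
  by apply: (nsq_ae Li LVY); move: eV eY; apply: filterS2 => x e1 e2; rewrite imB e1 e2.
have wr : nsq (rePart (wderiv2 (u \- v))) =
    nsq (fun x => rePart (wderiv2 u) x - rePart (wderiv2 v) x).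
  by apply: (nsq_ae LWr LWX); move: eW; apply: filterS => r e; rewrite -reB /rePart e.
have wi : nsq (imPart (wderiv2 (u \- v))) =
    nsq (fun x => imPart (wderiv2 u) x - imPart (wderiv2 v) x).
  by apply: (nsq_ae LWi LWY); move: eW; apply: filterS => x e; rewrite -imB /imPart e.
exists (nsq (rePart (u \- v)) + nsq (imPart (u \- v)) +
  (nsq (rePart (wderiv2 (u \- v))) + nsq (imPart (wderiv2 (u \- v))))).
have n1 := nsq_ge0 (rePart (u \- v)); have n2 := nsq_ge0 (imPart (u \- v)).
have n3 := nsq_ge0 (rePart (wderiv2 (u \- v))).
have n4 := nsq_ge0 (imPart (wderiv2 (u \- v))).
split.
- rewrite /H2norm (Lpnorm2E Luv) (Lpnorm2E LW) -EFinD poweR_EFin powR12_sqrt//.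
  by rewrite !addr_ge0.
- by rewrite lerDl addr_ge0.
- by rewrite !addr_ge0.
- rewrite er ei wr wi mulrDr; move: bR bI.
  move: (nsq _) (nsq _) (nsq _) (nsq _) (K * _) (K * _) => ? ? ? ? ? ?; lra.
Qed.

End solutions.

(** * Convergence of solutions *)

Section sequences.
Context {R : realType}.
Implicit Types (f g u v : R -> R[i]) (phi : R -> R) (x y t a h : R).

Local Notation mu := (@lebesgue_measure R).
Local Notation meas f := (measurable_fun [set: R] f).
Local Notation int f := (Rintegral mu [set: R] f).
Local Notation normc := ComplexField.Normc.normc.

Lemma sqrt_cvg0 (s : nat -> R) : (forall n, 0 <= s n) ->
  (fun n => Num.sqrt (s n)) @ \oo --> (0 : R) <-> s @ \oo --> (0 : R).
Proof.
move=> s0; split=> h.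
- rewrite (_ : s = fun n => Num.sqrt (s n) * Num.sqrt (s n)); last first.
    by apply/funext => n; rewrite -expr2 sqr_sqrtr.
  by rewrite -(mulr0 (0 : R)); apply: cvgM.
- rewrite -sqrtr0; apply: continuous_cvg => //; exact: sqrt_continuous.
Qed.

Lemma le_cvg0 (s t : nat -> R) : (forall n, 0 <= s n <= t n) ->
  t @ \oo --> (0 : R) -> s @ \oo --> (0 : R).
Proof.
move=> st t0; apply: (@squeeze_cvgr _ _ _ _ (fun=> 0) t) => //.
  by apply: nearW => n.
exact: cvg_cst.
Qed.

(** Existence is assembled from the two parts. Uniqueness is the estimate for the data g - g = 0,
    which is why 0 must be admissible with E = 0; convergence is the estimate for f_m - f. *)
Lemma solvable_of_well_posed a h (adm : (R -> R) -> Prop) (E : (R -> R) -> R)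
    (f_ : nat -> R -> R[i]) f :
  well_posed a h adm E -> adm (fun=> 0) -> E (fun=> 0) = 0 ->
  (forall m, adm (rePart (f_ m)) /\ adm (imPart (f_ m))) ->
  adm (rePart f) /\ adm (imPart f) ->
  (forall m, adm (rePart (f_ m \- f)) /\ adm (imPart (f_ m \- f))) ->
  (fun m => E (rePart (f_ m \- f)) + E (imPart (f_ m \- f))) @ \oo --> (0 : R) ->
  solvable_in_sequences a h f_ f.
Proof.
move=> [K wp] adm0 E0 am af ad cvgE.
have bound phi : adm phi -> forall U U1 U2 : R -> R, rsol a h phi U U1 U2 ->
    nsq U + nsq U2 <= K * E phi by move=> /wp[].
have uniq g : adm (rePart g) /\ adm (imPart g) -> uniquely_solvable a h g.
  move=> [/wp[[U [U1 [U2 hU]]] _] /wp[[V [V1 [V2 hV]]] _]].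
  exists (fun x => U x +i* V x); split; first exact: solution_build hU hV.
  move=> v Sv; have Su := solution_build hU hV.
  have r0 : rePart (g \- g) = fun=> 0 by apply/funext => x; rewrite /rePart /= subrr.
  have i0 : imPart (g \- g) = fun=> 0 by apply/funext => x; rewrite /imPart /= subrr.
  have [||Luv [N [_ nN _ N0]]] := H2norm_diff bound _ _ Sv Su; rewrite ?r0 ?i0//.
  rewrite r0 i0 E0 addr0 mulr0 in N0.
  have [Lr Li] := (Lp2P _).1 Luv.
  have n1 := nsq_ge0 (rePart (v \- (fun x => U x +i* V x))).
  have n2 := nsq_ge0 (imPart (v \- (fun x => U x +i* V x))).
  have /(nsq_eq0 Lr) er : nsq (rePart (v \- (fun x => U x +i* V x))) <= 0.
    by apply: le_trans N0; apply: le_trans nN; rewrite lerDl.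
  have /(nsq_eq0 Li) ei : nsq (imPart (v \- (fun x => U x +i* V x))) <= 0.
    by apply: le_trans N0; apply: le_trans nN; rewrite lerDr.
  move: er ei; apply: filterS2 => x er ei.
  by apply/eqP; rewrite -subr_eq0; apply/eqP/complex_eqE.
split; [by move=> m; exact: uniq|exact: uniq|].
move=> u_ u Su_ Su.
have H m := H2norm_diff bound (ad m).1 (ad m).2 (Su_ m) Su.
have /choice[N hN] m : exists N, [/\ H2norm (u_ m \- u) = (Num.sqrt N)%:E, 0 <= N &
    N <= K * (E (rePart (f_ m \- f)) + E (imPart (f_ m \- f)))].
  by have [_ [N [h1 _ h2 h3]]] := H m; exists N.
rewrite /cvg_H2 (_ : (fun m => _) = fun m => (Num.sqrt (N m))%:E); last first.
  by apply/funext => m; have [] := hN m.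
apply: cvg_EFin; first exact: nearW.
apply/sqrt_cvg0; first by move=> m; have [] := hN m.
apply: le_cvg0 (_ : (fun m => K * (E (rePart (f_ m \- f)) + E (imPart (f_ m \- f)))) @ \oo --> (0 : R)).
  by move=> m; have [_ -> ->] := hN m.
by rewrite -(mulr0 K); apply: cvgM => //; exact: cvg_cst.
Qed.

Lemma Lpnorm2_sqrt f : Lp 2 f ->
  Lpnorm 2 f = (Num.sqrt (nsq (rePart f) + nsq (imPart f)))%:E.
Proof.
move=> Lf; have n0 : 0 <= nsq (rePart f) + nsq (imPart f) by rewrite addr_ge0 ?nsq_ge0.
rewrite -powR12_sqrt// -poweR_EFin -Lpnorm2E// -poweRrM mulfV ?pnatr_eq0//.
by rewrite poweRe1// /Lpnorm Lnorm_ge0.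
Qed.

Lemma Lp2_sub f g : Lp 2 f -> Lp 2 g -> Lp 2 (f \- g).
Proof.
move=> /Lp2P[f1 f2] /Lp2P[g1 g2]; apply/Lp2P; split.
  by apply: L2_eq (L2B f1 g1) _ => x; rewrite /rePart ReB.
by apply: L2_eq (L2B f2 g2) _ => x; rewrite /imPart ImB.
Qed.

Lemma cvg_Lp2 (f_ : nat -> R -> R[i]) f : (forall m, Lp 2 (f_ m)) -> cvg_Lp 2 f_ f ->
  (fun m => nsq (rePart (f_ m \- f)) + nsq (imPart (f_ m \- f))) @ \oo --> (0 : R).
Proof.
move=> Lf_ [Lf cv]; apply/sqrt_cvg0.
  by move=> m; rewrite addr_ge0 ?nsq_ge0.
move: cv; rewrite (_ : (fun m => _) = fun m =>
  (Num.sqrt (nsq (rePart (f_ m \- f)) + nsq (imPart (f_ m \- f))))%:E).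
  by move=> /fine_cvg.
by apply/funext => m; rewrite Lpnorm2_sqrt//; exact: Lp2_sub.
Qed.

Lemma Lp2_parts (f_ : nat -> R -> R[i]) f : (forall m, Lp 2 (f_ m)) -> Lp 2 f ->
  [/\ forall m, L2 (rePart (f_ m)) /\ L2 (imPart (f_ m)),
      L2 (rePart f) /\ L2 (imPart f) &
      forall m, L2 (rePart (f_ m \- f)) /\ L2 (imPart (f_ m \- f))].
Proof.
move=> Lf_ Lf; split=> [m||m]; apply/Lp2P => //; exact: Lp2_sub.
Qed.

(** (1 + |x|) |phi| is at most 2 |x phi|, plus |phi| on [-1, 1]; Cauchy-Schwarz on this segment of
    length 2 bounds the latter by the L^2 norm. *)
Lemma L2_moment phi : L2 phi -> integ (fun x => x * phi x) ->
  integ (fun x => (1 + `|x|) * phi x) /\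
  moment phi ^+ 2 <= 4 * nsq phi + 8 * int (fun x => `|x * phi x|) ^+ 2.
Proof.
move=> Lp Ix.
have La : L2 (fun x => `|phi x|).
  apply: (@le_L2 _ _ phi) => //; first exact: (measurableT_comp (@normr_measurable R setT) (L2_meas Lp)).
  by move=> x; rewrite normr_id.
have Ic : integ (cut (-1) 1 (fun x => `|phi x|)) by apply: integ_cut; exact: L2_locint.
have In := integ_norm Ix.
have mp : meas (fun x => (1 + `|x|) * phi x).
  apply: measurable_funM; last exact: Lp.1.
  by apply: measurable_funD => //; exact: measurableT_comp.
have b x : (1 + `|x|) * `|phi x| <= cut (-1) 1 (fun x => `|phi x|) x + 2 * `|x * phi x|.
  have p0 := normr_ge0 (phi x); have x0 := normr_ge0 x.
  rewrite /cut -ler_norml normrM; case: (leP `|x| 1) => hx; nra.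
have I2 := integD Ic (integZ 2 In).
have Im : integ (fun x => (1 + `|x|) * phi x).
  by apply: le_integ I2 => // x; rewrite normrM [`|1 + _|]ger0_norm ?addr_ge0.
split=> //.
have Im' : integ (fun x => (1 + `|x|) * `|phi x|).
  have := integ_norm Im; congr integ; apply/funext => x.
  by rewrite normrM [`|1 + _|]ger0_norm ?addr_ge0.
have m0 : 0 <= moment phi by apply: int_ge0 => x; rewrite mulr_ge0// addr_ge0.
set A := int (cut (-1) 1 (fun x => `|phi x|)); set B := int (fun x => `|x * phi x|).
have mAB : moment phi <= A + 2 * B.
  by rewrite /A /B -intZ// -intD//; [exact: le_int|exact: integZ].
have Lc : L2 (cut (-1) 1 (fun _ : R => 1)).
  have lc : locint (fun _ : R => 1) by apply: cont_locint => ?; exact: cvg_cst.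
  split; first by apply: integ_meas; exact: integ_cut.
  have := integ_cut (-1) 1 lc; congr integ; apply/funext => x.
  by rewrite /cut; case: ifP => _; rewrite ?expr1n ?expr0n.
have nc : nsq (cut (-1) 1 (fun _ : R => 1)) = 2.
  have : J (-1) 1 (fun _ : R => 1) = 1 * (1 - -1) by apply: J_cst; lra.
  rewrite J_cut => e; rewrite nsqE -[RHS](_ : 1 * (1 - -1) = 2 :> R); last by ring.
  rewrite -e; apply: eq_Rintegral => x _.
  by rewrite /cut; case: ifP => _; rewrite ?expr1n ?expr0n.
have A2 : A ^+ 2 <= 2 * nsq phi.
  have := cauchy_schwarz Lc La; rewrite nc.
  have -> : ip (cut (-1) 1 (fun _ : R => 1)) (fun x => `|phi x|) = A.
    by apply: eq_Rintegral => x _; rewrite /cut; case: ifP => _; rewrite ?mul1r ?mul0r.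
  have -> // : nsq (fun x => `|phi x|) = nsq phi.
  by rewrite !nsqE; apply: eq_Rintegral => x _; rewrite real_normK// num_real.
have : moment phi ^+ 2 <= (A + 2 * B) ^+ 2.
  by rewrite ler_pXn2r ?nnegrE// (le_trans m0).
by have := sqr_ge0 (A - 2 * B); nra.
Qed.

Lemma inner_expi f (t : R -> R) (c : R) : c != 0 ->
  integ (fun x => rePart f x * cos (t x)) -> integ (fun x => rePart f x * sin (t x)) ->
  integ (fun x => imPart f x * cos (t x)) -> integ (fun x => imPart f x * sin (t x)) ->
  inner f (fun x => expi (t x) / c%:C) = 0 ->
  int (fun x => rePart f x * cos (t x)) + int (fun x => imPart f x * sin (t x)) = 0 /\
  int (fun x => imPart f x * cos (t x)) - int (fun x => rePart f x * sin (t x)) = 0.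
Proof.
move=> c0 i1 i2 i3 i4.
have E x : f x * (expi (t x) / c%:C)^* =
    (c^-1 * (rePart f x * cos (t x) + imPart f x * sin (t x))) +i*
    (c^-1 * (imPart f x * cos (t x) - rePart f x * sin (t x))).
  rewrite -fmorphV /rePart /imPart /expi; case: (f x) => p q /=.
  by apply/complex_eqE; split => /=; ring.
rewrite /inner (funext E) /cintegral => /complex_eqE[/=].
rewrite !intZ; [|exact: integB|exact: integD].
rewrite intD// intB// => /eqP + /eqP; rewrite !mulf_eq0 invr_eq0 (negbTE c0)/=.
by move=> /eqP -> /eqP ->.
Qed.

End sequences.

(** * Orthogonality relations and their passage to the limit *)

Section orthogonality.
Context {R : realType}.
Implicit Types (phi p : R -> R) (x a s : R).

Local Notation mu := (@lebesgue_measure R).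
Local Notation meas f := (measurable_fun [set: R] f).
Local Notation int f := (Rintegral mu [set: R] f).
Local Notation normc := ComplexField.Normc.normc.

Lemma int0 : int (fun=> 0) = 0.
Proof. by rewrite /Rintegral integral0. Qed.

Lemma nsq0 : nsq (fun=> 0 : R) = 0.
Proof. by rewrite nsqE; under eq_fun do rewrite expr0n; exact: int0. Qed.

Lemma moment0 : moment (fun=> 0 : R) = 0.
Proof. by rewrite /moment; under eq_fun do rewrite normr0 mulr0; exact: int0. Qed.

Lemma integ_bounded phi (k : R -> R) : integ phi -> meas k ->
  (forall x, `|k x| <= 1) -> integ (fun x => phi x * k x).
Proof.
move=> Ip mk k1; apply: le_integ (integ_norm Ip).
  by apply: measurable_funM => //; exact: integ_meas.
by move=> x; rewrite normrM ler_piMr.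
Qed.

Lemma meas_cosM s : meas (fun x => cos (s * x)).
Proof.
apply: continuous_measurable_fun => x; apply: continuous_comp; last exact: continuous_cos.
by apply: cvgM => //; exact: cvg_cst.
Qed.

Lemma meas_sinM s : meas (fun x => sin (s * x)).
Proof.
apply: continuous_measurable_fun => x; apply: continuous_comp; last exact: continuous_sin.
by apply: cvgM => //; exact: cvg_cst.
Qed.

Lemma cos_norm_le1 x : `|cos x| <= 1.
Proof. by rewrite ler_norml cos_geN1 cos_le1. Qed.

Lemma sin_norm_le1 x : `|sin x| <= 1.
Proof. by rewrite ler_norml sin_geN1 sin_le1. Qed.

Lemma weighted_integ phi : meas phi -> integ (fun x => (1 + `|x|) * phi x) -> integ phi.
Proof.
move=> mp /integ_norm; apply: le_integ => // x.
by rewrite normrM ler_peMl// ger0_norm ?addr_ge0// lerDl.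
Qed.

Lemma int_le_moment phi (k : R -> R) : meas phi -> integ (fun x => (1 + `|x|) * phi x) ->
  meas k -> (forall x, `|k x| <= 1) -> `|int (fun x => phi x * k x)| <= moment phi.
Proof.
move=> mp Ip mk k1; have Iphi := weighted_integ mp Ip.
have Ik := integ_bounded Iphi mk k1.
apply: le_trans (le_normr_Rintegral _ Ik) _ => //.
apply: le_int; first exact: integ_norm.
  have := integ_norm Ip; congr integ; apply/funext => x.
  by rewrite normrM [`|1 + _|]ger0_norm ?addr_ge0.
move=> x; rewrite normrM.
have p0 := normr_ge0 (phi x); have x0 := normr_ge0 x; have := k1 x.
have := normr_ge0 (k x); nra.
Qed.

(** The integral of (p_m - p) k, for k a sine or cosine, is bounded by a moment that tends to 0, yet
    by orthogonality of p_m it equals - int (p k) for every m. So p is orthogonal to k too. *)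
Lemma resonant_data_sequence a (p_ : nat -> R -> R) p :
  (forall m, L2 (p_ m)) -> L2 p ->
  (forall m, integ (fun x => x * p_ m x)) -> integ (fun x => x * p x) ->
  (forall m, int (fun x => p_ m x * cos (Num.sqrt a * x)) = 0 /\
             int (fun x => p_ m x * sin (Num.sqrt a * x)) = 0) ->
  (fun m => nsq (fun x => p_ m x - p x)) @ \oo --> (0 : R) ->
  (fun m => int (fun x => `|x * (p_ m x - p x)|)) @ \oo --> (0 : R) ->
  [/\ forall m, resonant_data a (p_ m), resonant_data a p, forall m, resonant_data a (fun x => p_ m x - p x) &
    (fun m => nsq (fun x => p_ m x - p x) + moment (fun x => p_ m x - p x) ^+ 2)
      @ \oo --> (0 : R)].
Proof.
move=> Lp_ Lp Ip_ Ip orth cvg2 cvg1.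
have Ld m := L2B (Lp_ m) Lp.
have Id m : integ (fun x => x * (p_ m x - p x)).
  have := integB (Ip_ m) Ip; congr integ; apply/funext => x.
  by rewrite mulrBr.
have W_ m := (L2_moment (Lp_ m) (Ip_ m)).1.
have W := (L2_moment Lp Ip).1.
have Wd m : integ (fun x => (1 + `|x|) * (p_ m x - p x)) := (L2_moment (Ld m) (Id m)).1.
have cvgm : (fun m => moment (fun x => p_ m x - p x) ^+ 2) @ \oo --> (0 : R).
  apply: (le_cvg0 (t := fun m => 4 * nsq (fun x => p_ m x - p x) +
      8 * int (fun x => `|x * (p_ m x - p x)|) ^+ 2)).
    by move=> m; rewrite sqr_ge0 (L2_moment (Ld m) (Id m)).2.
  rewrite -[0 in X in _ --> X](_ : 4 * 0 + 8 * (0 * 0) = 0 :> R); last by ring.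
  apply: cvgD; apply: cvgM => //; try exact: cvg_cst.
  by under eq_fun do rewrite expr2; apply: cvgM.
have cvgm1 : (fun m => moment (fun x => p_ m x - p x)) @ \oo --> (0 : R).
  have m0 m : 0 <= moment (fun x => p_ m x - p x).
    by apply: int_ge0 => x; rewrite mulr_ge0// addr_ge0.
  rewrite (_ : (fun m => _) = fun m => Num.sqrt (moment (fun x => p_ m x - p x) ^+ 2)).
    by apply/sqrt_cvg0 => // m; exact: sqr_ge0.
  by apply/funext => m; rewrite sqrtr_sqr ger0_norm.
have lim (k : R -> R) : meas k -> (forall x, `|k x| <= 1) ->
    (forall m, int (fun x => p_ m x * k x) = 0) ->
    int (fun x => p x * k x) = 0 /\ forall m, int (fun x => (p_ m x - p x) * k x) = 0.
  move=> mk k1 ok.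
  have dE m : int (fun x => (p_ m x - p x) * k x) = - int (fun x => p x * k x).
    rewrite -[RHS]add0r -[X in X - _](ok m) -intB.
    - by apply: eq_Rintegral => x _; rewrite mulrBl.
    - exact: integ_bounded (weighted_integ (Lp_ m).1 (W_ m)) mk k1.
    - exact: integ_bounded (weighted_integ Lp.1 W) mk k1.
  have z : int (fun x => p x * k x) = 0.
    apply/eqP; rewrite -normr_eq0; apply/eqP.
    have c : (fun _ : nat => `|int (fun x => p x * k x)|) @ \oo --> (0 : R).
      apply: le_cvg0 cvgm1 => m; rewrite normr_ge0 -normrN -(dE m).
      exact: int_le_moment (Ld m).1 (Wd m) mk k1.
    exact: cvg_unique (@cvg_cst _ _ _ _ _) c.
  by split=> // m; rewrite dE z oppr0.
have [c0 cd] := lim _ (meas_cosM (Num.sqrt a)) (fun x => cos_norm_le1 _) (fun m => (orth m).1).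
have [s0 sd] := lim _ (meas_sinM (Num.sqrt a)) (fun x => sin_norm_le1 _) (fun m => (orth m).2).
split=> [m||m|]; [|by split|by split|].
- by have [] := orth m; split.
- by rewrite -(addr0 (0 : R)); exact: cvgD.
Qed.

(** One exponential gives two relations between four real integrals. The opposite exponential flips
    the sign of the sine integrals, and together they force all four to vanish. *)
Lemma inner_expi_pm (f : R -> R[i]) s (c : R) : c != 0 ->
  integ (rePart f) -> integ (imPart f) ->
  inner f (fun x => expi (s * x) / c%:C) = 0 ->
  inner f (fun x => expi (- (s * x)) / c%:C) = 0 ->
  (int (fun x => rePart f x * cos (s * x)) = 0 /\
   int (fun x => rePart f x * sin (s * x)) = 0) /\
  (int (fun x => imPart f x * cos (s * x)) = 0 /\
   int (fun x => imPart f x * sin (s * x)) = 0).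
Proof.
move=> c0 Ir Ii ep em.
have B k (g : R -> R) := fun Ig : integ g => integ_bounded Ig (meas_cosM k) (fun x => cos_norm_le1 _).
have D k (g : R -> R) := fun Ig : integ g => integ_bounded Ig (meas_sinM k) (fun x => sin_norm_le1 _).
have [e1 e2] := inner_expi c0 (B s _ Ir) (D s _ Ir) (B s _ Ii) (D s _ Ii) ep.
have N : (fun x => expi (- (s * x)) / c%:C) = (fun x => expi (- s * x) / c%:C).
  by apply/funext => x; rewrite mulNr.
rewrite N in em.
have [] := inner_expi c0 (B (- s) _ Ir) (D (- s) _ Ir) (B (- s) _ Ii) (D (- s) _ Ii) em.
have cE (g : R -> R) : int (fun x => g x * cos (- s * x)) = int (fun x => g x * cos (s * x)).
  by apply: eq_Rintegral => x _; rewrite mulNr cosN.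
have sE (g : R -> R) : integ g ->
    int (fun x => g x * sin (- s * x)) = - int (fun x => g x * sin (s * x)).
  move=> Ig; rewrite -[RHS]mulN1r -intZ; last exact: D.
  by apply: eq_Rintegral => x _; rewrite mulNr sinN; ring.
rewrite !cE !sE//; move: e1 e2.
move: (int _) (int _) (int _) (int _) => p q r t e1 e2 e3 e4; split; split; lra.
Qed.

End orthogonality.

Lemma Lp1_sub (R : realType) (f g : R -> R[i]) : Lp 1 f -> Lp 1 g -> Lp 1 (f \- g).
Proof.
move=> Lf Lg; have cm : cmeasurable (f \- g).
  split.
    rewrite (_ : (fun x => _) = fun x => complex.Re (f x) - complex.Re (g x)).
      exact: measurable_funB Lf.1.1 Lg.1.1.
    by apply/funext => x; exact: ReB.
  rewrite (_ : (fun x => _) = fun x => complex.Im (f x) - complex.Im (g x)).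
    exact: measurable_funB Lf.1.2 Lg.1.2.
  by apply/funext => x; exact: ImB.
have [_ ri ii] := Lp1_integ Lf; have [_ ri' ii'] := Lp1_integ Lg.
have I : integ (fun x => ComplexField.Normc.normc ((f \- g) x)).
  apply: le_integ (integD (integ_norm (integB ri ri')) (integ_norm (integB ii ii'))).
    exact: (cmeas_normc cm).
  move=> x; rewrite ger0_norm ?normc_nonneg// -ler_sqr ?nnegrE ?addr_ge0 ?normc_nonneg//.
  rewrite normc_sq ReB ImB -/(rePart _ x) -/(rePart g x) -/(imPart _ x) -/(imPart g x).
  rewrite -[X in X + _ <= _]real_normK ?num_real// -[X in _ + X <= _]real_normK ?num_real//.
  by rewrite sqrrD lerD2r lerDl mulrn_wge0 ?mulr_ge0.
by split=> //; rewrite (Lpnorm1E cm) -int_EFin// ltry.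
Qed.

Lemma cvg_Lp1 (R : realType) (f_ : nat -> R -> R[i]) (f : R -> R[i]) :
  (forall m, Lp 1 (f_ m)) -> cvg_Lp 1 f_ f ->
  (fun m => Rintegral (@lebesgue_measure R) [set: R]
    (fun x => ComplexField.Normc.normc (f_ m x - f x))) @ \oo --> (0 : R).
Proof.
move=> Lf_ [Lf cv]; move: cv.
rewrite (_ : (fun m => _) = fun m => (Rintegral (@lebesgue_measure R) [set: R]
    (fun x => ComplexField.Normc.normc (f_ m x - f x)))%:E).
  by move=> /fine_cvg.
apply/funext => m; have LD := Lp1_sub (Lf_ m) Lf.
by rewrite (Lpnorm1E LD.1) int_EFin//; have [] := Lp1_integ LD.
Qed.

Theorem theorem2 (R : realType) (a h : R) (a_gt0 : 0 < a) (h_neq0 : h != 0)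
    (f_ : nat -> R -> R[i]) (f : R -> R[i])
    (f_L2 : forall m, Lp 2 (f_ m)) (f_cvg : cvg_Lp 2 f_ f) :
  ((forall n : int, h <> 2 * pi * n%:~R / Num.sqrt a) ->
     solvable_in_sequences a h f_ f) /\
  ((exists n : int, n != 0 /\ h = 2 * pi * n%:~R / Num.sqrt a) ->
   (forall m, Lp 1 (fun x => x%:C * f_ m x)) ->
   cvg_Lp 1 (fun m x => x%:C * f_ m x) (fun x => x%:C * f x) ->
   (forall m,
     inner (f_ m) (fun x => expi (Num.sqrt a * x) / (Num.sqrt (2 * pi))%:C) = 0
     /\
     inner (f_ m) (fun x => expi (- (Num.sqrt a * x)) / (Num.sqrt (2 * pi))%:C)
       = 0) ->
     solvable_in_sequences a h f_ f).
Proof.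
have sa : Num.sqrt a != 0 by rewrite gt_eqF// sqrtr_gt0.
have Lf : Lp 2 f by case: f_cvg.
have [Lm Lr Ld] := Lp2_parts f_L2 Lf.
have c2 := cvg_Lp2 f_L2 f_cvg.
split=> [h2pi|[n [n0 hE]] xf_L1 xf_cvg orth].
- have ch : cos (Num.sqrt a * h) != 1.
    apply/eqP => /cos_eq1[n hn]; apply: (h2pi n).
    by rewrite -hn mulrC mulKf.
  apply: (solvable_of_well_posed (well_posed_a a_gt0 ch)) => //; first exact: L2_0.
  exact: nsq0.
have ph : Num.sqrt a * h = 0 + 2 * pi * n%:~R by rewrite hE mulrC divfK// add0r.
have sh : sin (Num.sqrt a * h) = 0 by rewrite ph (sincos_periodic n 0).2 sin0.
have ch : cos (Num.sqrt a * h) = 1 by rewrite ph (sincos_periodic n 0).1 cos0.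
have xre (g : R -> R[i]) : rePart (fun x => x%:C * g x) = fun x => x * rePart g x.
  by apply/funext => x; rewrite /rePart; case: (g x) => p q /=; ring.
have xim (g : R -> R[i]) : imPart (fun x => x%:C * g x) = fun x => x * imPart g x.
  by apply/funext => x; rewrite /imPart; case: (g x) => p q /=; ring.
have Dre m : rePart (f_ m \- f) = fun x => rePart (f_ m) x - rePart f x.
  by apply/funext => x; exact: ReB.
have Dim m : imPart (f_ m \- f) = fun x => imPart (f_ m) x - imPart f x.
  by apply/funext => x; exact: ImB.
have xfL : Lp 1 (fun x => x%:C * f x) by case: xf_cvg.
have [_ ir ii] := Lp1_integ xfL; rewrite xre xim in ir ii.
have ir_ m : integ (fun x => x * rePart (f_ m) x).
  by have [_ + _] := Lp1_integ (xf_L1 m); rewrite xre.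
have ii_ m : integ (fun x => x * imPart (f_ m) x).
  by have [_ _ +] := Lp1_integ (xf_L1 m); rewrite xim.
have c1 := cvg_Lp1 xf_L1 xf_cvg.
have In m := (Lp1_integ (Lp1_sub (xf_L1 m) xfL)).
have cn : Num.sqrt (2 * pi) != 0 :> R by rewrite gt_eqF// sqrtr_gt0 mulr_gt0 ?pi_gt0.
(* Both parts of f_m are integrable: near 0 because f_m is in L^2, away from 0 because x f_m is in
   L^1. *)
have orthm m := inner_expi_pm cn
  (weighted_integ (Lm m).1.1 (L2_moment (Lm m).1 (ir_ m)).1)
  (weighted_integ (Lm m).2.1 (L2_moment (Lm m).2 (ii_ m)).1) (orth m).1 (orth m).2.
have c2r : (fun m => nsq (fun x => rePart (f_ m) x - rePart f x)) @ \oo --> (0 : R).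
  by apply: le_cvg0 c2 => m; rewrite nsq_ge0 -Dre lerDl nsq_ge0.
have c1r : (fun m => Rintegral (@lebesgue_measure R) [set: R]
    (fun x => `|x * (rePart (f_ m) x - rePart f x)|)) @ \oo --> (0 : R).
  apply: le_cvg0 c1 => m; rewrite int_ge0//=; have [I1 I2 _] := In m.
  have E x : x * (rePart (f_ m) x - rePart f x) =
      rePart ((fun y => y%:C * f_ m y) \- (fun y => y%:C * f y)) x.
    by rewrite [RHS]ReB -!/(rePart (fun y => y%:C * _ y) x) !xre mulrBr.
  apply: le_int => // [|x]; last by rewrite E normc_re.
  by under eq_fun do rewrite E; exact: integ_norm.
have c2i : (fun m => nsq (fun x => imPart (f_ m) x - imPart f x)) @ \oo --> (0 : R).
  by apply: le_cvg0 c2 => m; rewrite nsq_ge0 -Dim lerDr nsq_ge0.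
have c1i : (fun m => Rintegral (@lebesgue_measure R) [set: R]
    (fun x => `|x * (imPart (f_ m) x - imPart f x)|)) @ \oo --> (0 : R).
  apply: le_cvg0 c1 => m; rewrite int_ge0//=; have [I1 _ I2] := In m.
  have E x : x * (imPart (f_ m) x - imPart f x) =
      imPart ((fun y => y%:C * f_ m y) \- (fun y => y%:C * f y)) x.
    by rewrite [RHS]ImB -!/(imPart (fun y => y%:C * _ y) x) !xim mulrBr.
  apply: le_int => // [|x]; last by rewrite E normc_im.
  by under eq_fun do rewrite E; exact: integ_norm.
(* As the orthogonality has been split into real relations, the real and the imaginary parts are
   resonant data separately. *)
have [ar_ ar adr cr] := resonant_data_sequence (fun m => (Lm m).1) Lr.1 ir_ ir
  (fun m => (orthm m).1) c2r c1r.
have [ai_ ai adi ci] := resonant_data_sequence (fun m => (Lm m).2) Lr.2 ii_ ii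
  (fun m => (orthm m).2) c2i c1i.
apply: (solvable_of_well_posed (well_posed_b a_gt0 h_neq0 sh ch)) => //.
- split; first exact: L2_0.
  + by under eq_fun do rewrite mulr0; exact: integ0.
  + by under eq_fun do rewrite mul0r; exact: int0.
  + by under eq_fun do rewrite mul0r; exact: int0.
- by rewrite nsq0 moment0 expr0n addr0.
- by move=> m; rewrite Dre Dim.
- rewrite -(addr0 (0 : R)); under eq_fun do rewrite Dre Dim.
  exact: cvgD.
Qed.
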